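(* Consider the downlink SWIPT model described in the context with $M>K$ and zero-forcing precoding: with $\hat{\mathbf{H}}=[\hat{\mathbf{h}}_1,\dots,\hat{\mathbf{h}}_K]$ and $\boldsymbol{\epsilon}_k$ the $k$-th column of $\mathbf{I}_K$, $$\mathbf{w}_k=\frac{\hat{\mathbf{H}}(\hat{\mathbf{H}}^H\hat{\mathbf{H}})^{-1}\boldsymbol{\epsilon}_k}{\sqrt{\mathbb{E}\{\|\hat{\mathbf{H}}(\hat{\mathbf{H}}^H\hat{\mathbf{H}})^{-1}\boldsymbol{\epsilon}_k\|^2\}}}.$$ Then for every $k$, $$E_k\ \ge\ \underline{E}^{\mathrm{ZF}}_k=\frac{T_D}{T}\eta_{\mathrm{EH}}(1-\alpha_k)\Big[\rho_{\mathrm{RF}}p^s_k(M-K)(\beta_k-e_k)+\sum_{k'=1}^K\rho_{\mathrm{RF}}p^s_{k'}e_k\Big],$$ and $$R^D_k\ \ge\ \underline{R}^{\mathrm{ZF},D}_k=\frac{T_D}{T}\log_2\!\Big(1+\frac{\rho_{\mathrm{RF}}p^s_k\alpha_k(M-K)(\beta_k-e_k)}{\alpha_ke_k\sum_{k'=1}^K\rho_{\mathrm{RF}}p^s_{k'}+\alpha_k\sigma^2_{\mathrm{RF},k}+\sigma^2_{k,s}}\Big).$$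
   Context: Let $M,K,T$ be positive integers, $\tau=K$, $T_D\ge 0$ an integer. Let $\Phi\in\mathbb{C}\setminus\{0\}$, $\rho>0$, $\sigma^2>0$, and let $\mathbf{D}$ be an $M\times M$ diagonal matrix with unit-modulus diagonal entries. For $k=1,\dots,K$: $\beta_k>0$, $p^p_k>0$; the channels $\mathbf{h}_k\sim\mathcal{CN}(\mathbf{0},\beta_k\mathbf{I}_M)$ are mutually independent; the pilot observation is $\mathbf{y}_k=\sqrt{\rho\tau p^p_k}\,\Phi\mathbf{D}\mathbf{h}_k+\mathbf{z}_k$ with $\mathbf{z}_k\sim\mathcal{CN}(\mathbf{0},\sigma^2\mathbf{I}_M)$ mutually independent and independent of the channels; the channel estimate is $$\hat{\mathbf{h}}_k=\frac{\rho\beta_k\tau p^p_k|\Phi|^2}{\rho\beta_k\tau p^p_k|\Phi|^2+\sigma^2}\mathbf{h}_k+\frac{\sqrt{\rho\tau p^p_k}\,\beta_k\Phi^*}{\rho\beta_k\tau p^p_k|\Phi|^2+\sigma^2}\mathbf{D}^H\mathbf{z}_k,$$ and $e_k=\frac{\beta_k\sigma^2}{\rho\tau p^p_k\beta_k|\Phi|^2+\sigma^2}$. Downlink parameters: $\rho_{\mathrm{RF}}>0$, SWIPT powers $p^s_k\ge0$, noise variances $\sigma^2_{\mathrm{RF},k}>0$ and $\sigma^2_{k,s}>0$, power-splitting coefficients $\alpha_k\in[0,1]$, energy conversion efficiency $\eta_{\mathrm{EH}}\in(0,1]$, and precoding vectors $\mathbf{w}_k\in\mathbb{C}^M$. Define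 the harvested energy $$E_k=\frac{T_D}{T}\eta_{\mathrm{EH}}(1-\alpha_k)\,\mathbb{E}\Big\{\Big|\mathbf{h}_k^H\sum_{k'=1}^K\sqrt{\rho_{\mathrm{RF}}p^s_{k'}}\,\mathbf{w}_{k'}\Big|^2\Big\},$$ the downlink SINR $$\mathrm{SINR}^D_k=\frac{\alpha_k\rho_{\mathrm{RF}}p^s_k|\mathbb{E}\{\mathbf{h}_k^H\mathbf{w}_k\}|^2}{\alpha_k\Big(\sum_{k'=1}^K\rho_{\mathrm{RF}}p^s_{k'}\mathbb{E}\{|\mathbf{h}_k^H\mathbf{w}_{k'}|^2\}-\rho_{\mathrm{RF}}p^s_k|\mathbb{E}\{\mathbf{h}_k^H\mathbf{w}_k\}|^2+\sigma^2_{\mathrm{RF},k}\Big)+\sigma^2_{k,s}},$$ and the downlink rate $R^D_k=\frac{T_D}{T}\log_2(1+\mathrm{SINR}^D_k)$. All expectations are over channels and pilot noise. *)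

(* Defs.v *)
From HB Require Import structures.
From mathcomp Require Import all_boot all_order all_algebra.
From mathcomp Require Import all_classical all_reals all_analysis.
From mathcomp Require Import complex.
Set Implicit Arguments. Unset Strict Implicit. Unset Printing Implicit Defensive.
Import Order.TTheory GRing.Theory Num.Theory.
Import numFieldNormedType.Exports.
Local Open Scope classical_set_scope.
Local Open Scope ring_scope.

Section Defs.
Context {R : realType}.

Definition RC (x : R) : R[i] := Complex x 0.

Definition cabs2 (z : R[i]) : R := complex.Re z ^+ 2 + complex.Im z ^+ 2.

Definition cconj (z : R[i]) : R[i] := Complex (complex.Re z) (- complex.Im z).

Definition cdot (M : nat) (u v : 'cV[R[i]]_M) : R[i] :=
  \sum_(m < M) cconj (u m 0) * v m 0.

Definition cnorm2 (M : nat) (u : 'cV[R[i]]_M) : R :=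
  \sum_(m < M) cabs2 (u m 0).

Definition ctr (m n : nat) (A : 'M[R[i]]_(m, n)) : 'M[R[i]]_(n, m) :=
  (map_mx cconj A)^T.

Definition log2 (x : R) : R := ln x / ln 2.

Context {d : measure_display} {Omega : measurableType d}.

Definition rexp (P : probability Omega R) (X : Omega -> R) : R :=
  \int[P]_(w in setT) X w.

Definition cexp (P : probability Omega R) (Z : Omega -> R[i]) : R[i] :=
  Complex (rexp P (fun w => complex.Re (Z w))) (rexp P (fun w => complex.Im (Z w))).

Definition mutually_independent (P : probability Omega R) (I : finType)
    (X : I -> Omega -> R) : Prop :=
  forall B : I -> set R, (forall i, measurable (B i)) ->
    P (\bigcap_(i in [set: I]) (X i @^-1` B i)) =
    (\prod_(i : I) P (X i @^-1` B i))%E.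

(* X is a real random variable with law N(0, s^2)  (s = standard deviation) *)
Definition normal_rv (P : probability Omega R) (X : Omega -> R) (s : R) : Prop :=
  measurable_fun setT X /\
  forall B : set R, measurable B -> P (X @^-1` B) = normal_prob 0 s B.


Variables (M K : nat).

(* MMSE-type channel estimate, as given in the context:
   hhat_k = c1 h_k + c2 D^H z_k, with D = diag(dD), tau = K *)
Definition hhat (rho sigma2 : R) (Phi : R[i]) (dD : 'I_M -> R[i])
    (beta pp : 'I_K -> R) (h z : 'I_K -> Omega -> 'cV[R[i]]_M)
    (k : 'I_K) (w : Omega) : 'cV[R[i]]_M :=
  let tau := (K%:R : R) in
  let den := rho * beta k * tau * pp k * cabs2 Phi + sigma2 in
  RC (rho * beta k * tau * pp k * cabs2 Phi / den) *: h k w +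
  (RC (Num.sqrt (rho * tau * pp k) * beta k / den) * cconj Phi) *:
    (\col_(m < M) (cconj (dD m) * z k w m 0)).

Definition err_var (rho sigma2 : R) (Phi : R[i]) (beta pp : 'I_K -> R)
    (k : 'I_K) : R :=
  beta k * sigma2 / (rho * (K%:R : R) * pp k * beta k * cabs2 Phi + sigma2).

Definition Hmat (hh : 'I_K -> Omega -> 'cV[R[i]]_M) (w : Omega) :
    'M[R[i]]_(M, K) := \matrix_(m < M, j < K) hh j w m 0.

Definition unitvec (k : 'I_K) : 'cV[R[i]]_K := \col_(j < K) (j == k)%:R.

Definition zf_dir (hh : 'I_K -> Omega -> 'cV[R[i]]_M) (k : 'I_K) (w : Omega) :
    'cV[R[i]]_M :=
  let H := Hmat hh w in H *m invmx (ctr H *m H) *m unitvec k.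

Definition zf_precoder (P : probability Omega R)
    (hh : 'I_K -> Omega -> 'cV[R[i]]_M) (k : 'I_K) (w : Omega) : 'cV[R[i]]_M :=
  RC (Num.sqrt (rexp P (fun w' => cnorm2 (zf_dir hh k w'))))^-1 *: zf_dir hh k w.

Definition harvested (P : probability Omega R) (TD T : nat) (etaEH rhoRF : R)
    (alpha ps : 'I_K -> R) (h wp : 'I_K -> Omega -> 'cV[R[i]]_M) (k : 'I_K) : R :=
  (TD%:R / T%:R) * etaEH * (1 - alpha k) *
  rexp P (fun w => cabs2 (cdot (h k w)
     (\sum_(k' < K) RC (Num.sqrt (rhoRF * ps k')) *: wp k' w))).

Definition sinrD (P : probability Omega R) (rhoRF : R)
    (alpha ps sRF2 ss2 : 'I_K -> R) (h wp : 'I_K -> Omega -> 'cV[R[i]]_M)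
    (k : 'I_K) : R :=
  let S := rhoRF * ps k * cabs2 (cexp P (fun w => cdot (h k w) (wp k w))) in
  alpha k * S /
  (alpha k * (\sum_(k' < K) rhoRF * ps k' *
                rexp P (fun w => cabs2 (cdot (h k w) (wp k' w)))
              - S + sRF2 k) + ss2 k).

Definition rateD (P : probability Omega R) (TD T : nat) (rhoRF : R)
    (alpha ps sRF2 ss2 : 'I_K -> R) (h wp : 'I_K -> Omega -> 'cV[R[i]]_M)
    (k : 'I_K) : R :=
  (TD%:R / T%:R) * log2 (1 + sinrD P rhoRF alpha ps sRF2 ss2 h wp k).

End Defs.

(* Main.v *)
Require Import Defs.
From HB Require Import structures.
From mathcomp Require Import all_boot all_order all_algebra.
From mathcomp Require Import all_classical all_reals all_analysis.
From mathcomp Require Import complex measurable_realfun ring lra.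
Import Order.TTheory GRing.Theory Num.Theory.
Import numFieldNormedType.Exports.
Set Implicit Arguments. Unset Strict Implicit. Unset Printing Implicit Defensive.
Local Open Scope classical_set_scope.
Local Open Scope ring_scope.

(* The MMSE estimates and the estimation errors are obtained from the independent
   Gaussian coordinates by rotations and scalings of coordinate planes, so they are again
   independent Gaussian vectors, with variances g_k = beta_k - e_k and e_k. The precoders
   depend on the estimates only and are orthogonal to the other estimated channels, so the
   expected powers become explicit in terms of n_k = E N_kk and E Re N_ab (a <> b), where
   N is the inverse of the Gram matrix A of the estimates. It remains to see that
   n_k <= 1 / ((M - K) g_k) and E Re N_ab = 0. Rather than from the inverse Wishart law, both
   follow from Gaussian integration by parts for B = (A + eps)^-1, which gives
     delta_ab - eps E Re B_ab = g_a E (Re B_ab (M - K + eps tr B)),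
   by letting eps tend to 0. The same identity shows that A is almost surely invertible. *)

(** * Linear maps of Gaussian pairs *)

(** Independence is given on products of Borel sets of the real coordinates, and no density of the
    whole family is formed: one coordinate at a time is replaced by a fresh Gaussian variable, which
    reduces expectations to one-dimensional integrals. The obstacle is that A is singular at some
    points, near which N is unbounded; the shift by eps makes B smooth with entries of size at most
    1 / eps, as one-dimensional integration by parts demands. The factor M - K + eps tr B is the
    trace of 1 - Pi, where Pi = H B H^H is a smoothed projection onto the column space of H; the
    other terms of the derivative cancel between the real and the imaginary direction of each entry.
    Since 1 / n_k enters the energy and the SINR only through numerators, an upper bound on n_k
    suffices, and Fatou's lemma delivers it. The off-diagonal limit is an equality and needs a
    dominating function, found in B_aa <= N_aa. Real parts of N_ab suffice because the columns of H
    N are combined with real coefficients only. *)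

Section gaussian_integrals.
Context {R : realType}.
Local Notation leb := (@lebesgue_measure R).

(** Lebesgue measure is determined by its values on half-open intervals. For [a < 0] the preimage of
    such an interval is closed at the other end, hence the two cases. *)
Lemma lebesgue_measure_affine (a b : R) (A : set R) : a != 0 -> measurable A ->
  leb A = (`|a|%:E * leb ((fun x => (a * x + b)%R) @^-1` A))%E.
Proof.
move=> a0 mA.
pose phi : R -> measurableTypeR R := fun x => a * x + b.
have mphi : measurable_fun setT phi by apply: measurable_funD => //; exact: measurable_funM.
pose r : {nonneg R} := NngNum (normr_ge0 a).
pose nu := mscale r (pushforward leb phi).
suff h X : ocitv X -> leb X = nu mphi X by exact: (@lebesgue_measure_unique R (nu mphi) h A mA).
case=> -[c d] _ <-; rewrite /=.
change (nu mphi [set` `]c, d]]) with (`|a|%:E * leb (phi @^-1` [set` `]c, d]]))%E.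
rewrite [LHS]lebesgue_measure_itv [LHS]/= lte_fin.
have [an|ap] : a < 0 \/ 0 < a by apply/orP; rewrite -neq_lt.
- have -> : phi @^-1` [set` `]c, d]] = [set` `[(d - b) / a, (c - b) / a[].
    apply/seteqP; split => x /=; rewrite /phi !in_itv/=;
      by rewrite ltr_ndivlMr// ler_ndivrMr// ltrBlDr lerBrDr (mulrC x) andbC.
  rewrite lebesgue_measure_itv/= lte_fin ltr_nM2r ?invr_lt0// ltrD2r.
  case: ifPn => _; last by rewrite mule0.
  rewrite -!EFinD -EFinM ltr0_norm//; congr (_%:E); field; exact: a0.
- have -> : phi @^-1` [set` `]c, d]] = [set` `](c - b) / a, (d - b) / a]].
    apply/seteqP; split => x /=; rewrite /phi !in_itv/=;
      by rewrite ltr_pdivrMr// ler_pdivlMr// ltrBlDr lerBrDr (mulrC x).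
  rewrite lebesgue_measure_itv/= lte_fin ltr_pM2r ?invr_gt0// ltrD2r.
  case: ifPn => _; last by rewrite mule0.
  rewrite -!EFinD -EFinM gtr0_norm//; congr (_%:E); field; exact: a0.
Qed.

Lemma ge0_integral_affine (a b : R) (f : R -> \bar R) : a != 0 ->
  measurable_fun setT f -> (forall x, (0 <= f x)%E) ->
  (\int[leb]_x f x = `|a|%:E * \int[leb]_x f (a * x + b)%R)%E.
Proof.
move=> a0 mf f0.
pose phi : R -> measurableTypeR R := fun x => a * x + b.
have mphi : measurable_fun setT phi by apply: measurable_funD => //; exact: measurable_funM.
pose r : {nonneg R} := NngNum (normr_ge0 a).
pose nu := mscale r (pushforward leb phi).
transitivity (\int[nu mphi]_x f x)%E.
  apply: eq_measure_integral => A mA _.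
  exact: lebesgue_measure_affine.
by rewrite /nu ge0_integral_mscale//= ge0_integral_pushforward.
Qed.

(** The Radon-Nikodym derivative of the normal law and its density have the same integral over every
    measurable set, so they agree almost everywhere. *)
Lemma ge0_integral_normal_prob (s : R) (f : R -> \bar R) :
  measurable_fun setT f -> (forall x, (0 <= f x)%E) ->
  (\int[normal_prob 0 s]_x f x = \int[leb]_x (f x * (normal_pdf 0 s x)%:E))%E.
Proof.
move=> mf f0.
have dom := @normal_prob_dominates R 0 s.
rewrite -(Radon_Nikodym_SigmaFinite.change_of_variables dom f0 measurableT mf).
have RNi := Radon_Nikodym_SigmaFinite.f_integrable dom.
apply: ae_eq_integral => //.
- by apply: emeasurable_funM => //; exact: (measurable_int _ RNi).
- apply: emeasurable_funM => //.
  by apply: measurableT_comp => //=; exact: measurable_normal_pdf.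
- apply: ae_eqe_mul2l => /=.
  apply: integral_ae_eq => //.
  + by apply: measurableT_comp => //=; exact: measurable_normal_pdf.
  + by move=> E _ mE; rewrite -Radon_Nikodym_SigmaFinite.f_integral.
Qed.

End gaussian_integrals.

Section bivariate.
Context {R : realType}.
Local Notation leb := (@lebesgue_measure R).

Lemma normal_pdf_gt0E (s x : R) : 0 < s ->
  normal_pdf 0 s x = s^-1 * (Num.sqrt (pi *+ 2))^-1 * expR (- (x / s) ^+ 2 / 2).
Proof.
move=> s0; rewrite normal_pdfE ?gt_eqF// /normal_peak /normal_fun subr0.
rewrite -mulrnAr sqrtrM ?sqr_ge0// sqrtr_sqr gtr0_norm// invfM; congr (_ * expR _).
have := gt_eqF s0; rewrite -mulr_natr => /negbT s0'.
by field.
Qed.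

(** The equation equal to 0 says that the forms a x + b y and c x + d y are uncorrelated. Lagrange's
    identity then gives t1 t2 = |ad - bc| s1 s2, which matches the normalizing constants, and the
    same relation matches the exponents. *)
Lemma normal_pdf_linear (a b c d s1 s2 t1 t2 u v : R) :
  0 < s1 -> 0 < s2 -> 0 < t1 -> 0 < t2 -> a * d - b * c != 0 ->
  a * c * s1 ^+ 2 + b * d * s2 ^+ 2 = 0 ->
  t1 ^+ 2 = a ^+ 2 * s1 ^+ 2 + b ^+ 2 * s2 ^+ 2 ->
  t2 ^+ 2 = c ^+ 2 * s1 ^+ 2 + d ^+ 2 * s2 ^+ 2 ->
  normal_pdf 0 s1 ((d * u - b * v) / (a * d - b * c)) *
  normal_pdf 0 s2 ((a * v - c * u) / (a * d - b * c)) / `|a * d - b * c| =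
  normal_pdf 0 t1 u * normal_pdf 0 t2 v.
Proof.
move=> s10 s20 t10 t20; set D := a * d - b * c => D0 orth t1E t2E.
have tt : t1 * t2 = `|D| * s1 * s2.
  apply/eqP; rewrite -(@eqrXn2 _ 2)//; last 2 first.
  - by rewrite mulr_ge0// ltW.
  - by rewrite !mulr_ge0// ltW.
  rewrite !exprMn real_normK ?num_real// t1E t2E /D; apply/eqP.
  transitivity ((a * c * s1 ^+ 2 + b * d * s2 ^+ 2) ^+ 2
     + (a * d - b * c) ^+ 2 * s1 ^+ 2 * s2 ^+ 2); first by ring.
  by rewrite orth expr0n add0r.
have ne (x : R) : 0 < x -> x != 0 by move=> ?; rewrite gt_eqF.
rewrite !normal_pdf_gt0E//.
have eE : - (u / t1) ^+ 2 / 2 + - (v / t2) ^+ 2 / 2 =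
    - ((d * u - b * v) / D / s1) ^+ 2 / 2 + - ((a * v - c * u) / D / s2) ^+ 2 / 2.
  have [n1 n2 n3 n4] := And4 (ne _ s10) (ne _ s20) (ne _ t10) (ne _ t20).
  have tt2 : t1 ^+ 2 * t2 ^+ 2 = D ^+ 2 * s1 ^+ 2 * s2 ^+ 2.
    by rewrite -exprMn tt !exprMn real_normK ?num_real.
  transitivity (- (t2 ^+ 2 * u ^+ 2 + t1 ^+ 2 * v ^+ 2) / (t1 ^+ 2 * t2 ^+ 2) / 2).
    by field; rewrite n3 n4.
  rewrite tt2 t1E t2E.
  transitivity (- ((d * u - b * v) ^+ 2 * s2 ^+ 2 + (a * v - c * u) ^+ 2 * s1 ^+ 2
      + (a * c * s1 ^+ 2 + b * d * s2 ^+ 2) * (u * v) *+ 2) / (D ^+ 2 * s1 ^+ 2 * s2 ^+ 2) / 2).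
    congr (- _ / _ / _); ring.
  by rewrite orth mul0r mul0rn addr0; field; rewrite D0 n1 n2.
set q := (Num.sqrt _)^-1.
transitivity ((`|D| * s1 * s2)^-1 * q ^+ 2 *
    expR (- (u / t1) ^+ 2 / 2 + - (v / t2) ^+ 2 / 2)).
  by rewrite eE expRD !invfM; ring.
by rewrite -tt expRD invfM; ring.
Qed.

Lemma ge0_integral_normal_prod (s1 s2 : R) (f : R * R -> \bar R) :
  measurable_fun setT f -> (forall x, (0 <= f x)%E) ->
  (\int[normal_prob 0 s1 \x normal_prob 0 s2]_p f p =
   \int[leb]_x \int[leb]_y (f (x, y) * (normal_pdf 0 s1 x * normal_pdf 0 s2 y)%:E))%E.
Proof.
move=> mf f0.
rewrite fubini_tonelli1//= ge0_integral_normal_prob//; first last.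
- by move=> x; apply: integral_ge0.
- exact: (measurable_fun_fubini_tonelli_F (m2 := normal_prob 0 s2)).
apply: eq_integral => x _ /=.
rewrite /fubini_F/= ge0_integral_normal_prob//; last exact: measurableT_comp.
rewrite -ge0_integralZr//.
- by apply: eq_integral => y _; rewrite EFinM muleA muleAC.
- apply: emeasurable_funM; first exact: measurableT_comp.
  by apply: measurableT_comp => //=; exact: measurable_normal_pdf.
- by move=> y _; rewrite mule_ge0// lee_fin normal_pdf_ge0.
- by rewrite lee_fin normal_pdf_ge0.
Qed.

(* Two successive one-dimensional substitutions, exchanging the order of integration in between. *)
Lemma ge0_integral_normal_linear (a b c d s1 s2 t1 t2 : R) (f : R * R -> \bar R) :
  0 < s1 -> 0 < s2 -> 0 < t1 -> 0 < t2 -> a != 0 -> a * d - b * c != 0 ->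
  a * c * s1 ^+ 2 + b * d * s2 ^+ 2 = 0 ->
  t1 ^+ 2 = a ^+ 2 * s1 ^+ 2 + b ^+ 2 * s2 ^+ 2 ->
  t2 ^+ 2 = c ^+ 2 * s1 ^+ 2 + d ^+ 2 * s2 ^+ 2 ->
  measurable_fun setT f -> (forall x, (0 <= f x)%E) ->
  (\int[normal_prob 0 s1 \x normal_prob 0 s2]_p
      f (a * p.1 + b * p.2, c * p.1 + d * p.2)%R =
   \int[normal_prob 0 t1 \x normal_prob 0 t2]_p f p)%E.
Proof.
move=> s10 s20 t10 t20 a0; set D := a * d - b * c => D0 orth t1E t2E mf f0.
have mlin (al be : R) : measurable_fun setT (fun p : R * R => al * p.1 + be * p.2).
  by apply: measurable_funD; apply: measurable_funM.
have mpdf (s : R) (g : R * R -> R) : measurable_fun setT g ->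
    measurable_fun setT (fun p => normal_pdf 0 s (g p)).
  by move=> mg; apply: measurableT_comp => //; exact: measurable_normal_pdf.
pose g (p : R * R) := f (a * p.1 + b * p.2, c * p.1 + d * p.2)%R.
have mg : measurable_fun setT g.
  by apply: measurableT_comp => //; apply: measurable_fun_pair; exact: mlin.
have g0 p : (0 <= g p)%E by exact: f0.
apply: etrans; first exact: (ge0_integral_normal_prod s1 s2 mg g0).
apply: etrans; last exact: (esym (ge0_integral_normal_prod t1 t2 mf f0)).
pose F1 (p : R * R) := (g p *
   (normal_pdf 0 s1 p.1 * normal_pdf 0 s2 p.2)%:E)%E.
have mF1 : measurable_fun setT F1.
  apply: emeasurable_funM => //.
  by apply: measurableT_comp => //; apply: measurable_funM; exact: mpdf.
have F10 p : (0 <= F1 p)%E by rewrite mule_ge0 ?f0// lee_fin mulr_ge0 ?normal_pdf_ge0.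
apply: etrans; first exact: (@fubini_tonelli _ _ _ _ _ leb leb F1 mF1 F10).
(* Substitution x = (u - b y) / a at fixed y; afterwards y = (a v - c u) / D at fixed u. The
   Jacobian factors 1 / |a| and |a / D| multiply to 1 / |D|. *)
pose F2 (p : R * R) := F1 (a^-1 * p.1 + (- b / a) * p.2, p.2)%R.
have mF2 : measurable_fun setT F2.
  by apply: measurableT_comp => //; apply: measurable_fun_pair => //; exact: mlin.
have F20 p : (0 <= F2 p)%E by exact: F10.
have D0' : a * d - b * c != 0 by exact: D0.
have aV0 : a^-1 != 0 by rewrite invr_eq0.
have aD0 : a / D != 0 by rewrite mulf_neq0// invr_eq0.
pose F2' (p : R * R) := (`|a^-1|%:E * F2 p)%E.
have mF2' : measurable_fun setT F2' by exact: emeasurable_funM.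
have F2'0 p : (0 <= F2' p)%E by rewrite mule_ge0// lee_fin.
transitivity (\int[leb]_y \int[leb]_x F2' (x, y))%E.
  apply: eq_integral => y _.
  apply: etrans.
    exact: (ge0_integral_affine (- b / a * y) aV0 (measurable_fun_pair1 y mF1) (fun x => F10 (x, y))).
  by rewrite /F2' [RHS]ge0_integralZl//; exact: (measurable_fun_pair1 y mF2).
apply: etrans; first exact: (esym (@fubini_tonelli _ _ _ _ _ leb leb F2' mF2' F2'0)).
apply: eq_integral => u _.
apply: etrans.
  exact: (ge0_integral_affine (- c / D * u) aD0 (measurable_fun_pair2 u mF2') (fun x => F2'0 (u, x))).
rewrite -[LHS]ge0_integralZl//; last first.
  apply: (measurable_fun_pair2 (f := fun p => F2' (p.1, a / D * p.2 + - c / D * p.1)%R) u).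
  apply: measurableT_comp => //; apply: measurable_fun_pair => //.
  by apply: measurable_funD; apply: measurable_funM.
apply: eq_integral => v _.
rewrite /F2' /F2 /F1 /g/=.
have -> : a * (a^-1 * u + - b / a * (a / D * v + - c / D * u)) +
   b * (a / D * v + - c / D * u) = u by field; rewrite a0 D0.
have -> : c * (a^-1 * u + - b / a * (a / D * v + - c / D * u)) +
   d * (a / D * v + - c / D * u) = v by rewrite /D; field; rewrite a0 D0'.
have -> : a^-1 * u + - b / a * (a / D * v + - c / D * u) = (d * u - b * v) / D.
  by rewrite /D; field; rewrite a0 D0'.
have -> : a / D * v + - c / D * u = (a * v - c * u) / D by field.
rewrite -(@normal_pdf_linear a b c d s1 s2 t1 t2 u v)// -/D.
rewrite muleA -EFinM muleCA -EFinM; congr (_ * _%:E)%E.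
by rewrite -normrM mulrAC divff// mul1r normfV mulrC.
Qed.

Lemma normal_prob_linear (a b c d s1 s2 t1 t2 : R) (A B : set R) :
  0 < s1 -> 0 < s2 -> 0 < t1 -> 0 < t2 -> a != 0 -> a * d - b * c != 0 ->
  a * c * s1 ^+ 2 + b * d * s2 ^+ 2 = 0 ->
  t1 ^+ 2 = a ^+ 2 * s1 ^+ 2 + b ^+ 2 * s2 ^+ 2 ->
  t2 ^+ 2 = c ^+ 2 * s1 ^+ 2 + d ^+ 2 * s2 ^+ 2 ->
  measurable A -> measurable B ->
  ((normal_prob 0 s1 \x normal_prob 0 s2)
     [set p | A (a * p.1 + b * p.2)%R /\ B (c * p.1 + d * p.2)%R] =
   normal_prob 0 t1 A * normal_prob 0 t2 B)%E.
Proof.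
move=> s10 s20 t10 t20 a0 D0 orth t1E t2E mA mB.
have mAB : measurable (A `*` B) by exact: measurableX.
have mlin (al be : R) : measurable_fun setT (fun p : R * R => al * p.1 + be * p.2).
  by apply: measurable_funD; apply: measurable_funM.
pose f (p : R * R) : \bar R := (\1_(A `*` B) p)%:E.
have mf : measurable_fun setT f by exact: measurableT_comp.
have f0 p : (0 <= f p)%E by rewrite lee_fin.
apply: etrans; last exact: (product_measure1E (normal_prob 0 t1) (normal_prob 0 t2) mA mB).
have key := ge0_integral_normal_linear s10 s20 t10 t20 a0 D0 orth t1E t2E mf f0.
apply: etrans; last (apply: (etrans key); apply: etrans; first exact: integral_indic).
  set S := [set p | _].
  have mS : measurable S.
    by have := measurable_fun_pair (mlin a b) (mlin c d) measurableT mAB; rewrite setTI.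
  have := @integral_indic _ _ _ (normal_prob 0 s1 \x normal_prob 0 s2)%E setT measurableT S mS.
  rewrite setIT => /esym e; apply: (etrans e); apply: eq_integral => p _.
  by rewrite /f !indicE.
by rewrite setIT.
Qed.

End bivariate.

(** * Families of independent Gaussian variables *)

Section law.
Context {R : realType} {d1 d2 : measure_display}.
Context {T1 : measurableType d1} {T2 : measurableType d2}.

Definition mfun_of (f : T1 -> T2) (mf : measurable_fun setT f) : {mfun T1 >-> T2} :=
  HB.pack f (isMeasurableFun.Build _ _ _ _ _ mf).

Definition law (P : probability T1 R) (f : T1 -> T2) (mf : measurable_fun setT f) :
  probability T2 R := distribution P (mfun_of mf).

(** Unlike [law], this applies to measures of any mass, in particular to the restriction of [P] to
    an event. *)
Definition pushmeasure (m : {measure set T1 -> \bar R}) (f : T1 -> T2)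
    (mf : measurable_fun setT f) : {measure set T2 -> \bar R} :=
  measure_function_pushforward__canonical__measure_function_Measure m mf.

End law.

Section product_law.
Context {R : realType} {d1 d2 : measure_display}.
Context {T1 : measurableType d1} {T2 : measurableType d2}.
Variables (m1 : probability T1 R) (m2 : probability T2 R).

(** Absorbing [k] into the first factor reduces this to uniqueness of the product measure; [k] will
    be the probability of an event on which [P] is restricted. *)
Lemma scaled_product_unique (k : {nonneg R}) (m' : {measure set (T1 * T2) -> \bar R}) :
  (forall A B, measurable A -> measurable B -> m' (A `*` B) = k%:num%:E * (m1 A * m2 B))%E ->
  forall C, measurable C -> (m' C = k%:num%:E * (m1 \x m2) C)%E.
Proof.
move=> m'E C mC.
have h A B : measurable A -> measurable B -> (m' (A `*` B) = mscale k m1 A * m2 B)%E.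
  by move=> mA mB; rewrite m'E// muleA.
rewrite -(@product_measure_unique _ _ _ _ _ (mscale k m1) m2 m' h C mC).
by rewrite /product_measure1/= ge0_integral_mscale//=; exact: measurable_fun_xsection.
Qed.

Variable m' : probability (T1 * T2)%type R.
Hypothesis m'E : forall A B, measurable A -> measurable B -> m' (A `*` B) = (m1 A * m2 B)%E.

Lemma ge0_integral_product_law (f : T1 * T2 -> \bar R) :
  measurable_fun setT f -> (forall x, (0 <= f x)%E) ->
  (\int[m']_p f p = \int[m2]_y \int[m1]_x f (x, y))%E.
Proof.
move=> mf f0; apply: etrans; last exact: (fubini_tonelli2 f mf f0).
apply: eq_measure_integral => A mA _.
exact/esym/(@product_measure_unique _ _ _ _ _ m1 m2 m').
Qed.

Lemma integral_product_law (f : T1 * T2 -> \bar R) : m'.-integrable setT f ->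
  (\int[m']_p f p = \int[m2]_y \int[m1]_x f (x, y))%E /\
  m2.-integrable setT (fun y => \int[m1]_x f (x, y))%E.
Proof.
move=> /integrableP[mf fi].
have iprod : (m1 \x m2)%E.-integrable setT f.
  apply/integrable21ltyP => //.
  have e : (\int[m']_p `|f p| = \int[m2]_y \int[m1]_x `|f (x, y)|)%E.
    apply: (ge0_integral_product_law (f := abse \o f)); first exact: measurableT_comp.
    by move=> x; exact: abse_ge0.
  by rewrite -e.
split; last first.
  apply/integrableP; split; first exact: (measurable_fubini_G iprod).
  apply: le_lt_trans ((integrable21ltyP _ _ mf).1 iprod).
  apply: ge0_le_integral => //=.
  - by apply: measurableT_comp => //; exact: (measurable_fubini_G iprod).
  - apply: (measurable_fun_fubini_tonelli_G (m1 := m1) (abse \o f)); first exact: measurableT_comp.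
    by move=> x; exact: abse_ge0.
  - by move=> y _; apply: le_abse_integral => //; exact: measurableT_comp.
apply: etrans; last exact: (esym (integral21_prod_meas1 iprod)).
apply: eq_measure_integral => A mA _.
exact/esym/(@product_measure_unique _ _ _ _ _ m1 m2 m').
Qed.

End product_law.

Section gaussian_measure.
Context {R : realType}.

Definition gaussian (s : R) : probability (measurableTypeR R) R := normal_prob 0 s.

Lemma normal_rvE {d} {Omega : measurableType d} (P : probability Omega R)
    (X : Omega -> R) (s : R) (A : set R) :
  normal_rv P X s -> measurable A -> P (X @^-1` A) = gaussian s A.
Proof. by move=> [_ h] mA; rewrite h. Qed.

Lemma gaussian_linear (a b c d s1 s2 t1 t2 : R) (A B : set R) :
  0 < s1 -> 0 < s2 -> 0 < t1 -> 0 < t2 -> a != 0 -> a * d - b * c != 0 ->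
  a * c * s1 ^+ 2 + b * d * s2 ^+ 2 = 0 ->
  t1 ^+ 2 = a ^+ 2 * s1 ^+ 2 + b ^+ 2 * s2 ^+ 2 ->
  t2 ^+ 2 = c ^+ 2 * s1 ^+ 2 + d ^+ 2 * s2 ^+ 2 ->
  measurable A -> measurable B ->
  ((gaussian s1 \x gaussian s2)
     [set p | A (a * p.1 + b * p.2)%R /\ B (c * p.1 + d * p.2)%R] =
   gaussian t1 A * gaussian t2 B)%E.
Proof. exact: normal_prob_linear. Qed.

Lemma ge0_integral_gaussian (s : R) (f : R -> \bar R) :
  measurable_fun setT f -> (forall x, (0 <= f x)%E) ->
  (\int[gaussian s]_x f x = \int[lebesgue_measure]_x (f x * (normal_pdf 0 s x)%:E))%E.
Proof. exact: ge0_integral_normal_prob. Qed.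

End gaussian_measure.

Section independence.
Context {R : realType} {d : measure_display} {Omega : measurableType d}.
Variables (P : probability Omega R) (I : finType).
Implicit Types (X : I -> Omega -> R) (s : I -> R) (B : I -> set R).

Definition gaussian_family X s :=
  mutually_independent P X /\ forall i, normal_rv P (X i) (s i).

Lemma gaussian_family_measurable X s i : gaussian_family X s ->
  measurable_fun setT (X i).
Proof. by case=> _ /(_ i)[]. Qed.

Lemma measurable_cylinder X (D : pred I) B :
  (forall i, measurable_fun setT (X i)) -> (forall i, measurable (B i)) ->
  measurable (\bigcap_(l in [set l | D l]) X l @^-1` B l).
Proof.
move=> mX mB; apply: fin_bigcap_measurable; first exact: finite_finset.
by move=> l _; rewrite -[X in measurable X]setTI; exact: mX.
Qed.

Lemma independent_cylinder X (D : pred I) B : mutually_independent P X ->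
  (forall i, measurable (B i)) ->
  P (\bigcap_(l in [set l | D l]) X l @^-1` B l) = (\prod_(l | D l) P (X l @^-1` B l))%E.
Proof.
move=> iX mB.
pose B' l := if D l then B l else setT.
have mB' l : measurable (B' l) by rewrite /B'; case: ifP.
have := iX B' mB'; rewrite (_ : \bigcap_(l in _) _ = \bigcap_(l in [set l | D l]) X l @^-1` B l).
  move=> ->; rewrite [RHS]big_mkcond/=; apply: eq_bigr => l _; rewrite /B'; case: ifP => // _.
  by rewrite preimage_setT probability_setT.
apply/seteqP; split => w /= h l.
  by move=> Dl; have := h l Logic.I; rewrite /B' Dl.
by move=> _; rewrite /B'; case: ifPn => // Dl; exact: h.
Qed.

(** Restricting [P] to the event fixed by the other coordinates and pushing forward along the pair
    yields, on rectangles, a multiple of the product law. Uniqueness then reaches all planar sets,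
    in particular the oblique ones that a rotation produces. *)
Lemma gaussian_pair_law X s (i j : I) B (C : set (R * R)) :
  gaussian_family X s -> i != j -> (forall l, measurable (B l)) -> measurable C ->
  P ([set w | C (X i w, X j w)] `&`
     \bigcap_(l in [set l | (l != i) && (l != j)]) X l @^-1` B l) =
  ((gaussian (s i) \x gaussian (s j)) C *
     \prod_(l | (l != i) && (l != j)) P (X l @^-1` B l))%E.
Proof.
move=> gX ij mB mC.
have mX l : measurable_fun setT (X l) by exact: gaussian_family_measurable gX.
have [iX nX] := gX.
set E := \bigcap_(l in _) _.
have mE : measurable E by exact: measurable_cylinder.
have PE : P E = (\prod_(l | (l != i) && (l != j)) P (X l @^-1` B l))%E.
  exact: independent_cylinder.
rewrite -PE.
have mY : measurable_fun setT (fun w => (X i w : measurableTypeR R, X j w : measurableTypeR R)).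
  exact: (measurable_fun_pair (f := X i : Omega -> measurableTypeR R)
    (g := X j : Omega -> measurableTypeR R) (mX i) (mX j)).
have fPE : (0 <= fine (P E))%R by exact: fine_ge0.
pose k : {nonneg R} := NngNum fPE.
have kE : (k%:num%:E = P E)%E by rewrite /= fineK// fin_num_measure.
pose nu := pushmeasure (mrestr P mE) mY.
have nuE (A1 A2 : set R) : measurable A1 -> measurable A2 ->
    nu (A1 `*` A2) = (k%:num%:E * (gaussian (s i) A1 * gaussian (s j) A2))%E.
  move=> mA1 mA2.
  pose B' l := if l == i then A1 else if l == j then A2 else B l.
  have mB' l : measurable (B' l) by rewrite /B'; case: ifP => // _; case: ifP.
  rewrite /nu /pushmeasure /pushforward /mrestr /mscale/= -/(k%:num) kE.
  have := iX B' mB'; rewrite (bigD1 i)//= (bigD1 j)/=; last by rewrite eq_sym.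
  rewrite {1 2 3 4}/B' eqxx eq_sym (negbTE ij) eqxx.
  rewrite (eq_bigr (fun l => P (X l @^-1` B l))); last first.
    by move=> l /andP[li lj]; rewrite /B' (negbTE li) (negbTE lj).
  rewrite -PE (normal_rvE (nX i))// (normal_rvE (nX j))// => e.
  rewrite [RHS]muleC -muleA -[RHS]e.
  congr (P _); apply/seteqP; split => w /=.
    move=> [[w1 w2] wE] l _; rewrite /B'; case: eqVneq => [->//|li]; case: eqVneq => [->//|lj].
    by apply: wE => /=; rewrite li lj.
  move=> h; split; first split.
  - by have := h i Logic.I; rewrite /B' eqxx.
  - by have := h j Logic.I; rewrite /B' eqxx eq_sym (negbTE ij).
  - by move=> l /= /andP[li lj]; have := h l Logic.I; rewrite /B' (negbTE li) (negbTE lj).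
rewrite -[LHS]/(nu C) (@scaled_product_unique R _ _ (measurableTypeR R) (measurableTypeR R)
  (gaussian (s i)) (gaussian (s j)) k nu nuE C mC).
by rewrite kE [RHS]muleC.
Qed.

(** The rotated pair is again independent Gaussian and stays independent of the rest, so joint
    probabilities factor as in [key]. The marginals in [one] are read off [key] by leaving all other
    coordinates free. *)
Lemma gaussian_family_rotate X s (i j : I) (a b c e t1 t2 : R) :
  gaussian_family X s -> i != j -> 0 < s i -> 0 < s j -> 0 < t1 -> 0 < t2 ->
  a != 0 -> a * e - b * c != 0 ->
  a * c * s i ^+ 2 + b * e * s j ^+ 2 = 0 ->
  t1 ^+ 2 = a ^+ 2 * s i ^+ 2 + b ^+ 2 * s j ^+ 2 ->
  t2 ^+ 2 = c ^+ 2 * s i ^+ 2 + e ^+ 2 * s j ^+ 2 ->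
  gaussian_family
    (fun l w => if l == i then a * X i w + b * X j w else
                if l == j then c * X i w + e * X j w else X l w)
    (fun l => if l == i then t1 else if l == j then t2 else s l).
Proof.
move=> gX ij si0 sj0 t10 t20 a0 D0 orth t1E t2E.
have mX l : measurable_fun setT (X l) by exact: gaussian_family_measurable gX.
set X' := (X in gaussian_family X _).
have mlin (al be : R) : measurable_fun setT (fun p : R * R => al * p.1 + be * p.2).
  by apply: measurable_funD; apply: measurable_funM.
have key B : (forall l, measurable (B l)) ->
    P (\bigcap_(l in [set: I]) X' l @^-1` B l) =
    (gaussian t1 (B i) * gaussian t2 (B j) *
     \prod_(l | (l != i) && (l != j)) P (X l @^-1` B l))%E.
  move=> mB.
  pose C := [set p : R * R | B i (a * p.1 + b * p.2) /\ B j (c * p.1 + e * p.2)].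
  have mC : measurable C.
    by have := measurable_fun_pair (mlin a b) (mlin c e) measurableT
      (measurableX (mB i) (mB j)); rewrite setTI.
  have <- := gaussian_linear si0 sj0 t10 t20 a0 D0 orth t1E t2E (mB i) (mB j).
  rewrite -(gaussian_pair_law gX ij mB mC); congr (P _).
  apply/seteqP; split => w /=.
    move=> h; split.
      split; first by have := h i Logic.I; rewrite /X' /= eqxx.
      by have := h j Logic.I; rewrite /X' /= eq_sym (negbTE ij) eqxx.
    by move=> l /= /andP[li lj]; have := h l Logic.I; rewrite /X' /= (negbTE li) (negbTE lj).
  move=> [[h1 h2] h3] l _ /=; rewrite /X'; case: eqVneq => [->//|li]; case: eqVneq => [->//|lj].
  by apply: h3; rewrite /= li lj.
have one l (A : set R) : measurable A -> P (X' l @^-1` A) =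
    if l == i then gaussian t1 A else if l == j then gaussian t2 A else P (X l @^-1` A).
  move=> mA; pose B k := if k == l then A else setT.
  have mB k : measurable (B k) by rewrite /B; case: ifP.
  have := key B mB; rewrite (_ : \bigcap_(l in _) _ = X' l @^-1` A); last first.
    apply/seteqP; split => w /=; first by move=> /(_ l Logic.I); rewrite /B eqxx.
    by move=> h k _ /=; rewrite /B; case: eqVneq => [->|].
  move=> ->; have [li|li] := eqVneq l i; first subst l.
    rewrite /B eqxx eq_sym (negbTE ij) probability_setT mule1 big1 ?mule1// => k /andP[ki kj].
    by rewrite (negbTE ki) preimage_setT probability_setT.
  have [lj|lj] := eqVneq l j; first subst l.
    rewrite /B eqxx (negbTE ij) probability_setT mul1e big1 ?mule1// => k /andP[ki kj].
    by rewrite (negbTE kj) preimage_setT probability_setT.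
  rewrite (bigD1 l) ?li//= big1 ?mule1; last first.
    by move=> k /andP[_ kl]; rewrite /B (negbTE kl) preimage_setT probability_setT.
  by rewrite /B eqxx eq_sym (negbTE li) eq_sym (negbTE lj) !probability_setT !mul1e.
split.
  move=> B mB; rewrite key// [RHS](bigD1 i)//= [X in _ = (_ * X)%E](bigD1 j)/=; last by rewrite eq_sym.
  rewrite !one// eqxx eq_sym (negbTE ij) eqxx muleA; congr (_ * _)%E.
  by apply: eq_bigr => l /andP[li lj]; rewrite one// (negbTE li) (negbTE lj).
move=> l; split; last first.
  move=> A mA; rewrite one//; case: ifP => // _; case: ifP => // _.
  exact: (gX.2 l).2.
have ml al be : measurable_fun setT (fun w => al * X i w + be * X j w).
  by apply: measurable_funD; apply: measurable_funM.
by rewrite /X'; case: (l == i) => //; case: (l == j).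
Qed.

(** Measurability is tested along every measurable family, so that no sigma-algebra on [I -> R] is
    involved. Quantifying over the source space covers both the given family on [Omega] and the
    updated one on its product with a line. *)
Definition coord_measurable {d'} {U : measurableType d'} (F : (I -> R) -> U) :=
  forall d0 (T : measurableType d0) (Z : I -> T -> R),
    (forall i, measurable_fun setT (Z i)) -> measurable_fun setT (fun t => F (Z ^~ t)).

Definition upd (x : I -> R) (i : I) (t : R) : I -> R := fun l => if l == i then t else x l.

(** * Resampling a single coordinate *)

Section resampling.
Variables (X : I -> Omega -> R) (s : I -> R) (i : I).
Hypothesis gX : gaussian_family X s.

Let mX l : measurable_fun setT (X l). Proof. exact: gaussian_family_measurable gX. Qed.

Let G : set (set Omega) := [set E | exists2 B : I -> set R, (forall l, measurable (B l)) &
  E = \bigcap_(l in [set l | l != i]) X l @^-1` B l].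

(* Omega, carrying only the events that depend on the coordinates other than i *)
Let Omega' := g_sigma_algebraType G.

Let Gm : G `<=` @measurable d Omega.
Proof. by move=> _ [B mB ->]; exact: measurable_cylinder. Qed.

Let mid : measurable_fun setT (id : Omega -> Omega').
Proof.
move=> _ Y mY; rewrite setTI; have : <<s G >> Y by exact: mY.
by apply: smallest_sub; [exact: sigma_algebra_measurable|exact: Gm].
Qed.

Let P' := law P mid.

Let mjoint : measurable_fun setT (fun w => (X i w : measurableTypeR R, w : Omega')).
Proof. exact: (measurable_fun_pair (f := X i : Omega -> measurableTypeR R) (mX i) mid). Qed.

(** Independence of [X i] from the whole sigma-algebra of the other coordinates: the cylinders
    generate it and are closed under intersection, and on cylinders the claim is mutual
    independence. *)
Let joint_law A (E : set Omega') : measurable A -> measurable E ->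
  law P mjoint (A `*` E) = (gaussian (s i) A * P' E)%E.
Proof.
move=> mA mE.
have mXA : measurable (X i @^-1` A) by rewrite -[X in measurable X]setTI; exact: mX.
have f0 : (0 <= fine (gaussian (s i) A))%R by exact: fine_ge0.
pose k : {nonneg R} := NngNum f0.
have kE : (k%:num%:E = gaussian (s i) A)%E by rewrite /= fineK// fin_num_measure.
pose nu2 := pushmeasure (mrestr P mXA) mid.
rewrite -kE.
transitivity (nu2 E).
  rewrite /nu2/law/pushmeasure/distribution/pushforward/mrestr/=; congr (P _).
  by apply/seteqP; split => w/= [].
transitivity (mscale k (P') E) => //.
apply: (@measure_unique _ R Omega' G (fun=> setT) _ _ _ _ nu2 (mscale k P') _ _ E mE) => //.
- move=> _ _ [B1 mB1 ->] [B2 mB2 ->]; exists (fun l => B1 l `&` B2 l).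
    by move=> l; exact: measurableI.
  by rewrite -bigcapI; apply: eq_bigcapr => l _; rewrite preimage_setI.
- by move=> _; exists (fun=> setT) => //; apply/seteqP; split => // w _ l _.
- by rewrite bigcup_const.
- move=> _ [B mB ->].
  set cyl := \bigcap_(l in _) _.
  rewrite -[LHS]/(P (cyl `&` X i @^-1` A)) -[RHS]/(k%:num%:E * P cyl)%E kE.
  rewrite [P cyl]independent_cylinder//; last exact: gX.1.
  rewrite -(normal_rvE (gX.2 i))//.
  pose B' l : set R := if l == i then A else B l.
  have mB' l : measurable (B' l) by rewrite /B'; case: ifP => // _; exact: mA.
  have := gX.1 B' mB'; rewrite (bigD1 i)//= {2}/B' eqxx.
  rewrite (eq_bigr (fun l => P (X l @^-1` B l))); last first.
    by move=> l li; rewrite /B' (negbTE li).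
  move=> <-; congr (P _); apply/seteqP; split => w /=.
    move=> [h1 h2] l _; rewrite /B'; case: eqVneq => [->//|li].
    exact: h1.
  move=> h; split; last by have := h i Logic.I; rewrite /B' eqxx.
  by move=> l /= li; have := h l Logic.I; rewrite /B' (negbTE li).
- move=> _; rewrite -[nu2 _]/(P (setT `&` X i @^-1` A)) setTI.
  by apply: (le_lt_trans (probability_le1 P mXA)); rewrite ltry.
Qed.

Let mupd d' (U : measurableType d') (F : (I -> R) -> U) : coord_measurable F ->
  measurable_fun setT (fun p : measurableTypeR R * Omega' => F (upd (X ^~ p.2) i p.1)).
Proof.
move=> mF; apply: (mF _ _ (fun l (p : measurableTypeR R * Omega') => upd (X ^~ p.2) i p.1 l)) => l.
rewrite /upd; case: eqVneq => li; first exact: measurable_fst.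
apply: (measurableT_comp (f := X l : Omega' -> R)) => //.
move=> _ Y mY; rewrite setTI; apply: sub_sigma_algebra.
exists (fun k => if k == l then Y else setT); first by move=> k; case: ifP.
apply/seteqP; split => w /=.
  by move=> h k /= _; case: eqVneq => [->|].
by move=> /(_ l li); rewrite eqxx.
Qed.

Let updX w : upd (X ^~ w) i (X i w) = X ^~ w.
Proof. by apply/funext => l; rewrite /upd; case: eqVneq => [->|]. Qed.

(** The joint law of [X i] and of the identity into [Omega'] is a product, so by Tonelli the
    coordinate [i] may be drawn afresh while the others are kept. *)
Lemma ge0_resample (F : (I -> R) -> \bar R) : coord_measurable F ->
  (forall x, (0 <= F x)%E) ->
  (\int[P]_w F (X ^~ w) =
   \int[P]_w \int[gaussian (s i)]_t F (upd (X ^~ w) i t))%E.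
Proof.
move=> mF F0.
pose f (p : measurableTypeR R * Omega') := F (upd (X ^~ p.2) i p.1).
have mf : measurable_fun setT f by exact: mupd.
have f0 p : (0 <= f p)%E by exact: F0.
pose nu := law P mjoint.
transitivity (\int[nu]_p f p)%E.
  rewrite /nu /law /distribution ge0_integral_pushforward//= ?preimage_setT.
  by apply: eq_integral => w _ /=; rewrite /f/= updX.
apply: etrans; first exact: (@ge0_integral_product_law R _ _ (measurableTypeR R) Omega'
  (gaussian (s i)) P' nu joint_law f mf f0).
rewrite /P' /law /distribution ge0_integral_pushforward//=.
- exact: (measurable_fun_fubini_tonelli_G f mf f0).
- by move=> w _; apply: integral_ge0.
Qed.

Lemma resample (F : (I -> R) -> R) : coord_measurable F ->
  P.-integrable setT (fun w => (F (X ^~ w))%:E) ->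
  (\int[P]_w (F (X ^~ w))%:E =
   \int[P]_w \int[gaussian (s i)]_t (F (upd (X ^~ w) i t))%:E)%E.
Proof.
move=> mF iF.
pose f (p : measurableTypeR R * Omega') := (F (upd (X ^~ p.2) i p.1))%:E.
have mf : measurable_fun setT f by apply/measurable_EFinP; exact: mupd.
pose nu := law P mjoint.
have fE : f \o (fun w => (X i w : measurableTypeR R, w : Omega')) = (fun w => (F (X ^~ w))%:E).
  by apply/funext => w; rewrite /f/= updX.
have inu : (nu).-integrable setT f.
  by apply: integrable_pushforward => //; rewrite preimage_setT fE.
have [e ig] := @integral_product_law R _ _ (measurableTypeR R) Omega' (gaussian (s i)) P' nu joint_law f inu.
transitivity (\int[nu]_p f p)%E.
  rewrite /nu /law /distribution integral_pushforward//= ?preimage_setT.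
    by apply: eq_integral => w _ /=; rewrite /f/= updX.
  exact: (eq_ind_r (fun g => P.-integrable setT g) iF fE).
apply: (etrans e).
pose g (w : Omega') := (\int[gaussian (s i)]_x f (x, w))%E.
have mg : measurable_fun setT g := measurable_int _ ig.
rewrite -[LHS]/(\int[P']_w g w)%E /P' /law /distribution integral_pushforward//=.
rewrite preimage_setT; apply/integrableP; split; first exact: (measurableT_comp mg mid).
move/integrableP : ig => [_]; rewrite -/g /P' /law /distribution.
by rewrite ge0_integral_pushforward//=; exact: measurableT_comp.
Qed.

End resampling.
End independence.

(** * Gaussian integration by parts *)

Section stein.
Context {R : realType}.
Local Notation leb := (@lebesgue_measure R).
Variable s : R.
Hypothesis s0 : 0 < s.
Local Notation p := (normal_pdf 0 s).

Let sn0 : s != 0. Proof. by rewrite gt_eqF. Qed.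

Lemma integral_gaussian (f : R -> R) : measurable_fun setT f ->
  (\int[gaussian s]_x (f x)%:E = \int[leb]_x (f x * p x)%:E)%E.
Proof.
move=> mf; rewrite integralE [RHS]integralE.
have pos (g : R -> R) : measurable_fun setT g ->
    (\int[gaussian s]_x (EFin \o g)^\+ x = \int[leb]_x (EFin \o (fun x => g x * p x)%R)^\+ x)%E.
  move=> mg; rewrite ge0_integral_gaussian//; last first.
    by apply: measurable_funepos; exact/measurable_EFinP.
  apply: eq_integral => x _; rewrite !funeposE/=.
  have p0 := normal_pdf_ge0 0 s x.
  have [g0|g0] := leP 0 (g x).
    by rewrite (max_idPl _) ?lee_fin// (max_idPl _) ?lee_fin ?mulr_ge0.
  rewrite (max_idPr _) ?lee_fin ?ltW// mul0e (max_idPr _)// lee_fin.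
  by rewrite mulr_le0_ge0// ltW.
have nE (h : R -> R) (x : R) : ((EFin \o h)^\- x = (EFin \o (fun x => - h x)%R)^\+ x)%E.
  by rewrite funeposE funenegE/= EFinN.
congr (_ - _)%E; first exact: pos.
apply: etrans; first by apply: eq_integral => x _; exact: (nE f x).
rewrite pos; last exact: measurableT_comp.
apply: eq_integral => x _; apply/esym; apply: (etrans (nE (fun x => f x * p x) x)).
by rewrite !funeposE/= mulNr.
Qed.

Lemma integrable_gaussian (f : R -> R) : measurable_fun setT f ->
  leb.-integrable setT (fun x => (f x * p x)%:E) ->
  (gaussian s).-integrable setT (fun x => (f x)%:E).
Proof.
move=> mf /integrableP[_ fi]; apply/integrableP; split; first exact/measurable_EFinP.
rewrite (integral_gaussian (f := fun x => `|f x|)); last exact: measurableT_comp.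
apply: le_lt_trans fi; rewrite le_eqVlt; apply/orP; left; apply/eqP.
by apply: eq_integral => x _ /=; rewrite normrM (ger0_norm (normal_pdf_ge0 _ _ _)).
Qed.

(** The ratio of the densities with deviations s and 2 s is 2 exp (- y) with y = 3 x^2 / (8 s^2),
    and 1 + x^2 <= (1 + 8 s^2 / 3) (1 + y). Thus quadratic growth is absorbed by doubling the
    deviation. *)
Let K : R := 2 * (1 + 8 * s ^+ 2 / 3).

Let K0 : 0 < K.
Proof. by rewrite mulr_gt0// addr_gt0// !mulr_gt0 ?exprn_gt0// invr_gt0. Qed.

Let poly_pdf_le x : (1 + x ^+ 2) * p x <= K * normal_pdf 0 (2 * s) x.
Proof.
have s20 : 0 < 2 * s by rewrite mulr_gt0.
rewrite !normal_pdf_gt0E//.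
set q := (Num.sqrt _)^-1.
have q0 : 0 <= q by rewrite invr_ge0 sqrtr_ge0.
have -> : - (x / s) ^+ 2 / 2 = - (x / (2 * s)) ^+ 2 / 2 + - (3 * x ^+ 2 / (8 * s ^+ 2)).
  by field.
rewrite expRD; set E := expR (- (x / (2 * s)) ^+ 2 / 2).
have E0 : 0 < E by exact: expR_gt0.
set y := 3 * x ^+ 2 / (8 * s ^+ 2).
have y0 : 0 <= y by rewrite divr_ge0// mulr_ge0// sqr_ge0.
have h : 1 + x ^+ 2 <= (1 + 8 * s ^+ 2 / 3) * expR y.
  apply: (@le_trans _ _ ((1 + 8 * s ^+ 2 / 3) * (1 + y))).
    rewrite (_ : _ * _ = 1 + x ^+ 2 + (8 * s ^+ 2 / 3 + y)).
      by rewrite lerDl addr_ge0// divr_ge0// mulr_ge0// sqr_ge0.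
    by rewrite /y; field.
  rewrite ler_wpM2l// ?expR_ge1Dx//.
  by rewrite addr_ge0// divr_ge0// mulr_ge0// sqr_ge0.
rewrite expRN (_ : _ * (_ * _) = (s^-1 * q * E) * ((1 + x ^+ 2) / expR y)); last by ring.
rewrite (_ : K * _ = (s^-1 * q * E) * (1 + 8 * s ^+ 2 / 3)); last by rewrite /K; field.
apply: ler_wpM2l; first by rewrite !mulr_ge0// ?invr_ge0 ltW.
by rewrite ler_pdivrMr ?expR_gt0.
Qed.

Let sq_lin (x : R) : (1 + `|x|) ^+ 2 <= 2 * (1 + x ^+ 2).
Proof.
by rewrite -(real_normK (num_real x)); have := sqr_ge0 (1 - `|x|); nra.
Qed.

Let integrable_poly (g : R -> R) (C : R) : measurable_fun setT g ->
  (forall x, `|g x| <= C * (1 + `|x|) ^+ 2) ->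
  leb.-integrable setT (fun x => (g x * p x)%:E).
Proof.
move=> mg gC.
have C0 : 0 <= C.
  have := gC 0; rewrite normr0 addr0 expr1n mulr1; exact: le_trans.
have i2 : leb.-integrable setT (fun x => ((C * 2 * K)%:E * (normal_pdf 0 (2 * s) x)%:E)%E).
  by apply: integrableZl => //; exact: integrable_normal_pdf.
apply: le_integrable i2 => //.
  by apply/measurable_EFinP; apply: measurable_funM => //; exact: measurable_normal_pdf.
move=> x _ /=; rewrite lee_fin.
rewrite [leRHS]ger0_norm; last first.
  by rewrite mulr_ge0 ?normal_pdf_ge0// mulr_ge0 ?(ltW K0)// mulr_ge0.
rewrite normrM (ger0_norm (normal_pdf_ge0 _ _ _)).
apply: (@le_trans _ _ (C * (2 * (1 + x ^+ 2)) * p x)).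
  apply: ler_wpM2r; first exact: normal_pdf_ge0.
  by apply: le_trans (gC x) _; apply: ler_wpM2l => //; exact: sq_lin.
have -> : C * (2 * (1 + x ^+ 2)) * p x = C * 2 * ((1 + x ^+ 2) * p x) by ring.
by rewrite -(mulrA (C * 2)); apply: ler_wpM2l; [rewrite mulr_ge0|exact: poly_pdf_le].
Qed.

Lemma integrable_gaussian_poly (g : R -> R) (C : R) : measurable_fun setT g ->
  (forall x, `|g x| <= C * (1 + `|x|) ^+ 2) ->
  (gaussian s).-integrable setT (fun x => (g x)%:E).
Proof. by move=> mg gC; apply: integrable_gaussian => //; exact: integrable_poly gC. Qed.

Let is_derive_pdf (x : R) : is_derive x 1 (p : R -> R) (- (x / s ^+ 2) * p x).
Proof.
have pE : p = fun x => s^-1 * (Num.sqrt (pi *+ 2))^-1 * expR (- (2 * s ^+ 2)^-1 * x ^+ 2).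
  apply/funext => y; rewrite normal_pdf_gt0E//; congr (_ * expR _); by field.
rewrite pE.
apply: is_derive_eq.
rewrite /GRing.scale/=; move: (Num.sqrt _)^-1 => q; by field.
Qed.

(** Since p' = - x p / s^2, the derivative of f p is f' p - x f p / s^2. Its integral over the line
    is 0 because f p vanishes at infinity; linear growth of f and f' makes both terms integrable. *)
Lemma stein_gaussian (f f' : R -> R) (C : R) :
  (forall x : R, is_derive x 1 f (f' x)) -> continuous f' ->
  (forall x, `|f x| <= C * (1 + `|x|)) -> (forall x, `|f' x| <= C * (1 + `|x|)) ->
  (\int[gaussian s]_x (x * f x)%:E = (s ^+ 2)%:E * \int[gaussian s]_x (f' x)%:E)%E.
Proof.
move=> df cf' fC f'C.
have cf : continuous f.
  by move=> x; apply/differentiable_continuous/derivable1_diffP; have [] := df x.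
have mf : measurable_fun setT f by exact: continuous_measurable_fun.
have mf' : measurable_fun setT f' by exact: continuous_measurable_fun.
have C0 : 0 <= C.
  by have := fC 0; rewrite normr0 addr0 mulr1; exact: le_trans.
have x1 (x : R) : 1 <= 1 + `|x| by rewrite lerDl.
have ixf : leb.-integrable setT (fun x => (x * f x * p x)%:E).
  apply: (integrable_poly (C := C)); first exact: measurable_funM.
  move=> x; rewrite normrM expr2 mulrCA; apply: ler_pM => //.
  by rewrite lerDr.
have if' : leb.-integrable setT (fun x => (f' x * p x)%:E).
  apply: (integrable_poly (C := C)) => // x.
  apply: le_trans (f'C x) _; rewrite ler_wpM2l// expr2 ler_peMr//.
pose g x := f' x * p x - (s ^+ 2)^-1 * (x * f x * p x).
pose G x := f x * p x.
have dG (x : R) : is_derive x 1 G (g x).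
  have ? := df x; have ? := is_derive_pdf x.
  apply: is_derive_eq; rewrite /g /GRing.scale/=; field.
  exact: sn0.
have cg : continuous g.
  move=> x; apply: cvgB.
    by apply: cvgM; [exact: cf'|exact: continuous_normal_pdf].
  apply: cvgM; first exact: cvg_cst.
  apply: cvgM; last exact: continuous_normal_pdf.
  by apply: cvgM; [exact: cvg_id|exact: cf].
have ig : leb.-integrable setT (fun x => (g x)%:E).
  rewrite (_ : (fun x => _) = (fun x => (f' x * p x)%:E - (s ^+ 2)^-1%:E * (x * f x * p x)%:E)%E).
    by apply: integrableB => //; exact: integrableZl.
  by apply/funext => x; rewrite -EFinM -EFinB.
(* Decay like 1 / (1 + |x|) is enough for the boundary terms. The constant collects the growth bound
   C, the 2 of [sq_lin], the K of [poly_pdf_le] and the peak of the wider density. *)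
have mG x : `|G x| <= C * 2 * K * normal_peak (2 * s) / (1 + `|x|).
  have s20 : 2 * s != 0 by rewrite mulf_neq0// pnatr_eq0.
  rewrite ler_pdivlMr; last exact: lt_le_trans (x1 x).
  rewrite normrM (ger0_norm (normal_pdf_ge0 _ _ _)).
  apply: (@le_trans _ _ (C * (1 + `|x|) ^+ 2 * p x)).
    rewrite expr2 mulrA -!mulrA (mulrC (p x)) !mulrA.
    by do 2 (apply: ler_wpM2r; rewrite ?normal_pdf_ge0 ?addr_ge0//).
  have -> : C * 2 * K * normal_peak (2 * s) = C * (2 * (K * normal_peak (2 * s))) by rewrite !mulrA.
  rewrite -(mulrA C); apply: ler_wpM2l => //.
  apply: (@le_trans _ _ (2 * ((1 + x ^+ 2) * p x))).
    by rewrite mulrA; apply: ler_wpM2r; rewrite ?normal_pdf_ge0.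
  apply: ler_wpM2l => //; apply: le_trans (poly_pdf_le x) _.
  by apply: ler_wpM2l; [exact: ltW|exact: normal_pdf_ub].
(* The fundamental theorem of calculus is applied on bounded intervals exhausting the line; [n.+1]
   makes them nondegenerate from n = 0 on. *)
pose J (n : nat) : set R := `[- n.+1%:R, n.+1%:R]%classic.
pose gn n x := (g x * \1_(J n) x)%:E.
have mJ n : measurable (J n) by exact: measurable_itv.
have mg : measurable_fun setT g by exact: continuous_measurable_fun.
have intn n : (\int[leb]_x gn n x = (G n.+1%:R - G (- n.+1%:R))%:E)%E.
  have h : - n.+1%:R < n.+1%:R :> R by rewrite gtrN// ltr0n.
  rewrite EFinB -(@continuous_FTC2 _ g G _ _ h).
  - rewrite [RHS]integral_mkcond; apply: eq_integral => x _.
    by rewrite /gn patchE indicE; case: (x \in _); rewrite ?mulr1 ?mulr0.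
  - exact: continuous_subspaceT.
  - have cG : continuous G.
      by move=> x; apply/differentiable_continuous/derivable1_diffP; have [] := dG x.
    split; first by move=> x _; have [] := dG x.
    + by apply: cvg_at_right_filter; exact: cG.
    + by apply: cvg_at_left_filter; exact: cG.
  - by move=> x _; rewrite derive1E; have [_ ->] := dG x.
have cvg1 : (\int[leb]_x gn n x @[n --> \oo] --> \int[leb]_x (g x)%:E)%E.
  apply: (@dominated_cvg _ _ _ leb setT measurableT gn _ (fun x => `|g x|%:E)) => //.
  - by move=> n; apply/measurable_EFinP; apply: measurable_funM => //; apply: measurable_indic; exact: mJ.
  - move=> x _; apply: cvg_near_cst.
    near=> n; rewrite /gn indicE mem_set ?mulr1// /J/= in_itv/= -ler_norml.
    apply: (@le_trans _ _ n%:R); last by rewrite ler_nat.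
    by apply: ltW; near: n; exact: nbhs_infty_gtr.
  - exact: (integrable_abse ig).
  - move=> n x _; rewrite /gn lee_fin normrM ler_piMr// indicE.
    by case: (x \in _); rewrite ?normr1 ?normr0.
have cvg2 : (\int[leb]_x gn n x @[n --> \oo] --> 0)%E.
  under eq_fun do rewrite intn.
  apply/fine_cvgP; split; first exact: nearW.
  rewrite /comp/=; pose D := C * 2 * K * normal_peak (2 * s).
  have D0 : 0 <= D by rewrite mulr_ge0 ?normal_peak_ge0// mulr_ge0 ?(ltW K0)// mulr_ge0.
  apply: (@squeeze_cvgr _ _ _ _ (fun n => - (2 * D * n.+1%:R^-1)) (fun n => 2 * D * n.+1%:R^-1)).
  - apply: nearW => n; rewrite -ler_norml; apply: le_trans (ler_normB _ _) _.
    have h x : `|x| = n.+1%:R -> `|G x| <= D * n.+1%:R^-1.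
      move=> xn; apply: le_trans (mG x) _; rewrite xn; apply: ler_wpM2l => //.
      by rewrite lef_pV2 ?posrE ?ltr0n// ?addr_gt0 ?ltr0n// lerDr.
    have -> : 2 * D * n.+1%:R^-1 = D * n.+1%:R^-1 + D * n.+1%:R^-1 by ring.
    by apply: lerD; apply: h; rewrite ?normrN normr_nat.
  - rewrite -oppr0 -(mulr0 (2 * D)); apply: cvgN; apply: cvgM; first exact: cvg_cst.
    exact: cvg_harmonic.
  - rewrite -(mulr0 (2 * D)); apply: cvgM; first exact: cvg_cst.
    exact: cvg_harmonic.
have g0 : (\int[leb]_x (g x)%:E = 0)%E by exact: (cvg_unique _ cvg1 cvg2).
rewrite !integral_gaussian//; last exact: measurable_funM.
move: g0; rewrite (_ : (fun x => _) =
    (fun x => (f' x * p x)%:E - (s ^+ 2)^-1%:E * (x * f x * p x)%:E)%E); last first.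
  by apply/funext => x; rewrite -EFinM -EFinB.
rewrite integralB//; last exact: integrableZl.
rewrite integralZl//.
have [fi1 fi2] : (\int[leb]_x (x * f x * p x)%:E)%E \is a fin_num /\ (\int[leb]_x (f' x * p x)%:E)%E \is a fin_num.
  by split; exact: integrable_fin_num.
rewrite -(fineK fi1) -(fineK fi2) -EFinM -EFinB -EFinM => -[] /eqP.
rewrite subr_eq0 => /eqP ->; congr _%:E; field; exact: sn0.
Unshelve. all: by end_near. Qed.

Lemma gaussian_mean : (\int[gaussian s]_x x%:E = 0)%E.
Proof.
have := @stein_gaussian (cst 1) (cst 0) 1.
under eq_integral do rewrite mulr1.
move=> -> //.
- by rewrite integral0 mule0.
- by move=> x; exact: cvg_cst.
- by move=> x; rewrite normr1 mul1r lerDl.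
- by move=> x; rewrite normr0 mul1r addr_ge0.
Qed.

Lemma gaussian_second_moment : (\int[gaussian s]_x (x ^+ 2)%:E = (s ^+ 2)%:E)%E.
Proof.
have := @stein_gaussian id (cst 1) 1.
under eq_integral do rewrite -expr2.
move=> -> //.
- by rewrite -[X in (_ * X)%E]/(\int[gaussian s]_x (cst 1%:E x))%E integral_cst//= probability_setT !mule1.
- by move=> x; exact: cvg_cst.
- by move=> x; rewrite mul1r lerDr.
- by move=> x; rewrite normr1 mul1r lerDl.
Qed.

End stein.

(** * The regularized inverse of a Gram matrix *)

Section regularized_gram.
Context {C : numClosedFieldType}.

Definition adjm (m n : nat) (A : 'M[C]_(m, n)) : 'M[C]_(n, m) :=
  (map_mx Num.conj A)^T.

Lemma adjmM m n p (A : 'M[C]_(m, n)) (B : 'M[C]_(n, p)) :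
  adjm (A *m B) = adjm B *m adjm A.
Proof. by rewrite /adjm map_mxM trmx_mul. Qed.

Lemma adjmK m n (A : 'M[C]_(m, n)) : adjm (adjm A) = A.
Proof. by apply/matrixP => i j; rewrite !mxE conjCK. Qed.

Lemma adjmD m n (A B : 'M[C]_(m, n)) : adjm (A + B) = adjm A + adjm B.
Proof. by rewrite /adjm map_mxD linearD. Qed.

Lemma adjm_scalar n (a : C) : a \is Num.real -> adjm a%:M = a%:M :> 'M[C]_n.
Proof. by move=> ar; rewrite /adjm map_scalar_mx tr_scalar_mx /= (CrealP ar). Qed.

Lemma adjm_inv n (A : 'M[C]_n) : adjm A = A -> adjm (invmx A) = invmx A.
Proof. by move=> hA; rewrite /adjm map_invmx trmx_inv -/(adjm A) hA. Qed.

Lemma adjm_mul_diag m n (X : 'M[C]_(m, n)) a :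
  (adjm X *m X) a a = \sum_i `|X i a| ^+ 2.
Proof. by rewrite mxE; apply: eq_bigr => i _; rewrite !mxE mulrC normCK. Qed.

Lemma mul_adjm_diag m n (X : 'M[C]_(m, n)) a :
  (X *m adjm X) a a = \sum_i `|X a i| ^+ 2.
Proof. by rewrite mxE; apply: eq_bigr => i _; rewrite !mxE normCK. Qed.

Lemma ler_sum_term (I : finType) (F : I -> C) i :
  (forall j, 0 <= F j) -> F i <= \sum_j F j.
Proof. by move=> F0; rewrite (bigD1 i)//= lerDl sumr_ge0. Qed.

Variables (M K : nat).
Implicit Type H : 'M[C]_(M, K).

Definition gram H : 'M[C]_K := adjm H *m H.

Lemma adjm_gram H : adjm (gram H) = gram H.
Proof. by rewrite /gram adjmM adjmK. Qed.

(** At e = 0 and for an invertible Gram matrix, [reg_zf] is H (H^H H)^-1, whose columns are the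
    unnormalized zero-forcing directions, and [reg_proj] is the orthogonal projection onto the
    column space of H. *)
Definition reg_gram (e : C) H : 'M[C]_K := gram H + e%:M.
Definition reg_inv (e : C) H : 'M[C]_K := invmx (reg_gram e H).
Definition reg_zf (e : C) H : 'M[C]_(M, K) := H *m reg_inv e H.
Definition reg_proj (e : C) H : 'M[C]_M := reg_zf e H *m adjm H.

Section fixed.
Variables (e : C) (H : 'M[C]_(M, K)).
Hypothesis e0 : 0 < e.
Local Notation B := (reg_inv e H).
Local Notation V := (reg_zf e H).
Local Notation Pi := (reg_proj e H).

Let er : e \is Num.real. Proof. by rewrite ger0_real// ltW. Qed.

Lemma adjm_reg_gram : adjm (reg_gram e H) = reg_gram e H.
Proof. by rewrite /reg_gram adjmD adjm_gram adjm_scalar. Qed.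

(** Positive definiteness: u (H^H H + e) u^H = |u H^H|^2 + e |u|^2 vanishes only for u = 0. *)
Lemma reg_gram_unit : reg_gram e H \in unitmx.
Proof.
rewrite -row_free_unit; apply: inj_row_free => u uG.
have : (u *m reg_gram e H *m adjm u) 0 0 = 0 by rewrite uG mul0mx mxE.
rewrite /reg_gram mulmxDr mulmxDl mxE mul_mx_scalar -scalemxAl [X in _ + X]mxE.
rewrite (_ : u *m gram H *m adjm u = (u *m adjm H) *m adjm (u *m adjm H)); last first.
  by rewrite adjmM adjmK /gram !mulmxA.
rewrite !mul_adjm_diag => /eqP; rewrite paddr_eq0; last 2 first.
- by apply: sumr_ge0 => i _; rewrite exprn_ge0.
- by rewrite mulr_ge0 ?(ltW e0)//; apply: sumr_ge0 => i _; rewrite exprn_ge0.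
move=> /andP[_]; rewrite mulf_eq0 gt_eqF//= psumr_eq0; last by move=> i _; rewrite exprn_ge0.
move=> /allP h; apply/rowP => j; rewrite mxE; apply/eqP.
by have := h j (mem_index_enum _); rewrite /= expf_eq0/= normr_eq0.
Qed.

Lemma adjm_reg_inv : adjm B = B.
Proof. by apply: adjm_inv; exact: adjm_reg_gram. Qed.

Lemma mul_gram_reg_inv : gram H *m B = 1%:M - e *: B.
Proof.
apply/eqP; rewrite eq_sym subr_eq -mul_scalar_mx -mulmxDl.
by rewrite mulmxV// reg_gram_unit.
Qed.

Lemma mul_reg_inv_gram : B *m gram H = 1%:M - e *: B.
Proof.
apply/eqP; rewrite eq_sym subr_eq -mul_mx_scalar -mulmxDr.
by rewrite mulVmx// reg_gram_unit.
Qed.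

(** Expanding B = B (A + e) B writes B as a sum of two positive semidefinite matrices; the pointwise
    bounds on B and on V below come from this decomposition. *)
Lemma reg_inv_sum : B = adjm V *m V + e *: (adjm B *m B).
Proof.
rewrite /reg_zf adjmM adjm_reg_inv mulmxA -(mulmxA B) -/(gram H) mul_reg_inv_gram.
by rewrite mulmxBl mul1mx -scalemxAl subrK.
Qed.

Lemma adjm_reg_zf : adjm H *m V = 1%:M - e *: B.
Proof. by rewrite /reg_zf mulmxA mul_gram_reg_inv. Qed.

Lemma reg_inv_diagE a :
  B a a = \sum_m `|V m a| ^+ 2 + e * \sum_j `|B j a| ^+ 2.
Proof. by rewrite {1}reg_inv_sum mxE [X in _ + X]mxE !adjm_mul_diag. Qed.

Lemma reg_inv_diag_ge0 a : 0 <= B a a.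
Proof.
rewrite reg_inv_diagE addr_ge0 ?mulr_ge0 ?(ltW e0)//.
  by apply: sumr_ge0 => i _; rewrite exprn_ge0.
by apply: sumr_ge0 => i _; rewrite exprn_ge0.
Qed.

Lemma reg_zf_sum_le a : \sum_m `|V m a| ^+ 2 <= B a a.
Proof.
rewrite reg_inv_diagE lerDl mulr_ge0 ?(ltW e0)//.
by apply: sumr_ge0 => i _; rewrite exprn_ge0.
Qed.

Lemma reg_inv_entry_le j a : e * `|B j a| ^+ 2 <= B a a.
Proof.
apply: le_trans (_ : e * \sum_j `|B j a| ^+ 2 <= _); last first.
  rewrite [leRHS]reg_inv_diagE lerDr.
  by apply: sumr_ge0 => i _; rewrite exprn_ge0.
rewrite ler_pM2l//; apply: (ler_sum_term (F := fun j => `|B j a| ^+ 2)) => i.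
by rewrite exprn_ge0.
Qed.

(** The entry bound applied to the diagonal entry itself reads e B_aa^2 <= B_aa. *)
Lemma reg_inv_diag_le a : B a a <= e^-1.
Proof.
have := reg_inv_entry_le a a; rewrite ger0_norm ?reg_inv_diag_ge0// expr2 mulrA.
have := reg_inv_diag_ge0 a; rewrite le_eqVlt => /predU1P[<-|Ba].
  by move=> _; rewrite invr_ge0 ltW.
by rewrite ger_pMl// -ler_pdivlMl// mulr1.
Qed.

Lemma reg_zf_entry_le m a : `|V m a| ^+ 2 <= B a a.
Proof.
apply: le_trans (reg_zf_sum_le a).
by apply: (ler_sum_term (F := fun j => `|V j a| ^+ 2)) => i; rewrite exprn_ge0.
Qed.

Lemma normM_le_sqr (x y : C) : `|x * y| *+ 2 <= `|x| ^+ 2 + `|y| ^+ 2.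
Proof.
rewrite normrM -subr_ge0 (_ : _ - _ = (`|x| - `|y|) ^+ 2).
  by rewrite real_exprn_even_ge0// rpredB// normr_real.
by rewrite sqrrB addrAC.
Qed.

(** The inequality 2 |x y| <= |x|^2 + |y|^2, applied termwise in [reg_inv_sum]. *)
Lemma reg_inv_offdiag_le a b : `|B a b| *+ 2 <= B a a + B b b.
Proof.
rewrite {1}reg_inv_sum mxE [X in `|_ + X|]mxE.
apply: (@le_trans _ _ ((\sum_m `|(V m a)^* * V m b| + e * \sum_j `|(B j a)^* * B j b|) *+ 2)).
  rewrite ler_wMn2r//; apply: le_trans (ler_normD _ _) _; apply: lerD.
    rewrite mxE; apply: le_trans (ler_norm_sum _ _ _) _.
    by apply: ler_sum => i _; rewrite !mxE.
  rewrite normrM gtr0_norm// ler_pM2l// mxE; apply: le_trans (ler_norm_sum _ _ _) _.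
  by apply: ler_sum => i _; rewrite !mxE.
rewrite (reg_inv_diagE a) (reg_inv_diagE b) addrACA -mulrDr -!big_split mulrnDl/=.
apply: lerD; first by rewrite -sumrMnl; apply: ler_sum => i _; rewrite -[`|V i a|]norm_conjC normM_le_sqr.
rewrite -mulrnAr ler_pM2l// -sumrMnl; apply: ler_sum => i _.
by rewrite -[`|B i a|]norm_conjC normM_le_sqr.
Qed.

(** The analogue of [reg_inv_sum] for Pi. Its diagonal gives |Pi_mm|^2 <= Pi_mm, hence values in
    [0, 1] as for a true projection. *)
Lemma reg_proj_sum : Pi = Pi *m adjm Pi + e *: (V *m adjm V).
Proof.
have aV : adjm V = B *m adjm H by rewrite /reg_zf adjmM adjm_reg_inv.
have aP : adjm Pi = H *m B *m adjm H by rewrite /reg_proj adjmM adjmK aV mulmxA.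
rewrite aP /reg_proj aV [V *m adjm H *m _]mulmxA [V *m adjm H *m _]mulmxA.
rewrite -(mulmxA V) -/(gram H) -(mulmxA V (gram H)) mul_gram_reg_inv mulmxBr mulmx1 mulmxBl.
by rewrite -scalemxAr -scalemxAl mulmxA subrK.
Qed.

Lemma reg_proj_diag_01 m : 0 <= Pi m m <= 1.
Proof.
have E : Pi m m = \sum_j `|Pi m j| ^+ 2 + e * \sum_j `|V m j| ^+ 2.
  by rewrite {1}reg_proj_sum mxE [X in _ + X]mxE !mul_adjm_diag.
have P0 : 0 <= Pi m m.
  rewrite E addr_ge0 ?mulr_ge0 ?(ltW e0)//.
    by apply: sumr_ge0 => i _; rewrite exprn_ge0.
  by apply: sumr_ge0 => i _; rewrite exprn_ge0.
have : `|Pi m m| ^+ 2 <= Pi m m.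
  rewrite [leRHS]E; apply: le_trans (_ : _ <= \sum_j `|Pi m j| ^+ 2) _.
    by apply: (ler_sum_term (F := fun j => `|Pi m j| ^+ 2)) => i; rewrite exprn_ge0.
  by rewrite lerDl mulr_ge0 ?(ltW e0)//; apply: sumr_ge0 => i _; rewrite exprn_ge0.
rewrite ger0_norm// P0 expr2 /=; move: P0; rewrite le_eqVlt => /predU1P[<-//|P0].
by rewrite ger_pMr.
Qed.

(** By cyclicity the trace of Pi is that of H^H V = 1 - e B. This is how K enters the integration by
    parts. *)
Lemma reg_proj_trace : \tr Pi = K%:R - e * \tr B.
Proof.
rewrite /reg_proj mxtrace_mulC adjm_reg_zf linearB/= linearZ/= mxtrace_scalar.
by rewrite -mulr_natr mul1r.
Qed.

Hypothesis H_unit : gram H \in unitmx.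
Local Notation N := (invmx (gram H)).

Lemma adjm_inv_gram : adjm N = N.
Proof. by apply: adjm_inv; exact: adjm_gram. Qed.

Lemma inv_gram_subE : N - B = e *: (B *m N).
Proof.
have := congr1 (mulmx^~ N) mul_reg_inv_gram.
by rewrite -mulmxA mulmxV// mulmx1 mulmxBl mul1mx -scalemxAl => {1}->; rewrite opprB addrC subrK.
Qed.

Lemma inv_gram_sum : N = adjm (H *m N) *m (H *m N).
Proof. by rewrite adjmM adjm_inv_gram -mulmxA (mulmxA (adjm H)) -/(gram H) mulmxV// mulmx1. Qed.

(** B and N commute, and B N becomes a sum of Gram matrices with positive weights. By
    [inv_gram_subE], N - B is then positive semidefinite. *)
Lemma reg_inv_mul_invE :
  B *m N = adjm B *m B + e *: (adjm (H *m N *m B) *m (H *m N *m B)).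
Proof.
have NB : N *m B = B *m N.
  have : e *: (N *m B) = e *: (B *m N).
    rewrite -inv_gram_subE.
    have := congr1 (mulmx N) mul_gram_reg_inv.
    by rewrite mulmxA mulVmx// mul1mx mulmxBr mulmx1 -scalemxAr => {2}->; rewrite opprB addrC subrK.
  by move/scalerI; apply; rewrite gt_eqF.
have -> : adjm (H *m N *m B) *m (H *m N *m B) = B *m (N *m B).
  rewrite adjmM adjm_reg_inv mulmxA -(mulmxA B) -inv_gram_sum mulmxA//.
rewrite adjm_reg_inv NB.
have := congr1 (mulmx^~ (B *m N)) mul_reg_inv_gram.
rewrite -NB -mulmxA (mulmxA _ N) mulmxV// mul1mx => ->.
by rewrite mulmxBl mul1mx -scalemxAl subrK.
Qed.

(** Provides a majorant independent of e, under which the limit of the off-diagonal expectations is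
    taken. *)
Lemma reg_inv_diag_le_inv_gram a : B a a <= N a a.
Proof.
rewrite -subr_ge0 (_ : _ - _ = (N - B) a a); last by rewrite !mxE.
rewrite inv_gram_subE reg_inv_mul_invE mxE mulr_ge0 ?(ltW e0)// mxE [X in _ + X]mxE.
rewrite !adjm_mul_diag addr_ge0// ?mulr_ge0 ?(ltW e0)//.
  by apply: sumr_ge0 => i _; rewrite exprn_ge0.
by apply: sumr_ge0 => i _; rewrite exprn_ge0.
Qed.

End fixed.

(* On the singular set a null vector of the Gram matrix is an eigenvector of the
   regularized inverse for the eigenvalue 1/e, which forces a large diagonal. *)
Lemma reg_inv_singular (e : C) H : 0 < e -> gram H \notin unitmx ->
  (e * K%:R)^-1 <= \sum_a reg_inv e H a a.
Proof.
move=> e0; rewrite -row_free_unit -kermx_eq0 => /rowV0Pn[u /sub_kermxP uA u0].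
have K0 : (0 < K)%N.
  rewrite lt0n; apply: contraNneq u0 => K0; apply/eqP/rowP => -[j jK]; exfalso.
  by move: jK; rewrite K0.
have uB : u *m reg_inv e H = e^-1 *: u.
  have : u *m reg_gram e H = e *: u by rewrite /reg_gram mulmxDr uA add0r mul_mx_scalar.
  move=> /(congr1 (mulmx^~ (reg_inv e H))); rewrite -mulmxA mulmxV ?reg_gram_unit// mulmx1 -scalemxAl.
  by move=> {2}->; rewrite scalerA mulVf ?scale1r// gt_eqF.
(* At an index where |u_a| is largest, column a of u B = u / e gives 1 / e <= sum_j |B_ja|. *)
have [a Ha] : exists a, forall j, `|u 0 j| <= `|u 0 a|.
  have i0 : 'I_K by exact: Ordinal K0.
  have [a _ ha] := @real_arg_maxP _ _ i0 xpredT (fun j => `|u 0 j|) isT (fun j _ => normr_real _).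
  by exists a => j; exact: ha.
have ua : 0 < `|u 0 a|.
  rewrite normr_gt0; apply: contraNneq u0 => ua; apply/eqP/rowP => j; rewrite mxE.
  by apply/eqP; rewrite -normr_le0 (le_trans (Ha j))// ua normr0.
have h1 : e^-1 <= \sum_j `|reg_inv e H j a|.
  have := congr1 (fun X : 'rV_K => X 0 a) uB; rewrite !mxE => h.
  have : e^-1 * `|u 0 a| <= (\sum_j `|reg_inv e H j a|) * `|u 0 a|.
    rewrite -[e^-1]gtr0_norm ?invr_gt0// -normrM -h mulr_suml.
    apply: le_trans (ler_norm_sum _ _ _) _; apply: ler_sum => j _.
    by rewrite normrM mulrC ler_wpM2l.
  by rewrite ler_pM2r.
have eK0 : 0 < e * K%:R by rewrite mulr_gt0// ltr0n.
(* Sum of 2 b <= 1 / (e K) + e K b^2 over the K entries of column a; by [reg_inv_diagE] the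
   quadratic part is at most K B_aa. *)
have h2 : (\sum_j `|reg_inv e H j a|) *+ 2 <= e^-1 + K%:R * reg_inv e H a a.
  apply: (@le_trans _ _ (\sum_(j < K) ((e * K%:R)^-1 + e * K%:R * `|reg_inv e H j a| ^+ 2))).
    rewrite -sumrMnl; apply: ler_sum => j _; set b := `|_|.
    rewrite -(ler_pM2l eK0 (b *+ 2)) [X in _ <= X]mulrDr mulfV ?gt_eqF// -subr_ge0.
    rewrite (_ : _ - _ = (1 - e * K%:R * b) ^+ 2); last by rewrite -mulr_natl; ring.
    have b0 : 0 <= e * K%:R * b by rewrite mulr_ge0 ?(ltW eK0)// normr_ge0.
    by rewrite real_exprn_even_ge0// rpredB ?rpred1// ger0_real.
  have eKV : (e * K%:R)^-1 *+ K = e^-1.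
    by rewrite -[LHS]mulr_natr invfM -mulrA mulVf ?mulr1// pnatr_eq0 -lt0n.
  rewrite big_split/= sumr_const card_ord eKV.
  rewrite lerD2l -mulr_sumr (mulrC e) -mulrA ler_pM2l ?ltr0n//.
  rewrite [leRHS]reg_inv_diagE// lerDr.
  by apply: sumr_ge0 => i _; rewrite exprn_ge0.
have h3 : e^-1 <= K%:R * reg_inv e H a a.
  rewrite -(lerD2l e^-1); apply: le_trans h2; rewrite -mulr2n.
  by rewrite ler_wMn2r.
apply: (@le_trans _ _ (reg_inv e H a a)); last first.
  apply: (ler_sum_term (F := fun a => reg_inv e H a a)) => j.
  exact: reg_inv_diag_ge0.
by rewrite invfM ler_pdivrMr ?ltr0n// mulrC.
Qed.

End regularized_gram.

(** * Determinants, adjugates and inverses within a class of functions closed under ring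
    operations *)

Section ring_closed_class.
Context {T : Type} {F : fieldType}.
Variable S : (T -> F) -> Prop.
Hypothesis S_cst : forall a, S (fun=> a).
Hypothesis S_add : forall f g, S f -> S g -> S (fun t => f t + g t).
Hypothesis S_mul : forall f g, S f -> S g -> S (fun t => f t * g t).

Lemma class_sum (I : Type) (r : seq I) (Q : pred I) (f : I -> T -> F) :
  (forall i, S (f i)) -> S (fun t => \sum_(i <- r | Q i) f i t).
Proof.
move=> Sf; elim: r => [|i r ih].
  by rewrite (_ : (fun t => _) = fun=> 0)//; apply/funext => t; rewrite big_nil.
rewrite (_ : (fun t => _) = fun t => (if Q i then f i t else 0) + \sum_(i <- r | Q i) f i t).
  by apply: S_add => //; case: (Q i).
by apply/funext => t; rewrite big_cons; case: (Q i); rewrite ?add0r.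
Qed.

Lemma class_prod (I : Type) (r : seq I) (f : I -> T -> F) :
  (forall i, S (f i)) -> S (fun t => \prod_(i <- r) f i t).
Proof.
move=> Sf; elim: r => [|i r ih].
  by rewrite (_ : (fun t => _) = fun=> 1)//; apply/funext => t; rewrite big_nil.
rewrite (_ : (fun t => _) = fun t => f i t * \prod_(i <- r) f i t); first exact: S_mul.
by apply/funext => t; rewrite big_cons.
Qed.

Definition class_mx m n (A : T -> 'M[F]_(m, n)) := forall i j, S (fun t => A t i j).

Lemma class_mulmx m n p (A : T -> 'M[F]_(m, n)) (B : T -> 'M[F]_(n, p)) :
  class_mx A -> class_mx B -> class_mx (fun t => A t *m B t).
Proof.
move=> SA SB i j; rewrite (_ : (fun t => _) = fun t => \sum_k A t i k * B t k j).
  by apply: class_sum => k; exact: S_mul.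
by apply/funext => t; rewrite mxE.
Qed.

Lemma class_addmx m n (A B : T -> 'M[F]_(m, n)) :
  class_mx A -> class_mx B -> class_mx (fun t => A t + B t).
Proof.
move=> SA SB i j; rewrite (_ : (fun t => _) = fun t => A t i j + B t i j); first exact: S_add.
by apply/funext => t; rewrite mxE.
Qed.

Lemma class_det n (A : T -> 'M[F]_n) : class_mx A -> S (fun t => \det (A t)).
Proof.
move=> SA; apply: class_sum => s; apply: S_mul => //.
by apply: class_prod => i; exact: SA.
Qed.

Lemma class_adjugate n (A : T -> 'M[F]_n) : class_mx A -> class_mx (fun t => \adj (A t)).
Proof.
move=> SA i j.
rewrite (_ : (fun t => _) = fun t => (-1) ^+ (j + i) * \det (row' j (col' i (A t)))); last first.
  by apply/funext => t; rewrite mxE.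
apply: S_mul => //; apply: class_det => k l.
rewrite (_ : (fun t => _) = fun t => A t (lift j k) (lift i l)); first exact: SA.
by apply/funext => t; rewrite !mxE.
Qed.

(** Cramer's formula: only the reciprocal of the determinant goes beyond ring operations. *)
Lemma class_invmx n (A : T -> 'M[F]_n) :
  class_mx A -> S (fun t => (\det (A t))^-1) -> (forall t, A t \in unitmx) ->
  class_mx (fun t => invmx (A t)).
Proof.
move=> SA SV uA i j; rewrite (_ : (fun t => _) = fun t => (\det (A t))^-1 * \adj (A t) i j).
  by apply: S_mul => //; exact: class_adjugate.
by apply/funext => t; rewrite /invmx uA mxE.
Qed.

End ring_closed_class.

(** * Measurability of complex matrix functions of the coordinates *)

Section complex_measurable.
Context {R : realType} {I : finType}.
Local Notation C := R[i].

Lemma measurable_inv : measurable_fun setT (fun x : R => x^-1).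
Proof.
rewrite (_ : (fun x : R => x^-1) = fun x => if x == 0 then 0 else x^-1); last first.
  by apply/funext => x; case: eqVneq => // ->; rewrite invr0.
apply: measurable_fun_if => //; first exact: measurable_fun_eqr.
rewrite setTI; apply: open_continuous_measurable_fun.
  rewrite (_ : _ @^-1` _ = ~` [set 0]).
    exact/closed_openC/closed_eq.
  by apply/seteqP; split => x /=; [move/eqP|move=> /eqP/negbTE].
by move=> x; rewrite inE/= => /negbT x0; exact: inv_continuous.
Qed.

Definition cmeas (F : (I -> R) -> C) :=
  coord_measurable (fun x => complex.Re (F x)) /\ coord_measurable (fun x => complex.Im (F x)).

Lemma cmeas_cst a : cmeas (fun=> a).
Proof. by split => d T Z mZ; exact: measurable_cst. Qed.

Lemma cmeas_add f g : cmeas f -> cmeas g -> cmeas (fun x => f x + g x).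
Proof.
move=> [f1 f2] [g1 g2]; split => d T Z mZ.
  rewrite (_ : (fun t => _) = (fun t => complex.Re (f (Z ^~ t)) + complex.Re (g (Z ^~ t)))).
    by apply: measurable_funD; [exact: f1|exact: g1].
  by apply/funext => t; case: (f _) => ? ?; case: (g _).
rewrite (_ : (fun t => _) = (fun t => complex.Im (f (Z ^~ t)) + complex.Im (g (Z ^~ t)))).
  by apply: measurable_funD; [exact: f2|exact: g2].
by apply/funext => t; case: (f _) => ? ?; case: (g _).
Qed.

Lemma creM (x y : C) : complex.Re (x * y) =
  complex.Re x * complex.Re y - complex.Im x * complex.Im y.
Proof. by case: x => ? ?; case: y. Qed.

Lemma cimM (x y : C) : complex.Im (x * y) =
  complex.Re x * complex.Im y + complex.Im x * complex.Re y.
Proof. by case: x => ? ?; case: y. Qed.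

Lemma creD (x y : C) : complex.Re (x + y) = complex.Re x + complex.Re y.
Proof. by case: x => ? ?; case: y. Qed.

Lemma cimD (x y : C) : complex.Im (x + y) = complex.Im x + complex.Im y.
Proof. by case: x => ? ?; case: y. Qed.

Lemma cmeas_mul f g : cmeas f -> cmeas g -> cmeas (fun x => f x * g x).
Proof.
move=> [f1 f2] [g1 g2]; split => d T Z mZ.
  under eq_fun do rewrite creM.
  by apply: measurable_funB; apply: measurable_funM; [exact: f1|exact: g1|exact: f2|exact: g2].
under eq_fun do rewrite cimM.
by apply: measurable_funD; apply: measurable_funM; [exact: f1|exact: g2|exact: f2|exact: g1].
Qed.

Lemma cmeas_conj f : cmeas f -> cmeas (fun x => Num.conj (f x)).
Proof.
move=> [f1 f2]; split => d T Z mZ.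
  rewrite (_ : (fun t => _) = (fun t => complex.Re (f (Z ^~ t)))); first exact: f1.
  by apply/funext => t; case: (f _).
rewrite (_ : (fun t => _) = (fun t => - complex.Im (f (Z ^~ t)))).
  by apply: measurableT_comp => //; exact: f2.
by apply/funext => t; case: (f _).
Qed.

Lemma cmeas_inv f : cmeas f -> cmeas (fun x => (f x)^-1).
Proof.
move=> [f1 f2].
have m2 d (T : measurableType d) (Z : I -> T -> R) : (forall i, measurable_fun setT (Z i)) ->
    measurable_fun setT (fun t =>
      (complex.Re (f (Z ^~ t)) ^+ 2 + complex.Im (f (Z ^~ t)) ^+ 2)^-1).
  move=> mZ; apply: (measurableT_comp measurable_inv).
  by apply: measurable_funD; apply: measurable_funX; [exact: f1|exact: f2].
split => d T Z mZ.
  rewrite (_ : (fun t => _) = (fun t => complex.Re (f (Z ^~ t)) /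
      (complex.Re (f (Z ^~ t)) ^+ 2 + complex.Im (f (Z ^~ t)) ^+ 2))).
    by apply: measurable_funM; [exact: f1|exact: m2].
  by apply/funext => t; case: (f _).
rewrite (_ : (fun t => _) = (fun t => - (complex.Im (f (Z ^~ t)) /
      (complex.Re (f (Z ^~ t)) ^+ 2 + complex.Im (f (Z ^~ t)) ^+ 2)))).
  by apply: measurableT_comp => //; apply: measurable_funM; [exact: f2|exact: m2].
by apply/funext => t; case: (f _).
Qed.

Lemma cmeas_if0 c f g : cmeas c -> cmeas f -> cmeas g ->
  cmeas (fun x => if c x == 0 then f x else g x).
Proof.
move=> [c1 c2] [f1 f2] [g1 g2].
have mb d (T : measurableType d) (Z : I -> T -> R) : (forall i, measurable_fun setT (Z i)) ->
    measurable_fun setT (fun t => c (Z ^~ t) == 0).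
  move=> mZ; rewrite (_ : (fun t => _) = (fun t =>
    (complex.Re (c (Z ^~ t)) == 0) && (complex.Im (c (Z ^~ t)) == 0))).
    apply: measurable_and; apply: measurable_fun_eqr => //; [exact: c1|exact: c2].
  by apply/funext => t; rewrite eq_complex.
split => d T Z mZ.
  under eq_fun do rewrite (fun_if (@complex.Re R)).
  by apply: measurable_fun_ifT; [exact: mb|exact: f1|exact: g1].
under eq_fun do rewrite (fun_if (@complex.Im R)).
by apply: measurable_fun_ifT; [exact: mb|exact: f2|exact: g2].
Qed.

Definition cmeas_mx m n (A : (I -> R) -> 'M[C]_(m, n)) := class_mx cmeas A.

Lemma cmeas_mulmx m n p (A : (I -> R) -> 'M[C]_(m, n)) (B : (I -> R) -> 'M[C]_(n, p)) :
  cmeas_mx A -> cmeas_mx B -> cmeas_mx (fun x => A x *m B x).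
Proof. exact: (class_mulmx cmeas_cst cmeas_add cmeas_mul). Qed.

Lemma cmeas_adjm m n (A : (I -> R) -> 'M[C]_(m, n)) :
  cmeas_mx A -> cmeas_mx (fun x => adjm (A x)).
Proof.
move=> mA i j; rewrite (_ : (fun x => _) = fun x => Num.conj (A x j i)); first exact: cmeas_conj.
by apply/funext => x; rewrite !mxE.
Qed.

(** Singular values may occur here, where [invmx] returns the matrix itself; the two branches are
    separated by the measurable test on the determinant. *)
Lemma cmeas_invmx n (A : (I -> R) -> 'M[C]_n) : cmeas_mx A -> cmeas_mx (fun x => invmx (A x)).
Proof.
move=> mA i j.
have mdet := class_det cmeas_cst cmeas_add cmeas_mul mA.
rewrite (_ : (fun x => _) = fun x => if \det (A x) == 0 then A x i j else
    (\det (A x))^-1 * \adj (A x) i j).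
  apply: cmeas_if0 => //; apply: cmeas_mul; first exact: cmeas_inv.
  exact: (class_adjugate cmeas_cst cmeas_add cmeas_mul).
apply/funext => x; rewrite /invmx unitmxE unitfE; case: eqVneq => //= _.
by rewrite mxE.
Qed.

End complex_measurable.

(** * Complex matrix functions of a real variable and their derivatives *)

Section complex_derivative.
Context {R : realType}.
Local Notation C := R[i].
Implicit Types f g : R -> C.

(** The variable is real, so conjugation, and with it the conjugate transpose, can be
    differentiated. *)
Definition is_cderive f (t : R) (df : C) :=
  is_derive t 1 (fun u => complex.Re (f u) : R) (complex.Re df) /\
  is_derive t 1 (fun u => complex.Im (f u) : R) (complex.Im df).

Lemma is_cderive_cst a t : is_cderive (fun=> a) t 0.
Proof. by split; exact: is_derive_cst. Qed.

Lemma is_cderiveD f g t df dg : is_cderive f t df -> is_cderive g t dg ->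
  is_cderive (fun u => f u + g u) t (df + dg).
Proof.
move=> [f1 f2] [g1 g2]; split.
  by under eq_fun do rewrite creD; rewrite creD; exact: is_deriveD.
by under eq_fun do rewrite cimD; rewrite cimD; exact: is_deriveD.
Qed.

Lemma is_cderiveM f g t df dg : is_cderive f t df -> is_cderive g t dg ->
  is_cderive (fun u => f u * g u) t (df * g t + f t * dg).
Proof.
move=> [f1 f2] [g1 g2]; split.
  under eq_fun do rewrite creM.
  apply: is_derive_eq; rewrite creD !creM /GRing.scale/=; ring.
under eq_fun do rewrite cimM.
apply: is_derive_eq; rewrite cimD !cimM /GRing.scale/=; ring.
Qed.

Lemma is_cderive_conj f t df : is_cderive f t df ->
  is_cderive (fun u => Num.conj (f u)) t (Num.conj df).
Proof.
move=> [f1 f2]; split.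
  rewrite (_ : (fun u => _) = (fun u => complex.Re (f u))); first by case: (df) f1.
  by apply/funext => u; case: (f u).
rewrite (_ : (fun u => _) = (fun u => - complex.Im (f u))).
  by rewrite (_ : complex.Im _ = - complex.Im df); [exact: is_deriveN|case: (df)].
by apply/funext => u; case: (f u).
Qed.

Lemma is_cderive_unique f t df dg : is_cderive f t df -> is_cderive f t dg -> df = dg.
Proof.
move=> [[_ f1] [_ f2]] [[_ g1] [_ g2]].
by apply/eqP; rewrite eq_complex -f1 -f2 -g1 -g2 !eqxx.
Qed.

Definition cderivable f := forall t, exists df, is_cderive f t df.

Lemma cderivable_cst a : cderivable (fun=> a).
Proof. by move=> t; exists 0; exact: is_cderive_cst. Qed.

Lemma cderivable_add f g : cderivable f -> cderivable g -> cderivable (fun t => f t + g t).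
Proof. by move=> df dg t; have [a ?] := df t; have [b ?] := dg t; exists (a + b); exact: is_cderiveD. Qed.

Lemma cderivable_mul f g : cderivable f -> cderivable g -> cderivable (fun t => f t * g t).
Proof.
move=> df dg t; have [a ?] := df t; have [b ?] := dg t; exists (a * g t + f t * b).
exact: is_cderiveM.
Qed.

Lemma cderivable_conj f : cderivable f -> cderivable (fun t => Num.conj (f t)).
Proof. by move=> df t; have [a ?] := df t; exists (Num.conj a); exact: is_cderive_conj. Qed.

Lemma cderivable_inv f : cderivable f -> (forall t, f t != 0) -> cderivable (fun t => (f t)^-1).
Proof.
move=> df f0 t; have [a [f1 f2]] := df t.
pose n2 u : R := complex.Re (f u) ^+ 2 + complex.Im (f u) ^+ 2.
have n20 : n2 t != 0.
  apply: contra_neq (f0 t); rewrite /n2 => /eqP; rewrite paddr_eq0 ?sqr_ge0//.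
  rewrite !expf_eq0/= => /andP[a1 a2].
  by apply/eqP; rewrite eq_complex a1 a2.
have [[r1 _] [r2 _]] := (f1, f2).
have dn2 : derivable n2 t 1 by exact: (derivableD (derivableM r1 r1) (derivableM r2 r2)).
have dV : derivable (fun u => (n2 u)^-1) t 1 by exact: derivableV.
have d1 : derivable (fun u => complex.Re (f u) / n2 u : R) t 1.
  exact: (derivableM r1 dV).
have d2 : derivable (fun u => - (complex.Im (f u) / n2 u) : R) t 1.
  exact: (derivableN (derivableM r2 dV)).
exists (Complex ('D_1 (fun u => complex.Re (f u) / n2 u : R) t)
  ('D_1 (fun u => - (complex.Im (f u) / n2 u) : R) t)); split => /=.
  rewrite (_ : (fun u => _) = (fun u => complex.Re (f u) / n2 u)); first exact/derivableP.
  by apply/funext => u; rewrite /n2; case: (f u).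
rewrite (_ : (fun u => _) = (fun u => - (complex.Im (f u) / n2 u))); first exact/derivableP.
by apply/funext => u; rewrite /n2; case: (f u).
Qed.

Lemma cderivable_continuous f : cderivable f ->
  continuous (fun t => complex.Re (f t) : R) /\ continuous (fun t => complex.Im (f t) : R).
Proof.
move=> df; split => t; apply/differentiable_continuous/derivable1_diffP.
  by have [a [[] //]] := df t.
by have [a [_ []]] := df t.
Qed.

Definition is_mxderive m n (A : R -> 'M[C]_(m, n)) (t : R) (dA : 'M[C]_(m, n)) :=
  forall i j, is_cderive (fun u => A u i j) t (dA i j).

Lemma is_cderive_sum (I : Type) (r : seq I) (f : I -> R -> C) t (df : I -> C) :
  (forall i, is_cderive (f i) t (df i)) ->
  is_cderive (fun u => \sum_(i <- r) f i u) t (\sum_(i <- r) df i).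
Proof.
move=> h; elim: r => [|i r ih].
  rewrite big_nil (_ : (fun u => _) = fun=> 0); first exact: is_cderive_cst.
  by apply/funext => u; rewrite big_nil.
rewrite big_cons (_ : (fun u => _) = fun u => f i u + \sum_(i <- r) f i u); first exact: is_cderiveD.
by apply/funext => u; rewrite big_cons.
Qed.

Lemma is_mxderiveM m n p (A : R -> 'M[C]_(m, n)) (B : R -> 'M[C]_(n, p)) t dA dB :
  is_mxderive A t dA -> is_mxderive B t dB ->
  is_mxderive (fun u => A u *m B u) t (dA *m B t + A t *m dB).
Proof.
move=> hA hB i j; rewrite !mxE -big_split/=.
rewrite (_ : (fun u => _) = (fun u => \sum_k A u i k * B u k j)); last first.
  by apply/funext => u; rewrite mxE.
by apply: is_cderive_sum => k; exact: is_cderiveM.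
Qed.

Lemma is_mxderive_adjm m n (A : R -> 'M[C]_(m, n)) t dA :
  is_mxderive A t dA -> is_mxderive (fun u => adjm (A u)) t (adjm dA).
Proof.
move=> hA i j; rewrite !mxE (_ : (fun u => _) = fun u => Num.conj (A u j i)); first exact: is_cderive_conj.
by apply/funext => u; rewrite !mxE.
Qed.

Section reg_zf_derivative.
Variables (M K : nat) (e : C) (H0 E : 'M[C]_(M, K)).
Hypothesis e0 : 0 < e.

Definition line (t : R) : 'M[C]_(M, K) := H0 + (RC t) *: E.

Lemma is_mxderive_line t : is_mxderive line t E.
Proof.
move=> i j; split.
  rewrite (_ : (fun u => _) = (fun u : R => complex.Re (H0 i j) + u * complex.Re (E i j))).
    by apply: is_derive_eq; rewrite /GRing.scale/=; ring.
  by apply/funext => u; rewrite !mxE creD creM /= mul0r subr0.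
rewrite (_ : (fun u => _) = (fun u : R => complex.Im (H0 i j) + u * complex.Im (E i j))).
  by apply: is_derive_eq; rewrite /GRing.scale/=; ring.
by apply/funext => u; rewrite !mxE cimD cimM /= mul0r addr0.
Qed.

Local Notation H := line.
Local Notation B t := (reg_inv e (H t)).
Local Notation V t := (reg_zf e (H t)).

Let dG t : 'M[C]_K := adjm E *m H t + adjm (H t) *m E.

Let is_mxderive_reg_gram t : is_mxderive (fun u => reg_gram e (H u)) t (dG t).
Proof.
move=> i j; rewrite -[dG t i j]addr0.
rewrite (_ : (fun u => _) = fun u => (adjm (H u) *m H u) i j + (e%:M : 'M[C]_K) i j).
  apply: is_cderiveD; last exact: is_cderive_cst.
  apply: is_mxderiveM; last exact: is_mxderive_line.
  by apply: is_mxderive_adjm; exact: is_mxderive_line.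
by apply/funext => u; rewrite mxE.
Qed.

Lemma cderivable_reg_inv : class_mx cderivable (fun t => B t).
Proof.
have dGr : class_mx cderivable (fun t => reg_gram e (H t)).
  by move=> i j t; exists (dG t i j); exact: is_mxderive_reg_gram.
apply: (class_invmx cderivable_cst cderivable_add cderivable_mul) => //.
- apply: cderivable_inv.
    exact: (class_det cderivable_cst cderivable_add cderivable_mul).
  by move=> t; rewrite -unitfE -unitmxE reg_gram_unit.
- by move=> t; exact: reg_gram_unit.
Qed.

(** Existence of the derivative comes from Cramer's formula, its value from differentiating B (A +
    e) = 1. *)
Lemma is_mxderive_reg_inv t : is_mxderive (fun u => B u) t (- (B t *m dG t *m B t)).
Proof.
pose dB := \matrix_(i, j) projT1 (cid (cderivable_reg_inv i j t)).
have hB : is_mxderive (fun u => B u) t dB.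
  by move=> i j; rewrite mxE; exact: (projT2 (cid (cderivable_reg_inv i j t))).
have h1 : dB *m reg_gram e (H t) + B t *m dG t = 0.
  apply/matrixP => i j.
  apply: (is_cderive_unique (is_mxderiveM hB (is_mxderive_reg_gram t) i j)).
  rewrite mxE (_ : (fun u => _) = fun=> (1%:M : 'M[C]_K) i j); first exact: is_cderive_cst.
  by apply/funext => u; rewrite mulVmx ?reg_gram_unit.
suff -> : - (B t *m dG t *m B t) = dB by [].
have GB : reg_gram e (H t) *m B t = 1%:M by rewrite mulmxV ?reg_gram_unit.
have := congr1 (mulmx^~ (B t)) h1.
rewrite mulmxDl mul0mx -(mulmxA dB) GB mulmx1 => /eqP.
by rewrite addr_eq0 => /eqP ->.
Qed.

Lemma cderivable_reg_zf : class_mx cderivable (fun t => V t).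
Proof.
apply: (class_mulmx cderivable_cst cderivable_add cderivable_mul).
  by move=> i j t; exists (E i j); exact: is_mxderive_line.
exact: cderivable_reg_inv.
Qed.

(** The product rule for V = H B, with E^H H + H^H E as the derivative of the Gram matrix; V H^H is
    then recognized as Pi. *)
Lemma is_mxderive_reg_zf t : is_mxderive (fun u => V u) t
  (E *m B t - reg_proj e (H t) *m E *m B t - V t *m adjm E *m V t).
Proof.
have -> : E *m B t - reg_proj e (H t) *m E *m B t - V t *m adjm E *m V t =
    E *m B t + H t *m - (B t *m dG t *m B t).
  rewrite /reg_proj /dG /reg_zf mulmxN mulmxDr mulmxDl mulmxDr opprD -!mulmxA.
  by rewrite [X in _ = _ + X]addrC addrA.
by apply: is_mxderiveM; [exact: is_mxderive_line|exact: is_mxderive_reg_inv].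
Qed.

End reg_zf_derivative.
End complex_derivative.

(** * Expectations of functions of a Gaussian family *)

Section coordinate_expectation.
Context {R : realType} {d : measure_display} {Omega : measurableType d}.
Variables (P : probability Omega R) (I : finType) (X : I -> Omega -> R) (s : I -> R).
Hypotheses (gX : gaussian_family P X s) (s0 : forall i, 0 < s i).
Implicit Types F G : (I -> R) -> R.

Definition Ex F : R := \int[P]_w F (X ^~ w).
Definition integ F := P.-integrable setT (fun w => (F (X ^~ w))%:E).

Let mX l : measurable_fun setT (X l). Proof. exact: gaussian_family_measurable gX. Qed.

Lemma ExE F : integ F -> (\int[P]_w (F (X ^~ w))%:E = (Ex F)%:E)%E.
Proof. by move=> iF; rewrite /Ex /Rintegral fineK//; exact: integrable_fin_num. Qed.

Lemma coord_meas_X F : coord_measurable F -> measurable_fun setT (fun w => F (X ^~ w)).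
Proof. by move=> mF; apply: mF. Qed.

Lemma integD F G : integ F -> integ G -> integ (fun x => F x + G x).
Proof. by move=> iF iG; have := integrableD measurableT iF iG. Qed.

Lemma integZ c F : integ F -> integ (fun x => c * F x).
Proof. by move=> iF; have := integrableZl measurableT c iF. Qed.

Lemma ExD F G : integ F -> integ G -> Ex (fun x => F x + G x) = Ex F + Ex G.
Proof. by move=> iF iG; rewrite /Ex RintegralD. Qed.

Lemma ExZ c F : integ F -> Ex (fun x => c * F x) = c * Ex F.
Proof. by move=> iF; rewrite /Ex RintegralZl. Qed.

Lemma integ_cst c : integ (fun=> c).
Proof. exact: finite_measure_integrable_cst. Qed.

Lemma Ex_cst c : Ex (fun=> c) = c.
Proof. by rewrite /Ex Rintegral_cst//= probability_setT mulr1. Qed.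

Lemma integ_sum (T : Type) (r : seq T) (F : T -> (I -> R) -> R) :
  (forall j, integ (F j)) -> integ (fun x => \sum_(j <- r) F j x).
Proof.
move=> iF; elim: r => [|j r ih].
  by rewrite (_ : (fun x => _) = fun=> 0); [exact: integ_cst|apply/funext => x; rewrite big_nil].
rewrite (_ : (fun x => _) = fun x => F j x + \sum_(j <- r) F j x); first exact: integD.
by apply/funext => x; rewrite big_cons.
Qed.

Lemma Ex_sum (T : Type) (r : seq T) (F : T -> (I -> R) -> R) :
  (forall j, integ (F j)) -> Ex (fun x => \sum_(j <- r) F j x) = \sum_(j <- r) Ex (F j).
Proof.
move=> iF; elim: r => [|j r ih].
  rewrite big_nil (_ : (fun x => _) = fun=> 0); first exact: Ex_cst.
  by apply/funext => x; rewrite big_nil.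
rewrite (_ : (fun x => _) = fun x => F j x + \sum_(j <- r) F j x).
  by rewrite ExD//; [rewrite ih big_cons|exact: integ_sum].
by apply/funext => x; rewrite big_cons.
Qed.

Lemma Ex_le F G : integ F -> integ G -> (forall x, F x <= G x) -> Ex F <= Ex G.
Proof. by move=> iF iG FG; apply: le_Rintegral. Qed.

Lemma integ_le F G : coord_measurable F -> integ G -> (forall x, `|F x| <= G x) -> integ F.
Proof.
move=> mF iG FG; apply: le_integrable iG => //.
  by apply/measurable_EFinP; exact: coord_meas_X.
by move=> w _ /=; rewrite lee_fin (le_trans (FG _))// ler_norm.
Qed.

Lemma integ_bounded F (c : R) : coord_measurable F -> (forall x, `|F x| <= c) -> integ F.
Proof. by move=> mF Fc; apply: (integ_le mF (integ_cst c)). Qed.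

Lemma coord_measurable_coord i : coord_measurable (fun x : I -> R => x i).
Proof. by move=> d0 T Z; exact. Qed.

Lemma coord_measurableM F G : coord_measurable F -> coord_measurable G ->
  coord_measurable (fun x => F x * G x).
Proof. by move=> mF mG d0 T Z mZ; apply: measurable_funM; [exact: mF|exact: mG]. Qed.

Lemma coord_measurableD F G : coord_measurable F -> coord_measurable G ->
  coord_measurable (fun x => F x + G x).
Proof. by move=> mF mG d0 T Z mZ; apply: measurable_funD; [exact: mF|exact: mG]. Qed.

Lemma coord_measurable_cst (c : R) : coord_measurable (fun _ : I -> R => c).
Proof. by move=> d0 T Z mZ; exact: measurable_cst. Qed.

Lemma upd_same (x : I -> R) i t : upd x i t i = t.
Proof. by rewrite /upd eqxx. Qed.

(** Resampling coordinate [i] leaves [G] unchanged, so the inner integral is the mean of [phi] times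
    a constant. The same computation with absolute values gives integrability. *)
Lemma Ex_factor i (phi : R -> R) G :
  measurable_fun setT phi -> (gaussian (s i)).-integrable setT (EFin \o phi) ->
  coord_measurable G -> (forall x t, G (upd x i t) = G x) -> integ G ->
  integ (fun x => phi (x i) * G x) /\
  Ex (fun x => phi (x i) * G x) = (\int[gaussian (s i)]_t phi t) * Ex G.
Proof.
move=> mphi iphi mG Gi iG.
have mF : coord_measurable (fun x => phi (x i) * G x).
  apply: coord_measurableM => // d0 T Z mZ.
  by apply: (measurableT_comp mphi); exact: mZ.
have fin : (\int[gaussian (s i)]_t `|phi t|%:E)%E \is a fin_num.
  by apply: integrable_fin_num => //; exact: (integrable_abse iphi).
have iF : integ (fun x => phi (x i) * G x).
  apply/integrableP; split; first by apply/measurable_EFinP; exact: (coord_meas_X mF).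
  rewrite (ge0_resample (F := fun x => `|(phi (x i) * G x)%:E|%E) i gX)//; last first.
    by move=> d0 T Z mZ; apply: measurableT_comp => //; apply/measurable_EFinP; exact: mF.
  pose c := fine (\int[gaussian (s i)]_t `|phi t|%:E)%E.
  have cE : (c%:E = \int[gaussian (s i)]_t `|phi t|%:E)%E by rewrite /c fineK.
  have c0 : 0 <= c by rewrite /c fine_ge0// integral_ge0.
  rewrite (_ : (fun w => _) = (fun w => c%:E * `|(G (X ^~ w))%:E|)%E).
    rewrite ge0_integralZl//.
    - by apply: lte_mul_pinfty => //; case/integrableP: iG.
    - by apply: measurableT_comp => //; apply/measurable_EFinP; exact: (coord_meas_X mG).
  apply/funext => w; rewrite cE -ge0_integralZr//.
    by apply: eq_integral => t _; rewrite upd_same Gi EFinM abseM.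
  have mn : measurable_fun setT (fun t => `|phi t|) by exact: measurableT_comp.
  by apply: measurableT_comp.
split => //.
have cE : ((\int[gaussian (s i)]_t phi t)%:E = \int[gaussian (s i)]_t (phi t)%:E)%E.
  by rewrite /Rintegral fineK//; exact: integrable_fin_num.
apply: EFin_inj; rewrite -ExE// (resample (F := fun x => phi (x i) * G x) i gX)// EFinM -ExE//.
rewrite -integralZl//; apply: eq_integral => w _.
rewrite cE muleC -integralZl//.
by apply: eq_integral => t _; rewrite upd_same Gi mulrC EFinM.
Qed.

Lemma integrable_gaussian_id i : (gaussian (s i)).-integrable setT (fun x => x%:E).
Proof.
apply: (integrable_gaussian_poly (s0 i) (C := 1)) => // x.
by rewrite mul1r expr2; have := normr_ge0 x; nra.
Qed.

Lemma integrable_gaussian_sqr i : (gaussian (s i)).-integrable setT (fun x => (x ^+ 2)%:E).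
Proof.
apply: (integrable_gaussian_poly (s0 i) (C := 1)).
  exact: measurable_funX.
by move=> x; rewrite mul1r normrX; have := normr_ge0 x; nra.
Qed.

Lemma Ex_coordM i G : coord_measurable G -> (forall x t, G (upd x i t) = G x) -> integ G ->
  integ (fun x => x i * G x) /\ Ex (fun x => x i * G x) = 0.
Proof.
move=> mG Gi iG; have [//|h ->] := Ex_factor (phi := id) _ (integrable_gaussian_id i) mG Gi iG.
by split => //; rewrite /Rintegral gaussian_mean// mul0r.
Qed.

Lemma Ex_coord_sqrM i G : coord_measurable G -> (forall x t, G (upd x i t) = G x) -> integ G ->
  integ (fun x => x i ^+ 2 * G x) /\ Ex (fun x => x i ^+ 2 * G x) = s i ^+ 2 * Ex G.
Proof.
move=> mG Gi iG; have [|h ->] := Ex_factor (phi := fun t => t ^+ 2) _ (integrable_gaussian_sqr i) mG Gi iG.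
  exact: measurable_funX.
by split => //; rewrite /Rintegral gaussian_second_moment.
Qed.

(** After resampling coordinate [i] the others are frozen and the one-dimensional identity applies
    to [F] as a function of that coordinate; a bound by [c] implies the linear growth it asks
    for. *)
Lemma stein_coord i F F' (c : R) : coord_measurable F -> coord_measurable F' ->
  (forall x (t : R), is_derive t 1 (fun u : R => F (upd x i u)) (F' (upd x i t))) ->
  (forall x, continuous (fun t => F' (upd x i t))) ->
  (forall x, `|F x| <= c) -> (forall x, `|F' x| <= c) ->
  integ (fun x => x i * F x) /\ Ex (fun x => x i * F x) = s i ^+ 2 * Ex F'.
Proof.
move=> mF mF' dF cF' Fc F'c.
have iF' : integ F' by exact: integ_bounded F'c.
have iX : integ (fun x => `|x i|).
  have [//|/integrable_abse iXi _] := Ex_factor (phi := id) (G := fun=> 1) _ (integrable_gaussian_id i)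
    (coord_measurable_cst 1) (fun _ _ => erefl) (integ_cst 1).
  by apply: eq_integrable iXi => // w _ /=; rewrite mulr1.
have mxF : coord_measurable (fun x => x i * F x).
  by apply: coord_measurableM => //; exact: coord_measurable_coord.
have iF : integ (fun x => x i * F x).
  apply: (integ_le mxF (integZ c iX)) => x.
  by rewrite normrM mulrC; apply: ler_wpM2r.
split => //.
have c0 : 0 <= c by apply: le_trans (Fc (fun=> 0)).
have bnd (a t : R) : `|a| <= c -> `|a| <= c * (1 + `|t|).
  by move=> h; apply: le_trans h _; rewrite ler_peMr// lerDl.
rewrite -(ExZ _ iF'); apply: EFin_inj; rewrite -!ExE//; last exact: integZ.
rewrite (resample (F := fun x => x i * F x) i gX)// (resample (F := fun x => s i ^+ 2 * F' x) i gX)//; last 2 first.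
  by apply: coord_measurableM => //; exact: coord_measurable_cst.
  exact: integZ.
apply: eq_integral => w _.
pose y := X ^~ w.
have := stein_gaussian (s0 i) (dF y) (cF' y) (fun t => bnd _ t (Fc (upd y i t)))
  (fun t => bnd _ t (F'c (upd y i t))).
rewrite -integralZl//.
  by move=> <-; apply: eq_integral => t _; rewrite upd_same.
apply: (integrable_gaussian_poly (s0 i) (C := c)).
  by exact: continuous_measurable_fun.
move=> t; apply: le_trans (bnd _ t (F'c _)) _; rewrite ler_wpM2l//.
by rewrite expr2 ler_peMr// ?lerDl// addr_ge0.
Qed.

End coordinate_expectation.

(** * Real and imaginary parts and squared moduli *)

Section complex_facts.
Context {R : realType}.
Local Notation C := R[i].

Lemma cconjE (z : C) : cconj z = Num.conj z. Proof. by case: z. Qed.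

Lemma RC_inj : injective (@RC R). Proof. by move=> x y []. Qed.

Lemma RC_ge0 (x : R) : (0 <= RC x) = (0 <= x).
Proof. by rewrite /RC lecE/= eqxx. Qed.

Lemma RC_gt0 (x : R) : (0 < RC x) = (0 < x).
Proof. by rewrite /RC ltcE/= eqxx. Qed.

Lemma RC_le (x y : R) : (RC x <= RC y) = (x <= y).
Proof. by rewrite /RC lecE/= eqxx. Qed.

Lemma RCM (x y : R) : RC (x * y) = RC x * RC y.
Proof. exact: (rmorphM (real_complex R)). Qed.

Lemma RCD (x y : R) : RC (x + y) = RC x + RC y.
Proof. exact: (rmorphD (real_complex R)). Qed.

Lemma RCV (x : R) : RC x^-1 = (RC x)^-1.
Proof. exact: (fmorphV (real_complex R)). Qed.

Lemma RC_nat n : RC (n%:R : R) = n%:R.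
Proof. exact: (rmorph_nat (real_complex R)). Qed.

Lemma RC_sum (T : Type) (r : seq T) (F : T -> R) :
  RC (\sum_(j <- r) F j) = \sum_(j <- r) RC (F j).
Proof. exact: (rmorph_sum (real_complex R)). Qed.

Lemma normc_sqr (z : C) : `|z| ^+ 2 = RC (cabs2 z).
Proof.
rewrite normCK; case: z => a b; rewrite /cabs2/=; apply/eqP.
by rewrite eq_complex/=; apply/andP; split; apply/eqP; ring.
Qed.

Lemma cabs2_ge0 (z : C) : 0 <= cabs2 z.
Proof. by rewrite addr_ge0// sqr_ge0. Qed.

Lemma ReRC_ge0 (z : C) : 0 <= z -> z = RC (complex.Re z).
Proof. by case: z => a b; rewrite lecE/= => /andP[/eqP ->]. Qed.

Lemma le_Re (x y : C) : x <= y -> complex.Re x <= complex.Re y.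
Proof. by rewrite lecE => /andP[]. Qed.

Lemma Re_sum (T : Type) (r : seq T) (F : T -> C) :
  complex.Re (\sum_(j <- r) F j) = \sum_(j <- r) complex.Re (F j).
Proof. by elim: r => [|j r ih]; rewrite ?big_nil// !big_cons creD ih. Qed.

Lemma Im_sum (T : Type) (r : seq T) (F : T -> C) :
  complex.Im (\sum_(j <- r) F j) = \sum_(j <- r) complex.Im (F j).
Proof. by elim: r => [|j r ih]; rewrite ?big_nil// !big_cons cimD ih. Qed.

Lemma Re_le_cabs2 (z : C) : `|complex.Re z| <= 1 + cabs2 z.
Proof.
rewrite /cabs2 -(real_normK (num_real (complex.Re z))).
by have := sqr_ge0 (complex.Im z); have := sqr_ge0 (`|complex.Re z| - 1); nra.
Qed.

Lemma Im_le_cabs2 (z : C) : `|complex.Im z| <= 1 + cabs2 z.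
Proof.
rewrite /cabs2 -(real_normK (num_real (complex.Im z))).
by have := sqr_ge0 (complex.Re z); have := sqr_ge0 (`|complex.Im z| - 1); nra.
Qed.

Lemma ReM_le_cabs2 (x y : C) : `|complex.Re (x * y)| <= (cabs2 x + cabs2 y) / 2.
Proof.
rewrite creM /cabs2; case: x => a b; case: y => c d /=.
rewrite ler_norml; apply/andP; split.
  by have := sqr_ge0 (a + c); have := sqr_ge0 (b - d); lra.
by have := sqr_ge0 (a - c); have := sqr_ge0 (b + d); lra.
Qed.

Lemma Re_sqr_le (z : C) : complex.Re z ^+ 2 <= cabs2 z.
Proof. by rewrite lerDl sqr_ge0. Qed.

End complex_facts.

(** * Integration by parts for the regularized inverse of the Gram matrix *)

Section stein_gram.
Context {R : realType} {d : measure_display} {Omega : measurableType d}.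
Variables (P : probability Omega R) (M K : nat).
Local Notation C := R[i].
(* Coordinate (k, m, re, est): real (re) or imaginary part of the m-th entry of
   the k-th estimated channel (est) or of the k-th estimation error (~~ est). *)
Local Notation J := ('I_K * 'I_M * bool * bool)%type.
Implicit Types x : J -> R.

Definition est_mx x : 'M[C]_(M, K) :=
  \matrix_(m, k) Complex (x (k, m, true, true)) (x (k, m, false, true)).

Lemma cmeas_est_mx : cmeas_mx est_mx.
Proof.
move=> m k; split => d0 T Z mZ.
  by under eq_fun do rewrite mxE/=; exact: mZ.
by under eq_fun do rewrite mxE/=; exact: mZ.
Qed.

Lemma est_mx_upd_re x a m t : est_mx (upd x (a, m, true, true) t) =
  line (est_mx (upd x (a, m, true, true) 0)) (delta_mx m a) t.
Proof.
apply/matrixP => i j; rewrite !mxE /upd !xpair_eqE/= !andbT !andbF (eq_sym i) (eq_sym j).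
case: (eqVneq a j) => [<-|ja]; case: (eqVneq m i) => [<-|im]; rewrite ?eqxx ?(negbTE ja) ?(negbTE im) /=;
  by apply/eqP; rewrite eq_complex/= ?mul0r ?mulr0 ?mulr1 ?subr0 ?addr0 ?add0r !eqxx.
Qed.

Lemma est_mx_upd_im x a m t : est_mx (upd x (a, m, false, true) t) =
  line (est_mx (upd x (a, m, false, true) 0)) ('i%C *: delta_mx m a) t.
Proof.
apply/matrixP => i j; rewrite !mxE /upd !xpair_eqE/= !andbT !andbF (eq_sym i) (eq_sym j).
case: (eqVneq a j) => [<-|ja]; case: (eqVneq m i) => [<-|im]; rewrite ?eqxx ?(negbTE ja) ?(negbTE im) /=;
  by apply/eqP; rewrite eq_complex/=; apply/andP; split; apply/eqP; ring.
Qed.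

Variable eps : R.
Hypothesis eps0 : 0 < eps.
Local Notation e := (RC eps).
Local Notation B x := (reg_inv e (est_mx x)).
Local Notation V x := (reg_zf e (est_mx x)).
Local Notation Pi x := (reg_proj e (est_mx x)).

Let e0 : 0 < e. Proof. by rewrite RC_gt0. Qed.

Lemma cmeas_reg_inv : cmeas_mx (fun x => B x).
Proof.
apply: cmeas_invmx; apply: (class_addmx cmeas_add); last by move=> i j; exact: cmeas_cst.
by apply: cmeas_mulmx; [apply: cmeas_adjm|]; exact: cmeas_est_mx.
Qed.

Lemma cmeas_reg_zf : cmeas_mx (fun x => V x).
Proof. by apply: cmeas_mulmx; [exact: cmeas_est_mx|exact: cmeas_reg_inv]. Qed.

Lemma cmeas_reg_proj : cmeas_mx (fun x => Pi x).
Proof. by apply: cmeas_mulmx; [exact: cmeas_reg_zf|apply: cmeas_adjm; exact: cmeas_est_mx]. Qed.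

Definition gdiag x a : R := complex.Re (B x a a).

Lemma gdiagE x a : B x a a = RC (gdiag x a).
Proof. by apply: ReRC_ge0; exact: reg_inv_diag_ge0. Qed.

Lemma gdiag_ge0 x a : 0 <= gdiag x a.
Proof. by rewrite -RC_ge0 -gdiagE; exact: reg_inv_diag_ge0. Qed.

Lemma gdiag_le x a : gdiag x a <= eps^-1.
Proof. by rewrite -RC_le -gdiagE RCV; exact: reg_inv_diag_le. Qed.

Lemma reg_zf_cabs2_le x m a : cabs2 (V x m a) <= gdiag x a.
Proof. by rewrite -RC_le -gdiagE -normc_sqr; exact: reg_zf_entry_le. Qed.

Lemma reg_inv_Re_le x a b : `|complex.Re (B x a b)| <= (gdiag x a + gdiag x b) / 2.
Proof.
rewrite ler_pdivlMr// -RC_le RCD -!gdiagE.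
apply: le_trans (reg_inv_offdiag_le _ e0 a b); rewrite RCM RC_nat mulr_natr.
rewrite ler_wMn2r//.
have := normc_sqr (B x a b); have n0 := normr_ge0 (B x a b).
rewrite (ReRC_ge0 n0) RC_le -[X in RC _ ^+ 2 = RC X]/(_ + _) expr2 -RCM => /RC_inj h.
have r0 : 0 <= complex.Re `|B x a b| by rewrite -RC_ge0 -ReRC_ge0.
rewrite -ler_sqr ?nnegrE// real_normK ?num_real// [leRHS]expr2 h.
by rewrite lerDl sqr_ge0.
Qed.

Lemma reg_inv_Re_le_inv x a b : `|complex.Re (B x a b)| <= eps^-1.
Proof.
apply: le_trans (reg_inv_Re_le x a b) _; rewrite ler_pdivrMr// mulr_natr mulr2n.
by apply: lerD; exact: gdiag_le.
Qed.

Lemma reg_proj_Re x m : Pi x m m = RC (complex.Re (Pi x m m)) /\ 0 <= complex.Re (Pi x m m) <= 1.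
Proof.
have /andP[p0 p1] := reg_proj_diag_01 (est_mx x) e0 m.
have pE := ReRC_ge0 p0; split => //; rewrite -RC_ge0 -pE p0 /=.
by have := le_Re p1.
Qed.

(** Contribution of (1 - Pi) E B to the derivative of V_mb in the direction of the matrix unit E at
    (m, a); [stein_cross] is the contribution of V E^H V. The diagonal of Pi is real, so taking real
    parts factor by factor is exact. *)
Definition stein_main x a b m : R :=
  complex.Re (B x a b) * (1 - complex.Re (Pi x m m)).

Lemma stein_main_le x a b m : `|stein_main x a b m| <= eps^-1.
Proof.
have [_ /andP[p0 p1]] := reg_proj_Re x m.
rewrite /stein_main normrM -[leRHS]mulr1; apply: ler_pM => //.
  exact: reg_inv_Re_le_inv.
by rewrite ger0_norm ?subr_ge0// gerBl.
Qed.

Definition stein_cross x a b m : R := complex.Re (V x m a * V x m b).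

Lemma stein_cross_le x a b m : `|stein_cross x a b m| <= eps^-1.
Proof.
apply: le_trans (ReM_le_cabs2 _ _) _; rewrite ler_pdivrMr// mulr_natr mulr2n.
by apply: lerD; apply: le_trans (reg_zf_cabs2_le _ _ _) (gdiag_le _ _).
Qed.

Lemma coord_measurable_stein_main a b m : coord_measurable (fun x => stein_main x a b m).
Proof.
apply: coord_measurableM; first exact: (cmeas_reg_inv a b).1.
move=> d0 T Z mZ; apply: measurable_funB => //; exact: ((cmeas_reg_proj m m).1 _ _ _ mZ).
Qed.

Lemma coord_measurable_stein_cross a b m : coord_measurable (fun x => stein_cross x a b m).
Proof. exact: (cmeas_mul (cmeas_reg_zf m a) (cmeas_reg_zf m b)).1. Qed.

Lemma mul_delta_mxE (A : 'M[C]_M) (D : 'M[C]_K) m a i b :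
  (A *m delta_mx m a *m D) i b = A i m * D a b.
Proof.
by rewrite -(mul_delta_mx (0 : 'I_1) m a) mulmxA -colE -mulmxA -rowE mxE big_ord1 !mxE.
Qed.

Lemma mul_delta_mxE' (A : 'M[C]_(M, K)) m a i b :
  (A *m (delta_mx m a)^T *m A) i b = A i a * A m b.
Proof.
by rewrite trmx_delta -(mul_delta_mx (0 : 'I_1) a m) mulmxA -colE -mulmxA -rowE mxE big_ord1 !mxE.
Qed.

Lemma adjm_delta (c : C) m a : adjm (c *: delta_mx m a : 'M[C]_(M, K)) = Num.conj c *: (delta_mx m a)^T.
Proof.
apply/matrixP => i j; rewrite !mxE rmorphM; congr (_ * _).
by case: (_ && _); rewrite ?rmorph1 ?rmorph0.
Qed.

Lemma reg_zf_derivative_entry (c : C) m a b (H : 'M[C]_(M, K)) :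
  (c *: delta_mx m a *m reg_inv e H - reg_proj e H *m (c *: delta_mx m a) *m reg_inv e H
    - reg_zf e H *m adjm (c *: delta_mx m a) *m reg_zf e H) m b =
  c * (reg_inv e H a b * (1 - reg_proj e H m m)) - Num.conj c * (reg_zf e H m a * reg_zf e H m b).
Proof.
rewrite adjm_delta -scalemxAl -!scalemxAr -!scalemxAl.
have E1 : (delta_mx m a *m reg_inv e H) m b = reg_inv e H a b.
  by rewrite -[delta_mx m a]mul1mx mul_delta_mxE mxE eqxx mul1r.
have E2 := mul_delta_mxE (reg_proj e H) (reg_inv e H) m a m b.
have E3 := mul_delta_mxE' (reg_zf e H) m a m b.
rewrite !mxE in E1 E2 E3 *.
rewrite E1 E2 E3; ring.
Qed.

Variables (X : J -> Omega -> R) (s : J -> R) (g : 'I_K -> R).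
Hypotheses (gX : gaussian_family P X s) (s0 : forall i, 0 < s i).
Hypothesis sE : forall k m re, s (k, m, re, true) ^+ 2 = g k / 2.
Local Notation Ex := (Ex P X).
Local Notation integ := (integ P X).

Let c0 : R := eps^-1 + eps^-1 + 1.

Let ie0 : 0 <= eps^-1. Proof. by rewrite invr_ge0 ltW. Qed.

Let continuous_stein (H0 E : 'M[C]_(M, K)) a b m :
  continuous (fun t => complex.Re (reg_inv e (line H0 E t) a b) *
                       (1 - complex.Re (reg_proj e (line H0 E t) m m))) /\
  continuous (fun t => complex.Re (reg_zf e (line H0 E t) m a * reg_zf e (line H0 E t) m b)).
Proof.
have dB := cderivable_reg_inv H0 E e0; have dV := cderivable_reg_zf H0 E e0.
have dP : class_mx cderivable (fun t => reg_proj e (line H0 E t)).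
  apply: (class_mulmx (@cderivable_cst R) (@cderivable_add R) (@cderivable_mul R)) => //.
  move=> i j; rewrite (_ : (fun t => _) = fun t => Num.conj (line H0 E t j i)).
    by apply: cderivable_conj => t; exists (E j i); exact: is_mxderive_line.
  by apply/funext => t; rewrite !mxE.
split; last exact: (cderivable_continuous (cderivable_mul (dV m a) (dV m b))).1.
move=> t; apply: cvgM; first exact: ((cderivable_continuous (dB a b)).1 t).
apply: cvgB; first exact: cvg_cst.
exact: ((cderivable_continuous (dP m m)).1 t).
Qed.

Lemma stein_re a b m :
  integ (fun x => x (a, m, true, true) * complex.Re (V x m b)) /\
  Ex (fun x => x (a, m, true, true) * complex.Re (V x m b)) =
  g a / 2 * Ex (fun x => stein_main x a b m - stein_cross x a b m).
Proof.
rewrite -(sE a m true).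
apply: (stein_coord gX s0 (c := c0)).
- exact: (cmeas_reg_zf m b).1.
- move=> d0 T Z mZ.
  have m1 := coord_measurable_stein_main a b m mZ.
  have m2 := coord_measurable_stein_cross a b m mZ.
  by apply: measurable_funB.
- move=> x t.
  have [h1 h2] := is_mxderive_reg_zf (est_mx (upd x (a, m, true, true) 0)) (1 *: delta_mx m a) e0 t m b.
  move: (h1); rewrite reg_zf_derivative_entry scale1r -est_mx_upd_re.
  move=> h; under eq_fun do rewrite est_mx_upd_re.
  apply: (is_derive_eq h).
  rewrite /stein_main /stein_cross (reg_proj_Re _ m).1.
  by case: (B _ a b) => p q; case: (V _ m a * _) => p' q' /=; ring.
- move=> x.
  have [k1 k2] := continuous_stein (est_mx (upd x (a, m, true, true) 0)) (delta_mx m a) a b m.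
  rewrite (funext (g := fun t => complex.Re (reg_inv e (line _ _ t) a b) *
     (1 - complex.Re (reg_proj e (line _ _ t) m m)) -
     complex.Re (reg_zf e (line _ _ t) m a * reg_zf e (line _ _ t) m b))
     (fun t => congr1 (fun H => complex.Re (reg_inv e H a b) *
        (1 - complex.Re (reg_proj e H m m)) - complex.Re (reg_zf e H m a * reg_zf e H m b))
        (est_mx_upd_re x a m t))).
  by move=> t; exact: (cvgB (k1 t) (k2 t)).
- move=> x; apply: le_trans (Re_le_cabs2 _) _; rewrite /c0 addrC lerD2r.
  apply: le_trans (reg_zf_cabs2_le _ _ _) _; apply: le_trans (gdiag_le _ _) _.
  by rewrite lerDl.
- move=> x; apply: le_trans (ler_normB _ _) _; rewrite /c0.
  apply: le_trans (lerD (stein_main_le _ _ _ _) (stein_cross_le _ _ _ _)) _.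
  by rewrite lerDl.
Qed.

(** In the imaginary direction E carries the factor i and E^H the factor -i, so the cross part
    enters with the opposite sign to that in [stein_re]. *)
Lemma stein_im a b m :
  integ (fun x => x (a, m, false, true) * complex.Im (V x m b)) /\
  Ex (fun x => x (a, m, false, true) * complex.Im (V x m b)) =
  g a / 2 * Ex (fun x => stein_main x a b m + stein_cross x a b m).
Proof.
rewrite -(sE a m false).
apply: (stein_coord gX s0 (c := c0)).
- exact: (cmeas_reg_zf m b).2.
- move=> d0 T Z mZ.
  have m1 := coord_measurable_stein_main a b m mZ.
  have m2 := coord_measurable_stein_cross a b m mZ.
  by apply: measurable_funD.
- move=> x t.
  have [h1 h2] := is_mxderive_reg_zf (est_mx (upd x (a, m, false, true) 0)) ('i%C *: delta_mx m a) e0 t m b.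
  move: (h2); rewrite reg_zf_derivative_entry -est_mx_upd_im.
  move=> h; under eq_fun do rewrite est_mx_upd_im.
  apply: (is_derive_eq h).
  rewrite /stein_main /stein_cross (reg_proj_Re _ m).1.
  by case: (B _ a b) => p q; case: (V _ m a * _) => p' q' /=; ring.
- move=> x.
  have [k1 k2] := continuous_stein (est_mx (upd x (a, m, false, true) 0)) ('i%C *: delta_mx m a) a b m.
  rewrite (funext (g := fun t => complex.Re (reg_inv e (line _ _ t) a b) *
     (1 - complex.Re (reg_proj e (line _ _ t) m m)) +
     complex.Re (reg_zf e (line _ _ t) m a * reg_zf e (line _ _ t) m b))
     (fun t => congr1 (fun H => complex.Re (reg_inv e H a b) *
        (1 - complex.Re (reg_proj e H m m)) + complex.Re (reg_zf e H m a * reg_zf e H m b))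
        (est_mx_upd_im x a m t))).
  by move=> t; exact: (cvgD (k1 t) (k2 t)).
- move=> x; apply: le_trans (Im_le_cabs2 _) _; rewrite /c0 addrC lerD2r.
  apply: le_trans (reg_zf_cabs2_le _ _ _) _; apply: le_trans (gdiag_le _ _) _.
  by rewrite lerDl.
- move=> x; apply: le_trans (ler_normD _ _) _; rewrite /c0.
  apply: le_trans (lerD (stein_main_le _ _ _ _) (stein_cross_le _ _ _ _)) _.
  by rewrite lerDl.
Qed.

(* Integration by parts in each entry of H, applied to the entries of
   [adjm H *m reg_zf e H = 1 - e B]. *)
Lemma stein_gram a b :
  (a == b)%:R - eps * Ex (fun x => complex.Re (B x a b)) =
  g a * Ex (fun x => complex.Re (B x a b) *
    (M%:R - K%:R + eps * \sum_j gdiag x j)).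
Proof.
have iB : integ (fun x => complex.Re (B x a b)).
  exact: (integ_bounded gX (cmeas_reg_inv a b).1 (fun x => reg_inv_Re_le_inv x a b)).
have im m : integ (fun x => stein_main x a b m).
  exact: (integ_bounded gX (coord_measurable_stein_main a b m) (fun x => stein_main_le x a b m)).
have ic m : integ (fun x => stein_cross x a b m).
  exact: (integ_bounded gX (coord_measurable_stein_cross a b m) (fun x => stein_cross_le x a b m)).
have inc m : integ (fun x => -1 * stein_cross x a b m) by exact: integZ.
transitivity (\sum_m (Ex (fun x => x (a, m, true, true) * complex.Re (V x m b)) +
   Ex (fun x => x (a, m, false, true) * complex.Im (V x m b)))).
  transitivity (Ex (fun x => \sum_m (x (a, m, true, true) * complex.Re (V x m b) +
      x (a, m, false, true) * complex.Im (V x m b)))); last first.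
    rewrite Ex_sum; last by move=> m; apply: integD; [exact: (stein_re a b m).1|exact: (stein_im a b m).1].
    by apply: eq_bigr => m _; rewrite ExD//; [exact: (stein_re a b m).1|exact: (stein_im a b m).1].
  rewrite -(ExZ _ iB) -mulN1r -(Ex_cst P X (a == b)%:R) -ExZ ?integZ// -ExD ?integ_cst ?integZ//.
  congr (Ex _); apply/funext => x.
  have := congr1 (fun Q : 'M[C]_K => complex.Re (Q a b)) (adjm_reg_zf (est_mx x) e0).
  rewrite !mxE Re_sum => h; rewrite (_ : _ + _ = complex.Re ((a == b)%:R - e * B x a b)).
    rewrite -h; apply: eq_bigr => m _.
    have -> : adjm (est_mx x) a m = Complex (x (a, m, true, true)) (- x (a, m, false, true)).
      by rewrite !mxE.
    by case: (V x m b) => p q /=; ring.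
  by rewrite creD; case: (B x a b) => p q; case: (a == b) => /=; ring.
(* The cross parts cancel between the two directions and the main part doubles, which turns the
   variance g_a / 2 into g_a. *)
transitivity (\sum_m g a * Ex (fun x => stein_main x a b m)).
  apply: eq_bigr => m _; rewrite (stein_re a b m).2 (stein_im a b m).2.
  have e1 : Ex (fun x => stein_main x a b m - stein_cross x a b m) =
      Ex (fun x => stein_main x a b m) - Ex (fun x => stein_cross x a b m).
    by rewrite -[X in _ - X]mul1r -mulNr -ExZ// -ExD//; congr (Ex _); apply/funext => x; rewrite mulN1r.
  by rewrite e1 ExD//; field.
rewrite -mulr_sumr -Ex_sum//; congr (_ * Ex _); apply/funext => x.
rewrite -mulr_sumr; congr (_ * _).
(* The sum of 1 - Pi_mm over m is M - tr Pi = M - K + eps tr B. *)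
have := congr1 (@complex.Re R) (reg_proj_trace (est_mx x) e0).
rewrite /mxtrace Re_sum sumrB sumr_const card_ord => ->.
have -> : \sum_j B x j j = RC (\sum_j gdiag x j).
  by rewrite RC_sum; apply: eq_bigr => j _; exact: gdiagE.
rewrite -RC_nat -RCM /=; ring.
Qed.

End stein_gram.

(** * Moments of the inverse Gram matrix *)

Section gram_inverse.
Context {C : numClosedFieldType}.
Variables (M K : nat).
Implicit Type H : 'M[C]_(M, K).

Lemma gram_diag_ge0 H a : 0 <= gram H a a.
Proof. by rewrite /gram adjm_mul_diag; apply: sumr_ge0 => i _; rewrite exprn_ge0. Qed.

Lemma gram_offdiag_le H a b : `|gram H a b| *+ 2 <= gram H a a + gram H b b.
Proof.
rewrite /gram !adjm_mul_diag -big_split/= mxE.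
apply: (@le_trans _ _ ((\sum_m `|(H m a)^* * H m b|) *+ 2)).
  rewrite ler_wMn2r//; apply: le_trans (ler_norm_sum _ _ _) _.
  by apply: ler_sum => i _; rewrite !mxE.
rewrite -sumrMnl; apply: ler_sum => i _.
by rewrite -[`|H i a|]norm_conjC normM_le_sqr.
Qed.

(* With Rocq's junk value [invmx A = A] on singular matrices the inverse is a Gram matrix in all cases. *)
Lemma inv_gram_is_gram H : exists Y : 'M[C]_(M, K), invmx (gram H) = gram Y.
Proof.
have [u|u] := boolP (gram H \in unitmx).
  by exists (H *m invmx (gram H)); rewrite /gram -inv_gram_sum.
by exists H; rewrite /invmx (negbTE u).
Qed.

(** The resolvent identity used twice gives N - B = e (N N - e B N N), and the entries of e B have
    modulus at most 1; hence a constant that does not depend on e. *)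
Lemma reg_inv_cvg_bound H a b : gram H \in unitmx ->
  exists2 c : C, 0 <= c & forall e : C, 0 < e ->
    `|(invmx (gram H) - reg_inv e H) a b| <= e * c.
Proof.
move=> u; set N := invmx (gram H).
exists (`|(N *m N) a b| + \sum_j `|(N *m N) j b|).
  by rewrite addr_ge0// sumr_ge0.
move=> e e0; set B := reg_inv e H.
have E : N - B = e *: (N *m N - e *: B *m (N *m N)).
  have h := inv_gram_subE e0 u; rewrite -/N -/B in h.
  rewrite {1}h; congr (_ *: _).
  have -> : B = N - e *: (B *m N) by rewrite -h opprB addrC subrK.
  rewrite {1}mulmxBl; congr (_ - _).
  by rewrite -[in RHS]h opprB addrC subrK -!scalemxAl mulmxA.
rewrite E mxE normrM gtr0_norm// ler_pM2l// mxE.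
apply: le_trans (ler_normD _ _) _; rewrite lerD2l mxE normrN mxE.
apply: le_trans (ler_norm_sum _ _ _) _; apply: ler_sum => j _.
rewrite normrM -[leRHS]mul1r; apply: ler_wpM2r => //.
have := reg_inv_entry_le H e0 a j; rewrite -/B => h1.
have h2 := le_trans h1 (reg_inv_diag_le H e0 j).
rewrite mxE normrM gtr0_norm// -(@ler_pXn2r _ 2)// ?nnegrE ?mulr_ge0 ?(ltW e0)//.
by rewrite expr1n exprMn expr2 -mulrA -ler_pdivlMl// mulr1.
Qed.

End gram_inverse.

Section zf_limits.
Context {R : realType} {d : measure_display} {Omega : measurableType d}.
Variables (P : probability Omega R) (M K : nat).
Local Notation C := R[i].
Local Notation J := ('I_K * 'I_M * bool * bool)%type.
Variables (X : J -> Omega -> R) (s : J -> R) (g : 'I_K -> R).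
Hypotheses (gX : gaussian_family P X s) (s0 : forall i, 0 < s i).
Hypothesis sE : forall k m re, s (k, m, re, true) ^+ 2 = g k / 2.
Hypotheses (g0 : forall k, 0 < g k) (hMK : (K < M)%N).
Local Notation Ex := (Ex P X).
Local Notation integ := (integ P X).
Local Notation H := (@est_mx R M K).

Definition inv_gram (x : J -> R) : 'M[C]_K := invmx (gram (H x)).
Definition ndiag (x : J -> R) a : R := complex.Re (inv_gram x a a).
Definition unit_ind (x : J -> R) : R := (gram (H x) \in unitmx)%:R.

Lemma cmeas_gram : cmeas_mx (fun x => gram (H x)).
Proof. by apply: cmeas_mulmx; [apply: cmeas_adjm|]; exact: cmeas_est_mx. Qed.

Lemma cmeas_inv_gram : cmeas_mx inv_gram.
Proof. by apply: cmeas_invmx; exact: cmeas_gram. Qed.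

Lemma coord_measurable_unit_ind : coord_measurable unit_ind.
Proof.
have md := class_det (@cmeas_cst _ _) (@cmeas_add _ _) (@cmeas_mul _ _) cmeas_gram.
have := (cmeas_if0 md (cmeas_cst 0) (cmeas_cst 1)).1.
rewrite (_ : (fun x => complex.Re _) = unit_ind)//.
by apply/funext => x; rewrite /unit_ind unitmxE unitfE; case: eqVneq.
Qed.

Lemma ndiagE x a : inv_gram x a a = RC (ndiag x a).
Proof.
by apply: ReRC_ge0; rewrite /inv_gram; have [Y ->] := inv_gram_is_gram (H x); exact: gram_diag_ge0.
Qed.

Lemma ndiag_ge0 x a : 0 <= ndiag x a.
Proof.
by rewrite -RC_ge0 -ndiagE /inv_gram; have [Y ->] := inv_gram_is_gram (H x); exact: gram_diag_ge0.
Qed.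

Lemma norm_Re_le (z : C) (r : R) : `|z| <= RC r -> `|complex.Re z| <= r.
Proof.
move=> zr; have r0 : 0 <= r by rewrite -RC_ge0 (le_trans _ zr).
rewrite -ler_sqr ?nnegrE// real_normK ?num_real//; apply: le_trans (Re_sqr_le z) _.
by rewrite -RC_le -normc_sqr [in leRHS]expr2 RCM expr2; apply: ler_pM.
Qed.

Lemma inv_gram_Re_le x a b : `|complex.Re (inv_gram x a b)| <= (ndiag x a + ndiag x b) / 2.
Proof.
apply: norm_Re_le; have := ndiagE x a; have := ndiagE x b.
rewrite /inv_gram; have [Y ->] := inv_gram_is_gram (H x) => nb na.
have := gram_offdiag_le Y a b; rewrite na nb -RCD.
rewrite -[`|gram Y a b| *+ 2]mulr_natr -ler_pdivlMr ?ltr0n//.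
by rewrite RCM RCV RC_nat.
Qed.

Lemma gdiag_le_ndiag (eps : R) x a : 0 < eps -> gram (H x) \in unitmx ->
  gdiag eps x a <= ndiag x a.
Proof.
move=> eps0 u; rewrite -RC_le -ndiagE -(gdiagE eps0).
by apply: reg_inv_diag_le_inv_gram => //; rewrite RC_gt0.
Qed.

Lemma coord_measurable_gdiag (eps : R) (a : 'I_K) :
  coord_measurable (fun x : J -> R => gdiag eps x a).
Proof. exact: (@cmeas_reg_inv R M K eps a a).1. Qed.

Lemma integ_gdiag (eps : R) a : 0 < eps -> integ (fun x => gdiag eps x a).
Proof.
move=> eps0; apply: (integ_bounded gX (c := eps^-1)); first exact: coord_measurable_gdiag.
by move=> x; rewrite ger0_norm ?gdiag_ge0// gdiag_le.
Qed.

Let mdim : R := M%:R - K%:R.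
Let mdim0 : 0 < mdim. Proof. by rewrite subr_gt0 ltr_nat. Qed.

Definition trace_term (eps : R) x a b : R :=
  complex.Re (reg_inv (RC eps) (H x) a b) * (M%:R - K%:R + eps * \sum_j gdiag eps x j).

Lemma trace_bound (eps : R) (x : J -> R) : 0 < eps -> 0 <= eps * \sum_j gdiag eps x j <= K%:R.
Proof.
move=> eps0; apply/andP; split.
  by apply: mulr_ge0; [exact: ltW|apply: sumr_ge0 => j _; exact: gdiag_ge0].
rewrite mulrC -ler_pdivlMr//.
apply: le_trans (_ : \sum_(j < K) eps^-1 <= _).
  by apply: ler_sum => j _; exact: gdiag_le.
by rewrite sumr_const card_ord mulr_natl.
Qed.

Lemma coord_measurable_trace_term (eps : R) a b :
  coord_measurable (fun x => trace_term eps x a b).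
Proof.
apply: coord_measurableM; first exact: (@cmeas_reg_inv R M K eps a b).1.
apply: coord_measurableD; first exact: coord_measurable_cst.
apply: coord_measurableM; first exact: coord_measurable_cst.
by move=> d0 T Z mZ; apply: measurable_sum => j; exact: coord_measurable_gdiag.
Qed.

Lemma integ_trace_term (eps : R) a b : 0 < eps -> integ (fun x => trace_term eps x a b).
Proof.
move=> eps0; apply: (integ_bounded gX (c := eps^-1 * M%:R)); first exact: coord_measurable_trace_term.
move=> x; have /andP[t0 t1] := trace_bound x eps0.
rewrite normrM; apply: ler_pM => //; first exact: reg_inv_Re_le_inv.
rewrite ger0_norm; last by rewrite addr_ge0// ltW.
by rewrite -lerBrDl opprB addrC subrK.
Qed.

(** For a = b both eps terms of [stein_gram] have a favourable sign; dropping them leaves (M - K)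
    g_a E B_aa <= 1, uniformly in eps. *)
Lemma Ex_gdiag_le (eps : R) a : 0 < eps -> Ex (fun x => gdiag eps x a) <= (mdim * g a)^-1.
Proof.
move=> eps0; have := stein_gram eps0 gX s0 sE a a; rewrite eqxx /= => h.
have i1 := integ_gdiag a eps0; have i2 := integ_trace_term a a eps0.
have E0 : 0 <= Ex (fun x => gdiag eps x a).
  by rewrite -(Ex_cst P X 0); apply: Ex_le => //; [exact: integ_cst|move=> x; exact: gdiag_ge0].
have h1 : mdim * Ex (fun x => gdiag eps x a) <= Ex (fun x => trace_term eps x a a).
  rewrite -ExZ//; apply: Ex_le => //; first exact: integZ.
  move=> x; rewrite mulrC; apply: ler_wpM2l; first exact: gdiag_ge0.
  by rewrite lerDl; case/andP: (trace_bound x eps0).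
rewrite -[leRHS]mul1r ler_pdivlMr ?mulr_gt0//.
set E := Ex _ in h1 E0 h *; rewrite (_ : E * _ = g a * (mdim * E)); last by ring.
apply: (@le_trans _ _ (g a * Ex (fun x => trace_term eps x a a))).
  by rewrite ler_pM2l.
by rewrite -h gerBl mulr_ge0// ltW.
Qed.

(** The other half of [trace_bound]: at eps = 1 the identity becomes 1 <= (1 + g_a M) E B_aa.
    Through [Ex_ndiag_gt0] this keeps the precoder normalization from dividing by 0. *)
Lemma Ex_gdiag_gt0 a : 0 < Ex (fun x => gdiag 1 x a).
Proof.
have := stein_gram (@ltr01 R) gX s0 sE a a; rewrite eqxx /= => h.
have i1 := integ_gdiag a (@ltr01 R); have i2 := integ_trace_term a a (@ltr01 R).
have h1 : Ex (fun x => trace_term 1 x a a) <= M%:R * Ex (fun x => gdiag 1 x a).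
  rewrite -ExZ//; apply: Ex_le => //; first exact: integZ.
  move=> x; rewrite [leRHS]mulrC; apply: ler_wpM2l; first exact: gdiag_ge0.
  by have /andP[_ t1] := trace_bound x (@ltr01 R); lra.
have h2 : 1 <= (1 + g a * M%:R) * Ex (fun x => gdiag 1 x a).
  rewrite mulrDl -lerBlDl h -mulrA; exact: (ler_wpM2l (ltW (g0 a)) h1).
rewrite -(pmulr_rgt0 _ (x := 1 + g a * M%:R)); first exact: lt_le_trans h2.
by rewrite addr_gt0// mulr_gt0// ltr0n (leq_ltn_trans _ hMK).
Qed.

(* On the singular event the trace of the regularized inverse is at least 1 / (eps K),
   whereas its expectation is bounded uniformly in eps. *)
Lemma Ex_singular : Ex (fun x => 1 - unit_ind x) = 0.
Proof.
have mU := coord_measurable_unit_ind.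
have mF : coord_measurable (fun x => 1 - unit_ind x).
  by move=> d0 T Z mZ; apply: measurable_funB => //; exact: mU.
have F01 x : 0 <= 1 - unit_ind x <= 1.
  by rewrite /unit_ind; case: (_ \in _); rewrite ?subrr ?subr0 ?lexx ler01.
have iF : integ (fun x => 1 - unit_ind x).
  apply: (integ_bounded gX mF (c := 1)) => x; case/andP: (F01 x) => h1 h2.
  by rewrite ger0_norm.
pose c : R := K%:R * \sum_a (mdim * g a)^-1.
have key (eps : R) : 0 < eps -> Ex (fun x => 1 - unit_ind x) <= eps * c.
  move=> eps0.
  have is_ : integ (fun x => \sum_a gdiag eps x a) by apply: integ_sum => a; exact: integ_gdiag.
  apply: (@le_trans _ _ (Ex (fun x => eps * K%:R * \sum_a gdiag eps x a))).
    apply: Ex_le => //; first exact: integZ.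
    move=> x; rewrite /unit_ind; have [u|u] := boolP (_ \in _).
      rewrite subrr; apply: mulr_ge0; first by rewrite mulr_ge0 ?(ltW eps0).
      by apply: sumr_ge0 => a _; exact: gdiag_ge0.
    have e0 : 0 < RC eps by rewrite RC_gt0.
    have := reg_inv_singular e0 u.
    rewrite (eq_bigr (fun a => RC (gdiag eps x a))); last by move=> a _; exact: gdiagE.
    rewrite -RC_sum -RC_nat -RCM -RCV RC_le subr0 => h.
    (* An empty determinant is 1, so there is no singular case when K = 0. *)
    have [K0|K0] := posnP K.
      exfalso; move: u; rewrite unitmxE unitfE; rewrite /gram => /negP; apply.
      by move: (H x); rewrite K0 => Hx; rewrite det_mx00 oner_eq0.
    by rewrite mulrC -ler_pdivrMr ?mul1r// mulr_gt0// ltr0n.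
  rewrite ExZ// Ex_sum; last by move=> a; exact: integ_gdiag.
  rewrite /c mulrA; apply: ler_wpM2l; first by rewrite mulr_ge0 ?(ltW eps0).
  by apply: ler_sum => a _; exact: Ex_gdiag_le.
have c0 : 0 <= c.
  by apply: mulr_ge0 => //; apply: sumr_ge0 => a _; rewrite invr_ge0 mulr_ge0 ?(ltW mdim0) ?(ltW (g0 a)).
apply/eqP; rewrite eq_le; apply/andP; split; last first.
  rewrite -(Ex_cst P X 0); apply: Ex_le => //; first exact: integ_cst.
  by move=> x; case/andP: (F01 x).
apply/ler_addgt0Pl => eps eps0; rewrite addr0.
have h : 0 < eps / (c + 1) by rewrite divr_gt0// ltr_wpDl.
apply: le_trans (key _ h) _; rewrite mulrAC ler_pdivrMr ?ltr_wpDl//.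
by rewrite ler_pM2l// lerDl.
Qed.

Lemma ae_unit : {ae P, forall w, gram (H (X ^~ w)) \in unitmx}.
Proof.
have mU := coord_meas_X gX coord_measurable_unit_ind.
pose S := [set w | unit_ind (X ^~ w) = 0].
have mS : measurable S.
  by have := mU measurableT [set 0] (measurable_set1 _); rewrite setTI.
exists S; split => //; last first.
  by move=> w /= h; rewrite /S/= /unit_ind; case: (_ \in _) h.
have iF : integ (fun x => 1 - unit_ind x).
  apply: (integ_bounded gX (c := 1)).
    by move=> d0 T Z mZ; apply: measurable_funB => //; exact: coord_measurable_unit_ind.
  by move=> x; rewrite /unit_ind; case: (_ \in _); rewrite ?subrr ?subr0 ?normr0 ?normr1.
have := ExE iF; rewrite Ex_singular => h0; apply: etrans h0.
have := integral_indic P measurableT mS; rewrite setIT => <-.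
apply: eq_integral => w _; rewrite indicE /unit_ind.
have -> : (w \in S) = ~~ (gram (H (X ^~ w)) \in unitmx).
  apply/idP/idP; rewrite inE /S/= /unit_ind; first by case: (_ \in _) => // /eqP; rewrite oner_eq0.
  by move=> /negbTE ->.
by case: (_ \in _) => /=; rewrite ?subrr ?subr0.
Qed.

Lemma integ_ae (F G : (J -> R) -> R) : coord_measurable F -> integ G ->
  (forall x, gram (H x) \in unitmx -> `|F x| <= G x) -> integ F.
Proof.
move=> mF iG FG; apply/integrableP; split.
  by apply/measurable_EFinP; exact: (coord_meas_X gX mF).
have [mG fG] := integrableP _ _ _ iG; apply: le_lt_trans fG.
apply: ae_ge0_le_integral => //.
- by apply: measurableT_comp => //; apply/measurable_EFinP; exact: (coord_meas_X gX mF).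
- exact: measurableT_comp.
- apply: filterS ae_unit => w u _ /=; rewrite lee_fin.
  by apply: le_trans (FG _ u) _; exact: ler_norm.
Qed.

Lemma Ex_ae (F G : (J -> R) -> R) : coord_measurable F -> coord_measurable G ->
  (forall x, gram (H x) \in unitmx -> F x = G x) -> Ex F = Ex G.
Proof.
move=> mF mG FG; rewrite /Ex /Rintegral; congr fine.
apply: ae_eq_integral => //.
- by apply/measurable_EFinP; exact: (coord_meas_X gX mF).
- by apply/measurable_EFinP; exact: (coord_meas_X gX mG).
- by apply: filterS ae_unit => w u _; rewrite FG.
Qed.

Let epsn (n : nat) : R := n.+1%:R^-1.
Let epsn0 n : 0 < epsn n. Proof. by rewrite invr_gt0 ltr0n. Qed.

Let reg_inv_cvg x a b : gram (H x) \in unitmx ->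
  complex.Re (reg_inv (RC (epsn n)) (H x) a b) @[n --> \oo] --> complex.Re (inv_gram x a b).
Proof.
move=> u; have [c c0 hc] := reg_inv_cvg_bound a b u.
have cE := ReRC_ge0 c0; set r := complex.Re c in cE.
have h n : `|complex.Re (inv_gram x a b) - complex.Re (reg_inv (RC (epsn n)) (H x) a b)| <= epsn n * r.
  have e0 : 0 < RC (epsn n) by rewrite RC_gt0.
  have := hc _ e0; rewrite cE -RCM => /norm_Re_le.
  have -> : (invmx (gram (H x)) - reg_inv (RC (epsn n)) (H x)) a b =
      inv_gram x a b - reg_inv (RC (epsn n)) (H x) a b by rewrite mxE [X in _ + X]mxE.
  by rewrite creD; case: (reg_inv _ _ a b).
apply/cvgrPdist_le => /= eps eps0.
have : (epsn n * r) @[n --> \oo] --> (0 : R).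
  by rewrite -(mul0r r); apply: cvgM; [exact: cvg_harmonic|exact: cvg_cst].
move=> /cvgrPdist_le /(_ _ eps0); apply: filterS => n; rewrite sub0r normrN.
by move=> h2; apply: le_trans (h n) _; apply: le_trans h2; exact: ler_norm.
Qed.

Lemma coord_measurable_ndiag a : coord_measurable (fun x => ndiag x a).
Proof. exact: (cmeas_inv_gram a a).1. Qed.

(** Fatou's lemma along eps = 1 / (n + 1), with the uniform bound of [Ex_gdiag_le], yields
    integrability and the bound at once. *)
Lemma integ_Ex_ndiag a : integ (fun x => ndiag x a) /\ Ex (fun x => ndiag x a) <= (mdim * g a)^-1.
Proof.
have mN := coord_measurable_ndiag a.
pose U := [set w | gram (H (X ^~ w)) \in unitmx].
have mU : measurable U.
  have mu := coord_meas_X gX coord_measurable_unit_ind.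
  rewrite (_ : U = [set: Omega] `&` (fun w => unit_ind (X ^~ w)) @^-1` [set 1]); first exact: mu.
  rewrite setTI; apply/seteqP; split => w; rewrite /U/= /unit_ind; first by move=> ->.
  by case: (_ \in _) => // /eqP; rewrite eq_sym oner_eq0.
have PU : P (~` U) = 0%E.
  have [A [mA A0 sA]] := ae_unit.
  by apply: (subset_measure0 _ mA) => //; exact: measurableC.
have key : (\int[P]_w (ndiag (X ^~ w) a)%:E <= ((mdim * g a)^-1)%:E)%E.
  (* Off [U], a null set, [inv_gram] is a default value and not the limit of B. *)
  rewrite -[X in integral _ X](setUv U) ge0_integral_setU//=; first last.
  - by rewrite disj_set2E setICr.
  - by move=> w _; rewrite lee_fin ndiag_ge0.
  - by rewrite setUv; apply/measurable_EFinP; exact: (coord_meas_X gX mN).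
  - exact: measurableC.
  rewrite [X in (_ + X)%E]null_set_integral//; last 2 first.
  - exact: measurableC.
  - by apply: measurable_funTS; apply/measurable_EFinP; exact: (coord_meas_X gX mN).
  rewrite adde0.
  pose f (n : nat) w := (gdiag (epsn n) (X ^~ w) a)%:E.
  have mf n : measurable_fun setT (f n).
    by apply/measurable_EFinP; exact: (coord_meas_X gX (coord_measurable_gdiag (epsn n) a)).
  have -> : (\int[P]_(w in U) (ndiag (X ^~ w) a)%:E = \int[P]_(w in U) limn_einf (f^~ w))%E.
    apply: eq_integral => w; rewrite inE => u.
    have c : f n w @[n --> \oo] --> (ndiag (X ^~ w) a)%:E.
      by apply: cvg_EFin; [exact: nearW|exact: reg_inv_cvg].
    by have [-> _] := cvg_limn_einf_sup c.
  apply: le_trans (fatou P mU _ _) _.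
  - by move=> n; apply: measurable_funTS; exact: mf.
  - by move=> n w _; rewrite lee_fin; exact: gdiag_ge0.
  rewrite limn_einf_lim; apply: lime_le; first exact: is_cvg_einfs.
  apply: nearW => n; apply: (@le_trans _ _ (\int[P]_(w in U) f n w)%E).
    by apply: ereal_inf_lbound; exists n => /=.
  apply: (@le_trans _ _ (\int[P]_w f n w)%E).
    by apply: ge0_subset_integral => // w _; rewrite lee_fin; exact: gdiag_ge0.
  rewrite (ExE (integ_gdiag a (epsn0 n))) lee_fin; exact: Ex_gdiag_le.
have iN : integ (fun x => ndiag x a).
  apply/integrableP; split; first by apply/measurable_EFinP; exact: (coord_meas_X gX mN).
  apply: le_lt_trans (ltry ((mdim * g a)^-1)).
  rewrite (eq_integral (fun w => (ndiag (X ^~ w) a)%:E))// => w _ /=.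
  by rewrite ger0_norm// ndiag_ge0.
by split => //; rewrite -lee_fin -ExE.
Qed.

Lemma integ_ndiag a : integ (fun x => ndiag x a).
Proof. by have [] := integ_Ex_ndiag a. Qed.

Lemma Ex_ndiag_le a : Ex (fun x => ndiag x a) <= ((M - K)%:R * g a)^-1.
Proof. by rewrite natrB ?(ltnW hMK)//; have [] := integ_Ex_ndiag a. Qed.

(** On the almost sure event of invertibility B_aa at eps = 1 is at most N_aa; multiplying by the
    indicator makes the comparison hold everywhere. *)
Lemma Ex_ndiag_gt0 a : 0 < Ex (fun x => ndiag x a).
Proof.
have mu := coord_measurable_unit_ind.
have mF : coord_measurable (fun x => gdiag 1 x a * unit_ind x).
  by apply: coord_measurableM => //; exact: coord_measurable_gdiag.
apply: lt_le_trans (Ex_gdiag_gt0 a) _.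
rewrite (Ex_ae (G := fun x => gdiag 1 x a * unit_ind x))//; last 2 first.
- exact: coord_measurable_gdiag.
- by move=> x u; rewrite /unit_ind u mulr1.
apply: Ex_le; last first.
- move=> x; rewrite /unit_ind; case: (boolP (_ \in _)) => u.
    by rewrite mulr1 gdiag_le_ndiag.
  by rewrite mulr0 ndiag_ge0.
- exact: integ_ndiag.
- apply: (integ_ae mF (integ_gdiag a (@ltr01 R))) => x u.
  by rewrite /unit_ind u mulr1 ger0_norm// gdiag_ge0.
Qed.

Lemma integ_inv_gram a b : integ (fun x => complex.Re (inv_gram x a b)).
Proof.
apply: (integ_le gX (G := fun x => 2^-1 * (ndiag x a + ndiag x b))).
- exact: (cmeas_inv_gram a b).1.
- by apply: integZ; apply: integD; exact: integ_ndiag.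
- by move=> x; rewrite mulrC; exact: inv_gram_Re_le.
Qed.

(** For a <> b the identity [stein_gram] says that [F n] has mean 0. As eps tends to 0, [F n]
    converges almost surely to g_a (M - K) Re N_ab, and dominated convergence carries the zero mean
    to the limit. *)
Lemma Ex_inv_gram_offdiag a b : a != b -> Ex (fun x => complex.Re (inv_gram x a b)) = 0.
Proof.
move=> ab.
pose F n x : R := epsn n * complex.Re (reg_inv (RC (epsn n)) (H x) a b) + g a * trace_term (epsn n) x a b.
have iB n : integ (fun x => complex.Re (reg_inv (RC (epsn n)) (H x) a b)).
  exact: (integ_bounded gX (@cmeas_reg_inv R M K _ a b).1 (fun x => reg_inv_Re_le_inv (epsn0 n) x a b)).
have mF n : coord_measurable (F n).
  apply: coord_measurableD; apply: coord_measurableM; try exact: coord_measurable_cst.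
    exact: (@cmeas_reg_inv R M K _ a b).1.
  exact: coord_measurable_trace_term.
have F0 n : Ex (F n) = 0.
  have := stein_gram (epsn0 n) gX s0 sE a b; rewrite (negbTE ab) sub0r /= => h.
  rewrite ExD; [|exact: integZ|by apply: integZ; exact: integ_trace_term].
  by rewrite !ExZ//; [rewrite -h subrr|exact: integ_trace_term].
have iF n : integ (F n).
  by apply: integD; apply: integZ => //; exact: integ_trace_term.
(* The constant uses eps <= 1 and M - K + eps tr B <= M; the other factor dominates Re B_ab through
   B_aa <= N_aa. *)
pose D x : R := (1 + g a * M%:R) * (2^-1 * (ndiag x a + ndiag x b)).
have iD : integ D by do 2 apply: integZ; apply: integD; exact: integ_ndiag.
pose L x : R := g a * mdim * complex.Re (inv_gram x a b).
have mL : coord_measurable L.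
  by apply: coord_measurableM; [exact: coord_measurable_cst|exact: (cmeas_inv_gram a b).1].
have iL : integ L by apply: integZ; exact: integ_inv_gram.
have dom n x : gram (H x) \in unitmx -> `|F n x| <= D x.
  move=> u; have /andP[t0 t1] := trace_bound x (epsn0 n).
  have b1 : `|complex.Re (reg_inv (RC (epsn n)) (H x) a b)| <= 2^-1 * (ndiag x a + ndiag x b).
    apply: le_trans (reg_inv_Re_le (epsn0 n) x a b) _; rewrite mulrC ler_pM2l ?invr_gt0//.
    by apply: lerD; apply: gdiag_le_ndiag.
  rewrite (_ : F n x = (epsn n + g a * (M%:R - K%:R + epsn n * \sum_j gdiag (epsn n) x j)) *
     complex.Re (reg_inv (RC (epsn n)) (H x) a b)); last by rewrite /F /trace_term; ring.
  have e1 : epsn n <= 1 by rewrite invf_le1 ?ltr0n// ler1n.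
  rewrite normrM; apply: ler_pM => //; rewrite ger0_norm.
    apply: lerD => //; apply: ler_wpM2l; first exact: ltW.
    by lra.
  apply: addr_ge0; first exact: ltW.
  by apply: mulr_ge0; [exact: ltW|rewrite addr_ge0// (ltW mdim0)].
have cF x : gram (H x) \in unitmx -> F n x @[n --> \oo] --> L x.
  move=> u; have cB := @reg_inv_cvg x a b u.
  have ce : epsn n @[n --> \oo] --> (0 : R) by exact: cvg_harmonic.
  have cg j : gdiag (epsn n) x j @[n --> \oo] --> ndiag x j by exact: reg_inv_cvg.
  have cs : (\sum_j gdiag (epsn n) x j) @[n --> \oo] --> \sum_j ndiag x j.
    elim: (index_enum _) => [|j r IH].
      by under eq_fun do rewrite big_nil; rewrite big_nil; exact: cvg_cst.
    by under eq_fun do rewrite big_cons; rewrite big_cons; exact: cvgD.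
  rewrite (_ : L x = 0 * complex.Re (inv_gram x a b) +
     g a * (complex.Re (inv_gram x a b) * (M%:R - K%:R + 0 * \sum_j ndiag x j))); last first.
    by rewrite /L /mdim; ring.
  apply: cvgD; first exact: cvgM.
  apply: cvgM; first exact: cvg_cst.
  apply: cvgM => //; apply: cvgD; first exact: cvg_cst.
  exact: cvgM.
have cI : ((\int[P]_(w in setT) (F n (X ^~ w))%:E) @[n --> \oo] -->
    \int[P]_(w in setT) (L (X ^~ w))%:E)%E.
  have [|||||_ _] // := @dominated_convergence _ _ _ P setT measurableT (fun n w => (F n (X ^~ w))%:E)
    (fun w => (L (X ^~ w))%:E) (fun w => (D (X ^~ w))%:E).
  - by move=> n; exact: measurable_int (iF n).
  - exact: measurable_int iL.
  - apply: filterS ae_unit => w u _; apply: cvg_EFin; first exact: nearW.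
    exact: cF.
  - by apply: filterS ae_unit => w u n _; rewrite /= lee_fin; exact: dom.
have EL : Ex L = 0.
  apply: EFin_inj; rewrite -ExE//; apply/esym; apply: (cvg_unique _ _ cI) => //.
  by rewrite /=; under eq_fun do rewrite ExE// F0; exact: cvg_cst.
move: EL; rewrite ExZ; last exact: integ_inv_gram.
by move/eqP; rewrite mulf_eq0 (gt_eqF (mulr_gt0 (g0 a) mdim0))/= => /eqP.
Qed.

End zf_limits.

(** * Zero-forcing combinations *)

Section linear_forms.
Context {R : realType} {d : measure_display} {Omega : measurableType d}.
Variables (P : probability Omega R) (I : finType) (X : I -> Omega -> R) (s : I -> R).
Hypotheses (gX : gaussian_family P X s) (s0 : forall i, 0 < s i).
Variables (T : finType) (c : T -> I) (G : T -> (I -> R) -> R) (v : R).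
Hypotheses (c_inj : injective c) (cv : forall t, s (c t) ^+ 2 = v).
Hypotheses (mG : forall t, coord_measurable (G t))
  (Gc : forall t t' x r, G t (upd x (c t') r) = G t x)
  (iG2 : forall t, integ P X (fun x => G t x ^+ 2)).
Local Notation Ex := (Ex P X).
Local Notation integ := (integ P X).

Let iG t : integ (G t).
Proof.
apply: (integ_le gX (G := fun x => 1 + G t x ^+ 2)) => //.
  by apply: integD => //; exact: integ_cst.
move=> x; rewrite -(real_normK (num_real (G t x))).
by have := sqr_ge0 (`|G t x| - 1); have := normr_ge0 (G t x); nra.
Qed.

Let iGG t u : integ (fun x => G t x * G u x).
Proof.
apply: (integ_le gX (G := fun x => G t x ^+ 2 + G u x ^+ 2)).
- exact: coord_measurableM.
- exact: integD.
- move=> x; rewrite normrM -(real_normK (num_real (G t x))) -(real_normK (num_real (G u x))).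
  have := sqr_ge0 (`|G t x| - `|G u x|); have := normr_ge0 (G t x); have := normr_ge0 (G u x); nra.
Qed.

Lemma Ex_linear_form : integ (fun x => \sum_t x (c t) * G t x) /\
  Ex (fun x => \sum_t x (c t) * G t x) = 0.
Proof.
have h t : integ (fun x => x (c t) * G t x) /\ Ex (fun x => x (c t) * G t x) = 0.
  exact: (Ex_coordM gX s0 (i := c t) (mG t) (fun x r => Gc t t x r) (iG t)).
split; first by apply: integ_sum => t; exact: (h t).1.
by rewrite Ex_sum => [|t]; [rewrite big1// => t _; exact: (h t).2|exact: (h t).1].
Qed.

(** In the expanded square a product of two distinct coordinates averages to 0 by resampling one of
    them, injectivity of [c] keeping the other fixed; the diagonal terms contribute the variance
    [v]. *)
Lemma Ex_linear_form_sqr : integ (fun x => (\sum_t x (c t) * G t x) ^+ 2) /\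
  Ex (fun x => (\sum_t x (c t) * G t x) ^+ 2) = v * \sum_t Ex (fun x => G t x ^+ 2).
Proof.
pose Q t u x := x (c t) * (x (c u) * (G t x * G u x)).
have hQ t u : integ (Q t u) /\ Ex (Q t u) = if t == u then v * Ex (fun x => G t x ^+ 2) else 0.
  have mGG : coord_measurable (fun x => G t x * G u x) by exact: coord_measurableM.
  case: eqVneq => [<-|tu].
    have [||//|h1 h2] := Ex_coord_sqrM gX s0 (i := c t) (G := fun x => G t x ^+ 2).
    - by move=> d0 U Z mZ; apply: measurable_funX; exact: mG.
    - by move=> x r; rewrite Gc.
    rewrite cv in h2; rewrite -h2.
    by rewrite (_ : Q t t = fun x => x (c t) ^+ 2 * G t x ^+ 2)//; apply/funext => x; rewrite /Q !expr2; ring.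
  have [|h1 _] := Ex_coordM gX s0 (i := c u) mGG _ (iGG t u).
    by move=> x r; rewrite !Gc.
  apply: (Ex_coordM gX s0 (i := c t)) => //.
    by apply: coord_measurableM => //; exact: coord_measurable_coord.
  move=> x r; rewrite !Gc; congr (_ * _).
  by rewrite /upd; case: eqVneq => // /c_inj e; rewrite e eqxx in tu.
have E : (fun x => (\sum_t x (c t) * G t x) ^+ 2) = fun x => \sum_t \sum_u Q t u x.
  apply/funext => x; rewrite expr2 mulr_suml; apply: eq_bigr => t _.
  by rewrite mulr_sumr; apply: eq_bigr => u _; rewrite /Q; ring.
rewrite E; split.
  by apply: integ_sum => t; apply: integ_sum => u; exact: (hQ t u).1.
rewrite Ex_sum; last by move=> t; apply: integ_sum => u; exact: (hQ t u).1.
rewrite mulr_sumr; apply: eq_bigr => t _.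
rewrite Ex_sum; last by move=> u; exact: (hQ t u).1.
rewrite (bigD1 t)//= (hQ t t).2 eqxx big1 ?addr0// => u ut.
by rewrite (hQ t u).2 eq_sym (negbTE ut).
Qed.

End linear_forms.

Section zf_moments.
Context {R : realType} {d : measure_display} {Omega : measurableType d}.
Variables (P : probability Omega R) (M K : nat).
Local Notation C := R[i].
Local Notation J := ('I_K * 'I_M * bool * bool)%type.
Variables (X : J -> Omega -> R) (s : J -> R) (g er : 'I_K -> R).
Hypotheses (gX : gaussian_family P X s) (s0 : forall i, 0 < s i).
Hypothesis sE : forall k m re, s (k, m, re, true) ^+ 2 = g k / 2.
Hypothesis sErr : forall k m re, s (k, m, re, false) ^+ 2 = er k / 2.
Hypotheses (g0 : forall k, 0 < g k) (hMK : (K < M)%N).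
Local Notation Ex := (Ex P X).
Local Notation integ := (integ P X).
Local Notation H := (@est_mx R M K).

Definition zf_mx (x : J -> R) : 'M[C]_(M, K) := H x *m inv_gram x.
Definition err_vec k (x : J -> R) : 'cV[C]_M :=
  \col_m Complex (x (k, m, true, false)) (x (k, m, false, false)).
(** A single precoder and the superposition of all transmitted signals are both real combinations of
    the zero-forcing directions, so their moments are computed once for arbitrary [c]. *)
Definition zf_comb (c : 'I_K -> R) (x : J -> R) : 'cV[C]_M :=
  zf_mx x *m \col_a RC (c a).

Lemma cmeas_zf_comb c m : cmeas (fun x => zf_comb c x m 0).
Proof.
have mc : cmeas_mx (fun _ : J -> R => \col_a RC (c a) : 'cV[C]_K).
  by move=> i j; exact: cmeas_cst.
have mz : cmeas_mx zf_mx by apply: cmeas_mulmx; [exact: cmeas_est_mx|exact: cmeas_inv_gram].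
exact: (cmeas_mulmx mz mc).
Qed.

Lemma zf_comb_upd c x k m re r : zf_comb c (upd x (k, m, re, false) r) = zf_comb c x.
Proof.
have HE : H (upd x (k, m, re, false) r) = H x.
  by apply/matrixP => i j; rewrite !mxE /upd !xpair_eqE !andbF.
by rewrite /zf_comb /zf_mx /inv_gram HE.
Qed.

(** N = (H N)^H (H N), so the squared norm is the quadratic form of N at the real vector [c]; its
    value is real, whence only Re N_ab appears. *)
Lemma zf_comb_norm c x : gram (H x) \in unitmx ->
  cnorm2 (zf_comb c x) = \sum_a \sum_b c a * c b * complex.Re (inv_gram x a b).
Proof.
move=> u; apply: RC_inj.
have -> : RC (cnorm2 (zf_comb c x)) = (adjm (zf_comb c x) *m zf_comb c x) 0 0.
  by rewrite adjm_mul_diag RC_sum; apply: eq_bigr => m _; rewrite normc_sqr.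
have AE : adjm (zf_comb c x) *m zf_comb c x =
    adjm (\col_a RC (c a)) *m inv_gram x *m \col_a RC (c a).
  by rewrite [in RHS]/inv_gram (inv_gram_sum u) /zf_comb /zf_mx !adjmM !mulmxA.
have E : (adjm (\col_a RC (c a)) *m inv_gram x *m \col_a RC (c a)) 0 0 =
    \sum_a \sum_b RC (c a * c b) * inv_gram x a b.
  rewrite mxE exchange_big; apply: eq_bigr => b _; rewrite mxE mulr_suml.
  apply: eq_bigr => a _; rewrite !mxE RCM mulrAC; congr (_ * _ * _).
  by rewrite /RC/=; apply/eqP; rewrite eq_complex/= oppr0 !eqxx.
have r0 : 0 <= (adjm (zf_comb c x) *m zf_comb c x) 0 0.
  by rewrite adjm_mul_diag; apply: sumr_ge0 => i _; rewrite exprn_ge0.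
rewrite (ReRC_ge0 r0); congr RC; rewrite AE E Re_sum; apply: eq_bigr => a _.
by rewrite Re_sum; apply: eq_bigr => b _; rewrite creM /= mul0r subr0.
Qed.

(** Zero forcing proper: H^H H N = 1, so each estimated channel sees only its own coefficient. *)
Lemma est_zf_comb c x k : gram (H x) \in unitmx ->
  cdot (col k (H x)) (zf_comb c x) = RC (c k).
Proof.
move=> u.
have -> : cdot (col k (H x)) (zf_comb c x) = (adjm (H x) *m zf_comb c x) k 0.
  by rewrite mxE; apply: eq_bigr => m _; rewrite !mxE cconjE.
by rewrite /zf_comb /zf_mx !mulmxA -/(gram (H x)) /inv_gram mulmxV// mul1mx mxE.
Qed.

Let mN2 c : coord_measurable (fun x => cnorm2 (zf_comb c x)).
Proof.
move=> d0 T Z mZ; apply: measurable_sum => m; rewrite /cabs2.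
have [m1 m2] := cmeas_zf_comb c m.
by apply: measurable_funD; apply: measurable_funX; [exact: m1|exact: m2].
Qed.

Let mgram2 c : coord_measurable (fun x : J -> R => \sum_a \sum_b c a * c b * complex.Re (inv_gram x a b)).
Proof.
move=> d0 T Z mZ; apply: measurable_sum => a; apply: measurable_sum => b.
have h : coord_measurable (fun x : J -> R => c a * c b * complex.Re (inv_gram x a b)).
  by apply: coord_measurableM; [exact: coord_measurable_cst|exact: (@cmeas_inv_gram R M K a b).1].
exact: h.
Qed.

Lemma integ_zf_comb_norm c : integ (fun x => cnorm2 (zf_comb c x)).
Proof.
have iS : integ (fun x : J -> R => \sum_a \sum_b c a * c b * complex.Re (inv_gram x a b)).
  apply: integ_sum => a; apply: integ_sum => b; apply: integZ.
  exact: (integ_inv_gram gX s0 sE g0 hMK).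
apply: (integ_ae gX s0 sE g0 hMK (mN2 c) iS) => x u.
rewrite -zf_comb_norm// ger0_norm//; apply: sumr_ge0 => m _; exact: cabs2_ge0.
Qed.

Lemma Ex_zf_comb_norm c :
  Ex (fun x => cnorm2 (zf_comb c x)) = \sum_a c a ^+ 2 * Ex (fun x : J -> R => ndiag x a).
Proof.
have iN a b : integ (fun x : J -> R => complex.Re (inv_gram x a b)).
  exact: (integ_inv_gram gX s0 sE g0 hMK).
rewrite (Ex_ae gX s0 sE g0 hMK (mN2 c) (mgram2 c) (@zf_comb_norm c)).
rewrite Ex_sum; last by move=> a; apply: integ_sum => b; exact: integZ.
apply: eq_bigr => a _; rewrite Ex_sum; last by move=> b; exact: integZ.
rewrite (bigD1 a)//= ExZ// -expr2 big1 ?addr0// => b ba.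
by rewrite ExZ// (Ex_inv_gram_offdiag gX s0 sE g0 hMK) ?mulr0// eq_sym.
Qed.

Section error_form.
Variables (c : 'I_K -> R) (k : 'I_K).
Let u x m := zf_comb c x m 0.
Let T := ('I_M * bool)%type.
Let ci (t : T) : J := (k, t.1, t.2, false).
(** Weights read off conj(x + i y) (p + i q) = (x p + y q) + i (x q - y p), where x and y are error
    coordinates and p + i q is an entry of the combination; [GIm] holds those of the imaginary
    part. *)
Let GRe (t : T) x : R := if t.2 then complex.Re (u x t.1) else complex.Im (u x t.1).
Let GIm (t : T) x : R := if t.2 then complex.Im (u x t.1) else - complex.Re (u x t.1).

Let ci_inj : injective ci.
Proof. by move=> [m r] [m' r'] [-> ->]. Qed.

Let cdot_err_Re x : complex.Re (cdot (err_vec k x) (zf_comb c x)) = \sum_t x (ci t) * GRe t x.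
Proof.
rewrite /cdot Re_sum -(pair_bigA _ (fun m b => x (ci (m, b)) * GRe (m, b) x)) /=.
apply: eq_bigr => m _; rewrite big_bool /ci /GRe /u /= mxE creM/=.
by ring.
Qed.

Let cdot_err_Im x : complex.Im (cdot (err_vec k x) (zf_comb c x)) = \sum_t x (ci t) * GIm t x.
Proof.
rewrite /cdot Im_sum -(pair_bigA _ (fun m b => x (ci (m, b)) * GIm (m, b) x)) /=.
apply: eq_bigr => m _; rewrite big_bool /ci /GIm /u /= mxE cimM/=.
by ring.
Qed.

Let mRe t : coord_measurable (GRe t).
Proof. by rewrite /GRe; case: (t.2); [exact: (cmeas_zf_comb c t.1).1|exact: (cmeas_zf_comb c t.1).2]. Qed.

Let mIm t : coord_measurable (GIm t).
Proof.
rewrite /GIm; case: (t.2); first exact: (cmeas_zf_comb c t.1).2.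
move=> d0 Y Z mZ; apply: (measurableT_comp (f := fun r : R => - r)); first exact: oppr_measurable.
exact: (cmeas_zf_comb c t.1).1.
Qed.

Let Gc (Q : T -> (J -> R) -> R) : Q = GRe \/ Q = GIm ->
  forall t t' x r, Q t (upd x (ci t') r) = Q t x.
Proof. by move=> [|] -> t t' x r; rewrite /GRe /GIm /u /ci zf_comb_upd. Qed.

Let sqr_le (t : T) x : GRe t x ^+ 2 <= cnorm2 (zf_comb c x) /\ GIm t x ^+ 2 <= cnorm2 (zf_comb c x).
Proof.
have h : cabs2 (u x t.1) <= cnorm2 (zf_comb c x).
  by rewrite /cnorm2 (bigD1 t.1)//= lerDl sumr_ge0// => m _; exact: cabs2_ge0.
have hr := Re_sqr_le (u x t.1).
have hi : complex.Im (u x t.1) ^+ 2 <= cabs2 (u x t.1) by rewrite lerDr sqr_ge0.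
by rewrite /GRe /GIm; case: (t.2); rewrite ?sqrrN; split; apply: le_trans h.
Qed.

Let iRe2 t : integ (fun x => GRe t x ^+ 2).
Proof.
apply: (integ_le gX _ (integ_zf_comb_norm c)).
  by move=> d0 Y Z mZ; apply: measurable_funX; exact: mRe.
by move=> x; rewrite ger0_norm ?sqr_ge0//; exact: (sqr_le t x).1.
Qed.

Let iIm2 t : integ (fun x => GIm t x ^+ 2).
Proof.
apply: (integ_le gX _ (integ_zf_comb_norm c)).
  by move=> d0 Y Z mZ; apply: measurable_funX; exact: mIm.
by move=> x; rewrite ger0_norm ?sqr_ge0//; exact: (sqr_le t x).2.
Qed.

Let sv t : s (ci t) ^+ 2 = er k / 2. Proof. exact: sErr. Qed.

Lemma Ex_err_Re : integ (fun x => complex.Re (cdot (err_vec k x) (zf_comb c x))) /\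
  Ex (fun x => complex.Re (cdot (err_vec k x) (zf_comb c x))) = 0.
Proof.
rewrite (_ : (fun x => _) = fun x => \sum_t x (ci t) * GRe t x); last first.
  by apply/funext.
exact: (Ex_linear_form gX s0 mRe (Gc (or_introl erefl)) iRe2).
Qed.

Lemma Ex_err_Im : integ (fun x => complex.Im (cdot (err_vec k x) (zf_comb c x))) /\
  Ex (fun x => complex.Im (cdot (err_vec k x) (zf_comb c x))) = 0.
Proof.
rewrite (_ : (fun x => _) = fun x => \sum_t x (ci t) * GIm t x); last first.
  by apply/funext.
exact: (Ex_linear_form gX s0 mIm (Gc (or_intror erefl)) iIm2).
Qed.

(** At each error coordinate the squared weights of the two parts add up to |u_m|^2. Every antenna
    has two coordinates, and this factor 2 cancels the half in the variance er_k / 2. *)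
Lemma Ex_err_cabs2 : integ (fun x => cabs2 (cdot (err_vec k x) (zf_comb c x))) /\
  Ex (fun x => cabs2 (cdot (err_vec k x) (zf_comb c x))) =
  er k * \sum_a c a ^+ 2 * Ex (fun x : J -> R => ndiag x a).
Proof.
have [h1 h2] := Ex_linear_form_sqr gX s0 ci_inj sv mRe (Gc (or_introl erefl)) iRe2.
have [h3 h4] := Ex_linear_form_sqr gX s0 ci_inj sv mIm (Gc (or_intror erefl)) iIm2.
have -> : (fun x => cabs2 (cdot (err_vec k x) (zf_comb c x))) =
    fun x => (\sum_t x (ci t) * GRe t x) ^+ 2 + (\sum_t x (ci t) * GIm t x) ^+ 2.
  by apply/funext => x; rewrite /cabs2 cdot_err_Re cdot_err_Im.
split; first exact: integD.
rewrite ExD// h2 h4 -mulrDr -big_split/= -Ex_zf_comb_norm.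
have -> : \sum_t (Ex (fun x => GRe t x ^+ 2) + Ex (fun x => GIm t x ^+ 2)) =
    2 * Ex (fun x => cnorm2 (zf_comb c x)).
  rewrite -ExZ; last exact: integ_zf_comb_norm.
  transitivity (Ex (fun x => \sum_t (GRe t x ^+ 2 + GIm t x ^+ 2))).
    rewrite Ex_sum; last by move=> t; exact: integD.
    by apply: eq_bigr => t _; rewrite ExD.
  congr (Ex _); apply/funext => x.
  rewrite -(pair_bigA _ (fun m b => GRe (m, b) x ^+ 2 + GIm (m, b) x ^+ 2)) /=.
  rewrite /cnorm2 mulr_sumr; apply: eq_bigr => m _.
  by rewrite big_bool /GRe /GIm /= /cabs2 /u; ring.
by field.
Qed.

End error_form.

Definition chan_vec k x : 'cV[C]_M := col k (H x) + err_vec k x.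

Lemma cdotDl (a b v : 'cV[C]_M) : cdot (a + b) v = cdot a v + cdot b v.
Proof.
rewrite /cdot -big_split/=; apply: eq_bigr => m _.
by rewrite mxE !cconjE rmorphD mulrDl.
Qed.

Let cmeas_cdot (a : (J -> R) -> 'cV[C]_M) c : (forall m, cmeas (fun x => a x m 0)) ->
  cmeas (fun x => cdot (a x) (zf_comb c x)).
Proof.
move=> ma; rewrite /cdot; apply: (class_sum (@cmeas_cst _ _) (@cmeas_add _ _)) => m.
apply: cmeas_mul; last exact: cmeas_zf_comb.
rewrite (_ : (fun x => _) = fun x => Num.conj (a x m 0)); first exact: cmeas_conj.
by apply/funext => x; exact: cconjE.
Qed.

Let cmeas_err k m : cmeas (fun x => err_vec k x m 0).
Proof.
by split => d0 T Z mZ; under eq_fun do rewrite mxE/=; exact: mZ.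
Qed.

Let cmeas_chan k m : cmeas (fun x => chan_vec k x m 0).
Proof.
rewrite (_ : (fun x => _) = fun x => H x m k + err_vec k x m 0).
  by apply: cmeas_add; [exact: cmeas_est_mx|exact: cmeas_err].
by apply/funext => x; rewrite mxE [X in X + _]mxE.
Qed.

Lemma chan_zf_comb c k x : gram (H x) \in unitmx ->
  cdot (chan_vec k x) (zf_comb c x) = RC (c k) + cdot (err_vec k x) (zf_comb c x).
Proof. by move=> u; rewrite cdotDl est_zf_comb. Qed.

Lemma Ex_chan_Re c k : Ex (fun x => complex.Re (cdot (chan_vec k x) (zf_comb c x))) = c k.
Proof.
have [i1 e1] := Ex_err_Re c k.
rewrite (Ex_ae gX s0 sE g0 hMK (G := fun x => c k + complex.Re (cdot (err_vec k x) (zf_comb c x)))).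
- by rewrite ExD ?Ex_cst ?e1 ?addr0//; exact: integ_cst.
- exact: (cmeas_cdot c (cmeas_chan k)).1.
- by apply: coord_measurableD; [exact: coord_measurable_cst|exact: (cmeas_cdot c (cmeas_err k)).1].
- by move=> x u; rewrite chan_zf_comb// creD.
Qed.

Lemma Ex_chan_Im c k : Ex (fun x => complex.Im (cdot (chan_vec k x) (zf_comb c x))) = 0.
Proof.
have [i1 e1] := Ex_err_Im c k.
rewrite (Ex_ae gX s0 sE g0 hMK (G := fun x => complex.Im (cdot (err_vec k x) (zf_comb c x))))//.
- exact: (cmeas_cdot c (cmeas_chan k)).2.
- exact: (cmeas_cdot c (cmeas_err k)).2.
- by move=> x u; rewrite chan_zf_comb// cimD/= add0r.
Qed.

Let cabs2_meas (f : (J -> R) -> C) : cmeas f -> coord_measurable (fun x => cabs2 (f x)).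
Proof.
move=> [f1 f2] d0 T Z mZ; rewrite /cabs2.
by apply: measurable_funD; apply: measurable_funX; [exact: f1|exact: f2].
Qed.

(** Almost surely the inner product is c_k plus the error form, which has mean 0, so the cross term
    drops out. *)
Lemma Ex_chan_cabs2 c k :
  Ex (fun x => cabs2 (cdot (chan_vec k x) (zf_comb c x))) =
  c k ^+ 2 + er k * \sum_a c a ^+ 2 * Ex (fun x : J -> R => ndiag x a).
Proof.
have [i1 e1] := Ex_err_Re c k; have [i2 e2] := Ex_err_cabs2 c k.
have i3 : integ (fun x => 2 * c k * complex.Re (cdot (err_vec k x) (zf_comb c x))) by exact: integZ.
rewrite -e2 (Ex_ae gX s0 sE g0 hMK (G := fun x => c k ^+ 2 +
  (2 * c k * complex.Re (cdot (err_vec k x) (zf_comb c x)) + cabs2 (cdot (err_vec k x) (zf_comb c x))))).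
- rewrite ExD; [|exact: integ_cst|exact: integD].
  by rewrite Ex_cst ExD// ExZ// e1 mulr0 add0r.
- exact: (cabs2_meas (cmeas_cdot c (cmeas_chan k))).
- apply: coord_measurableD; first exact: coord_measurable_cst.
  apply: coord_measurableD; last exact: (cabs2_meas (cmeas_cdot c (cmeas_err k))).
  apply: coord_measurableM; first exact: coord_measurable_cst.
  exact: (cmeas_cdot c (cmeas_err k)).1.
- move=> x u; rewrite chan_zf_comb// /cabs2 creD cimD /=.
  by ring.
Qed.

End zf_moments.

(** * The joint law of estimates and errors *)

Section family_rotations.
Context {R : realType} {d : measure_display} {Omega : measurableType d}.
Variables (P : probability Omega R) (I : finType).
Local Notation fam := (gaussian_family P).

Lemma gaussian_family_rotate_to (X Y : I -> Omega -> R) (s t : I -> R) (i j : I) (a b c e : R) :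
  fam X s -> i != j -> (forall l, 0 < s l) -> (forall l, 0 < t l) ->
  a != 0 -> a * e - b * c != 0 -> a * c * s i ^+ 2 + b * e * s j ^+ 2 = 0 ->
  t i ^+ 2 = a ^+ 2 * s i ^+ 2 + b ^+ 2 * s j ^+ 2 ->
  t j ^+ 2 = c ^+ 2 * s i ^+ 2 + e ^+ 2 * s j ^+ 2 ->
  (forall w, Y i w = a * X i w + b * X j w) -> (forall w, Y j w = c * X i w + e * X j w) ->
  (forall l, l != i -> l != j -> Y l = X l /\ t l = s l) -> fam Y t.
Proof.
move=> gX ij s0 t0 a0 D0 orth tiE tjE Yi Yj Yl.
have := gaussian_family_rotate gX ij (s0 i) (s0 j) (t0 i) (t0 j) a0 D0 orth tiE tjE.
congr (gaussian_family _ _ _).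
  apply/funext => l; apply/funext => w.
  have [->|li] := eqVneq l i; first by rewrite Yi.
  by have [->|lj] := eqVneq l j; [rewrite Yj|have [-> _] := Yl l li lj].
apply/funext => l.
have [->//|li] := eqVneq l i.
by have [->//|lj] := eqVneq l j; have [_ ->] := Yl l li lj.
Qed.

(* A rotation by a right angle has pivot [p = 0], excluded in [gaussian_family_rotate];
   it is performed as two rotations by pi / 4. *)
Lemma gaussian_family_phase (X Y : I -> Omega -> R) (s t : I -> R) (i j : I) (p q : R) :
  fam X s -> i != j -> (forall l, 0 < s l) -> (forall l, 0 < t l) -> s j ^+ 2 = s i ^+ 2 ->
  0 < p ^+ 2 + q ^+ 2 ->
  t i ^+ 2 = (p ^+ 2 + q ^+ 2) * s i ^+ 2 -> t j ^+ 2 = (p ^+ 2 + q ^+ 2) * s i ^+ 2 ->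
  (forall w, Y i w = p * X i w - q * X j w) -> (forall w, Y j w = q * X i w + p * X j w) ->
  (forall l, l != i -> l != j -> Y l = X l /\ t l = s l) -> fam Y t.
Proof.
have nz (u v : R) : u != 0 -> 0 < u ^+ 2 + v ^+ 2.
  by move=> u0; rewrite ltr_pwDl ?sqr_ge0// exprn_even_gt0.
have direct X' Y' (s' t' : I -> R) (p' q' : R) : p' != 0 ->
    fam X' s' -> i != j -> (forall l, 0 < s' l) -> (forall l, 0 < t' l) -> s' j ^+ 2 = s' i ^+ 2 ->
    t' i ^+ 2 = (p' ^+ 2 + q' ^+ 2) * s' i ^+ 2 -> t' j ^+ 2 = (p' ^+ 2 + q' ^+ 2) * s' i ^+ 2 ->
    (forall w, Y' i w = p' * X' i w - q' * X' j w) ->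
    (forall w, Y' j w = q' * X' i w + p' * X' j w) ->
    (forall l, l != i -> l != j -> Y' l = X' l /\ t' l = s' l) -> fam Y' t'.
  move=> p0 gX ij s0 t0 ss ti tj Yi Yj Yl.
  apply: (gaussian_family_rotate_to (a := p') (b := - q') (c := q') (e := p') gX ij) => //.
  - by rewrite (_ : _ - _ = p' ^+ 2 + q' ^+ 2) ?gt_eqF ?nz//; ring.
  - by rewrite ss; ring.
  - by rewrite ti ss; ring.
  - by rewrite tj ss; ring.
  - by move=> w; rewrite Yi mulNr.
move=> gX ij s0 t0 ss pq ti tj Yi Yj Yl.
have [p0|] := eqVneq p 0; last by move=> p0; exact: (direct X Y s t p q).
have q0 : q != 0 by apply: contraTneq pq => ->; rewrite p0 expr0n addr0 ltxx.
pose X1 l w := if l == i then X i w - X j w else if l == j then X i w + X j w else X l w.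
pose s1 l := if (l == i) || (l == j) then Num.sqrt 2 * s i else s l.
have ji : (j == i) = false by rewrite eq_sym (negbTE ij).
have s1i : s1 i ^+ 2 = 2 * s i ^+ 2 by rewrite /s1 eqxx/= exprMn sqr_sqrtr.
have s1j : s1 j ^+ 2 = 2 * s i ^+ 2 by rewrite /s1 eqxx orbT exprMn sqr_sqrtr.
have s10 l : 0 < s1 l by rewrite /s1; case: ifP => // _; rewrite mulr_gt0 ?sqrtr_gt0.
have g1 : fam X1 s1.
  apply: (direct X X1 s s1 1 1) => //.
  - by rewrite s1i; ring.
  - by rewrite s1j; ring.
  - by move=> w; rewrite /X1 eqxx !mul1r.
  - by move=> w; rewrite /X1 ji eqxx !mul1r.
  - by move=> l li lj; rewrite /X1 /s1 (negbTE li) (negbTE lj).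
(* In complex notation the two maps are multiplications by 1 + i and (q / 2) (1 + i), with product i
   q. *)
apply: (direct X1 Y s1 t (q / 2) (q / 2)) => //.
- by rewrite mulf_neq0 ?invr_eq0 ?pnatr_eq0.
- by rewrite s1i s1j.
- by rewrite ti s1i p0; field.
- by rewrite tj s1i p0; field.
- by move=> w; rewrite Yi p0 /X1 eqxx ji eqxx; field.
- by move=> w; rewrite Yj p0 /X1 eqxx ji eqxx; field.
- by move=> l li lj; rewrite /X1 /s1 (negbTE li) (negbTE lj)/=; exact: Yl.
Qed.

(** With c = p + i q, the hypothesis on a (1 - a) vh says that the estimate a h + c z and the error
    (1 - a) h - c z are uncorrelated. The noise z is replaced by c z; the real parts and the
    imaginary parts are then mapped in two separate planes. *)
Lemma gaussian_family_mmse4 (X Y : I -> Omega -> R) (s t : I -> R) (hr hi zr zi : I)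
    (a p q vh vz : R) :
  fam X s -> (forall l, 0 < s l) -> (forall l, 0 < t l) -> uniq [:: hr; hi; zr; zi] ->
  s hr ^+ 2 = vh -> s hi ^+ 2 = vh -> s zr ^+ 2 = vz -> s zi ^+ 2 = vz ->
  0 < a -> 0 < p ^+ 2 + q ^+ 2 -> a * (1 - a) * vh = (p ^+ 2 + q ^+ 2) * vz ->
  t hr ^+ 2 = a * vh -> t hi ^+ 2 = a * vh ->
  t zr ^+ 2 = (1 - a) * vh -> t zi ^+ 2 = (1 - a) * vh ->
  (forall w, Y hr w = a * X hr w + (p * X zr w - q * X zi w)) ->
  (forall w, Y hi w = a * X hi w + (q * X zr w + p * X zi w)) ->
  (forall w, Y zr w = X hr w - Y hr w) -> (forall w, Y zi w = X hi w - Y hi w) ->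
  (forall l, l \notin [:: hr; hi; zr; zi] -> Y l = X l /\ t l = s l) -> fam Y t.
Proof.
move=> gX s0 t0 /=; rewrite !inE !negb_or => /andP[/and3P[n1 n2 n3]] /and3P[/andP[n4 n5] n6 _].
move=> shr shi szr szi a0 pq orth thr thi tzr tzi Yhr Yhi Yzr Yzi Yl.
have [m1 m2 m3 m4 [m5 m6]] : [/\ (hi == hr) = false, (zr == hr) = false, (zi == hr) = false,
    (zr == hi) = false & (zi == hi) = false /\ (zi == zr) = false].
  by split; [..|split]; rewrite eq_sym; apply/negbTE.
move: n1 n2 n3 n4 n5 n6 => /negbTE n1 /negbTE n2 /negbTE n3 /negbTE n4 /negbTE n5 /negbTE n6.
have vz0 : 0 < vz by rewrite -szr exprn_gt0.
pose X1 l w := if l == zr then p * X zr w - q * X zi w else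
  if l == zi then q * X zr w + p * X zi w else X l w.
pose v := (p ^+ 2 + q ^+ 2) * vz.
have v0 : 0 < v by rewrite mulr_gt0.
pose s1 l := if (l == zr) || (l == zi) then Num.sqrt v else s l.
have sv : Num.sqrt v ^+ 2 = v by rewrite sqr_sqrtr// ltW.
have s10 l : 0 < s1 l by rewrite /s1; case: ifP => // _; rewrite sqrtr_gt0.
have g1 : fam X1 s1.
  apply: (gaussian_family_phase (i := zr) (j := zi) (p := p) (q := q) gX) => //.
  - by rewrite n6.
  - by rewrite szr szi.
  - by rewrite /s1 eqxx sv szr.
  - by rewrite /s1 eqxx orbT sv szr.
  - by move=> w; rewrite /X1 eqxx.
  - by move=> w; rewrite /X1 m6 eqxx.
  - by move=> l lr li; rewrite /X1 /s1 (negbTE lr) (negbTE li).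
pose X2 l := if (l == hr) || (l == zr) then Y l else X1 l.
pose s2 l := if (l == hr) || (l == zr) then t l else s1 l.
have s20 l : 0 < s2 l by rewrite /s2; case: ifP.
have det : a * -1 - 1 * (1 - a) != 0 by rewrite (_ : _ - _ = -1) ?oppr_eq0 ?oner_eq0//; ring.
have g2 : fam X2 s2.
  apply: (gaussian_family_rotate_to (i := hr) (j := zr) (a := a) (b := 1) (c := 1 - a) (e := -1) g1) => //.
  - by rewrite n2.
  - by rewrite gt_eqF.
  - by rewrite /s1 n2 n3 eqxx/= sv shr /v -orth; ring.
  - by rewrite /s2 /s1 n2 n3 !eqxx/= sv thr shr /v -orth; ring.
  - by rewrite /s2 /s1 n2 n3 !eqxx orbT/= sv tzr shr /v -orth; ring.
  - by move=> w; rewrite /X2 /X1 n2 n3 !eqxx/= Yhr; ring.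
  - by move=> w; rewrite /X2 /X1 n2 n3 !eqxx orbT/= Yzr Yhr; ring.
  - by move=> l lr li; rewrite /X2 /s2 (negbTE lr) (negbTE li).
apply: (gaussian_family_rotate_to (i := hi) (j := zi) (a := a) (b := 1) (c := 1 - a) (e := -1) g2) => //.
- by rewrite n5.
- by rewrite gt_eqF.
- by rewrite /s2 /s1 m1 n4 n5 m3 m6 eqxx/= sv shi /v -orth; ring.
- by rewrite /s2 /s1 m1 n4 n5 m3 m6 eqxx/= sv thi shi /v -orth; ring.
- by rewrite /s2 /s1 m1 n4 n5 m3 m6 eqxx/= sv tzi shi /v -orth; ring.
- by move=> w; rewrite /X2 /X1 m1 n4 n5 m3 m6 eqxx/= Yhi; ring.
- by move=> w; rewrite /X2 /X1 m1 n4 n5 m3 m6 eqxx/= Yzi Yhi; ring.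
- move=> l li lzi; rewrite /X2 /s2 /X1 /s1.
  have [->//|lhr] := eqVneq l hr; have [->//|lzr] := eqVneq l zr => /=.
  by rewrite (negbTE lzi); apply: Yl; rewrite !inE !negb_or lhr li lzr lzi.
Qed.

End family_rotations.

Section mmse_rotation.
Context {R : realType} {d : measure_display} {Omega : measurableType d}.
Variables (P : probability Omega R) (T : finType).
Local Notation J := (T * bool * bool)%type.
Variables (X Y : J -> Omega -> R) (s t : J -> R) (a p q vh vz : T -> R).
Hypotheses (gX : gaussian_family P X s) (s0 : forall i, 0 < s i) (t0 : forall i, 0 < t i).
Hypotheses (sE : forall u re ch, s (u, re, ch) ^+ 2 = if ch then vh u else vz u)
  (tE : forall u re ch, t (u, re, ch) ^+ 2 = (if ch then a u else 1 - a u) * vh u).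
Hypotheses (a0 : forall u, 0 < a u) (pq0 : forall u, 0 < p u ^+ 2 + q u ^+ 2)
  (orth : forall u, a u * (1 - a u) * vh u = (p u ^+ 2 + q u ^+ 2) * vz u).
Hypothesis YE : forall u re w, Y (u, re, true) w = a u * X (u, re, true) w +
  if re then p u * X (u, true, false) w - q u * X (u, false, false) w
  else q u * X (u, true, false) w + p u * X (u, false, false) w.
Hypothesis YF : forall u re w, Y (u, re, false) w = X (u, re, true) w - Y (u, re, true) w.

(** Each index [u], a user and an antenna in the application, owns a block of four coordinates
    disjoint from the others. The blocks are treated one after another, [Z S] being the family with
    the blocks in [S] already replaced. *)
Lemma gaussian_family_mmse : gaussian_family P Y t.
Proof.
pose Z (S : seq T) (i : J) := if i.1.1 \in S then Y i else X i.
pose r (S : seq T) (i : J) := if i.1.1 \in S then t i else s i.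
have key (S : seq T) : uniq S -> gaussian_family P (Z S) (r S).
  elim: S => [//|u S IH] /= /andP[uS uqS].
  have rS0 S' i : 0 < r S' i by rewrite /r; case: ifP.
  apply: (gaussian_family_mmse4 (hr := (u, true, true)) (hi := (u, false, true))
    (zr := (u, true, false)) (zi := (u, false, false)) (a := a u) (p := p u) (q := q u)
    (vh := vh u) (vz := vz u) (IH uqS)) => //;
    rewrite /r /Z /= ?mem_head ?(negbTE uS) ?sE ?tE//.
  - by rewrite !inE !xpair_eqE !eqxx.
  - move=> [[u' re] ch] /=; have [->|nu _] := eqVneq u' u.
      by case: re; case: ch; rewrite !inE !xpair_eqE !eqxx.
    by rewrite in_cons (negbTE nu).
have := key (enum T) (enum_uniq T).
by congr (gaussian_family _ _ _); apply/funext => i; rewrite /Z /r mem_enum.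
Qed.

End mmse_rotation.

(** * Received powers and gains under zero-forcing precoding *)

Section zf_downlink.
Context {R : realType} {d : measure_display} {Omega : measurableType d}.
Variables (P : probability Omega R) (M K : nat).
Local Notation C := R[i].
Local Notation J := ('I_K * 'I_M * bool * bool)%type.
Variables (h hh : 'I_K -> Omega -> 'cV[C]_M).

(** The indexing of the model, with the estimate in place of the channel and the error in place of
    the noise, so that [est_mx] and [chan_vec] give back [hh] and [h]. *)
Definition chan_parts (i : J) (w : Omega) : R :=
  let: (k, m, re, est) := i in
  let c := (if est then hh k w else h k w - hh k w) m 0 in
  if re then complex.Re c else complex.Im c.

Variables (s : J -> R) (g er : 'I_K -> R).
Hypotheses (gX : gaussian_family P chan_parts s) (s0 : forall i, 0 < s i).
Hypothesis sE : forall k m re, s (k, m, re, true) ^+ 2 = g k / 2.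
Hypothesis sErr : forall k m re, s (k, m, re, false) ^+ 2 = er k / 2.
Hypotheses (g0 : forall k, 0 < g k) (hMK : (K < M)%N).
Local Notation x w := (chan_parts ^~ w).
Local Notation Ex := (Ex P chan_parts).

Definition zf_power a : R := Ex (fun y : J -> R => ndiag y a).

Lemma HmatE w : Hmat hh w = est_mx (x w).
Proof. by apply/matrixP => m k; rewrite !mxE /=; case: (hh k w m 0). Qed.

Lemma chanE k w : h k w = chan_vec k (x w).
Proof.
apply/matrixP => m j; rewrite (ord1 j) !mxE /= !mxE.
by case: (h k w m 0) (hh k w m 0) => [a b] [a' b'] /=; congr Complex; rewrite subrKC.
Qed.

Lemma scale_zf_comb (r : R) c (y : J -> R) :
  RC r *: (zf_comb c y : 'cV[C]_M) = zf_comb (fun a => r * c a) y.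
Proof.
rewrite /zf_comb scalemxAr; congr (_ *m _).
by apply/matrixP => i j; rewrite !mxE RCM.
Qed.

Lemma sum_zf_comb (c : 'I_K -> 'I_K -> R) (y : J -> R) :
  \sum_k (zf_comb (c k) y : 'cV[C]_M) = zf_comb (fun a => \sum_k c k a) y.
Proof.
rewrite /zf_comb -mulmx_sumr; congr (_ *m _).
by apply/matrixP => i j; rewrite summxE !mxE RC_sum; apply: eq_bigr => k _; rewrite mxE.
Qed.

Lemma zf_dirE k w : zf_dir hh k w = zf_comb (fun a => (a == k)%:R) (x w).
Proof.
have adjE : ctr (Hmat hh w) = adjm (Hmat hh w).
  by apply/matrixP => i j; rewrite !mxE cconjE.
rewrite /zf_dir /zf_comb /zf_mx /inv_gram /gram adjE HmatE; congr (_ *m _).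
by apply/matrixP => i j; rewrite !mxE RC_nat.
Qed.

Lemma zf_power_gt0 k : 0 < zf_power k.
Proof. exact: (Ex_ndiag_gt0 gX s0 sE g0 hMK). Qed.

Lemma zf_dir_power k : rexp P (fun w => cnorm2 (zf_dir hh k w)) = zf_power k.
Proof.
under eq_fun do rewrite zf_dirE.
rewrite -[LHS]/(Ex (fun y => cnorm2 (zf_comb (fun a => (a == k)%:R) y))).
rewrite (Ex_zf_comb_norm gX s0 sE g0 hMK) (bigD1 k)//= eqxx expr1n mul1r big1 ?addr0// => a ak.
by rewrite (negbTE ak) expr0n mul0r.
Qed.

Lemma sum_zf_precoder (c : 'I_K -> R) w :
  \sum_k RC (c k) *: zf_precoder P hh k w =
  zf_comb (fun a => c a / Num.sqrt (zf_power a)) (x w).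
Proof.
transitivity (\sum_k (zf_comb (fun a => c k * ((Num.sqrt (zf_power k))^-1 * (a == k)%:R)) (x w) : 'cV[C]_M)).
  apply: eq_bigr => k _.
  by rewrite /zf_precoder zf_dir_power zf_dirE !scale_zf_comb.
rewrite sum_zf_comb; congr zf_comb; apply/funext => a.
rewrite (bigD1 a)//= eqxx mulr1 big1 ?addr0// => k ka.
by rewrite eq_sym (negbTE ka) !mulr0.
Qed.

Lemma zf_precoderE k w :
  zf_precoder P hh k w = zf_comb (fun a => (a == k)%:R / Num.sqrt (zf_power a)) (x w).
Proof.
rewrite -sum_zf_precoder (bigD1 k)//= eqxx big1 => [|a ak].
  by rewrite (RC_nat 1) scale1r addr0.
by rewrite (negbTE ak) (RC_nat 0) scale0r.
Qed.

Let sq k (c : R) : (c / Num.sqrt (zf_power k)) ^+ 2 = c ^+ 2 / zf_power k.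
Proof. by rewrite expr_div_n sqr_sqrtr// ltW// zf_power_gt0. Qed.

(** Normalization divides c_a by the root of n_a, so n_a cancels in the error term and every signal
    leaks er_k c_a^2; only the signal intended for user k keeps the factor 1 / n_k. *)
Lemma zf_received_power c k :
  rexp P (fun w => cabs2 (cdot (h k w) (\sum_k' RC (c k') *: zf_precoder P hh k' w))) =
  c k ^+ 2 / zf_power k + er k * \sum_k' c k' ^+ 2.
Proof.
under eq_fun do rewrite sum_zf_precoder chanE.
rewrite -[LHS]/(Ex (fun y => cabs2 (cdot (chan_vec k y)
   (zf_comb (fun a => c a / Num.sqrt (zf_power a)) y)))).
rewrite (Ex_chan_cabs2 gX s0 sE sErr g0 hMK) sq; congr (_ + _ * _).
by apply: eq_bigr => a _; rewrite sq -/(zf_power a) divfK// gt_eqF// zf_power_gt0.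
Qed.

Lemma zf_cross_power k k' :
  rexp P (fun w => cabs2 (cdot (h k w) (zf_precoder P hh k' w))) =
  (k == k')%:R / zf_power k + er k.
Proof.
have E w : zf_precoder P hh k' w = \sum_j RC ((j == k')%:R) *: zf_precoder P hh j w.
  by rewrite sum_zf_precoder zf_precoderE.
under eq_fun do rewrite E.
rewrite zf_received_power (bigD1 k')//= eqxx big1 => [|a ak].
  by rewrite expr1n addr0 mulr1; case: eqP => _; rewrite ?expr1n ?expr0n.
by rewrite (negbTE ak) expr0n.
Qed.

Lemma zf_gain k :
  cabs2 (cexp P (fun w => cdot (h k w) (zf_precoder P hh k w))) = (zf_power k)^-1.
Proof.
rewrite /cexp; under eq_fun do rewrite zf_precoderE chanE.
under [in X in Complex _ X]eq_fun do rewrite zf_precoderE chanE.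
rewrite -[rexp P _]/(Ex (fun y => complex.Re (cdot (chan_vec k y)
   (zf_comb (fun a => (a == k)%:R / Num.sqrt (zf_power a)) y)))).
rewrite (Ex_chan_Re gX s0 sE g0 hMK).
rewrite -[rexp P _]/(Ex (fun y => complex.Im (cdot (chan_vec k y)
   (zf_comb (fun a => (a == k)%:R / Num.sqrt (zf_power a)) y)))).
by rewrite (Ex_chan_Im gX s0 sE g0 hMK) /cabs2/= sq eqxx expr1n expr0n addr0 mul1r.
Qed.

Lemma zf_power_inv_ge k : (M - K)%:R * g k <= (zf_power k)^-1.
Proof.
have mk0 : 0 < (M - K)%:R * g k by rewrite mulr_gt0// ltr0n subn_gt0.
have := Ex_ndiag_le gX s0 sE g0 hMK k; rewrite -/(zf_power k).
move=> le; rewrite -[leLHS]invrK lef_pV2 ?posrE ?invr_gt0//.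
exact: zf_power_gt0.
Qed.

End zf_downlink.

Lemma cabs2M {R : realType} (x y : R[i]) : cabs2 (x * y) = cabs2 x * cabs2 y.
Proof. by rewrite /cabs2 creM cimM; ring. Qed.

Lemma cabs2_RC {R : realType} (x : R) : cabs2 (RC x) = x ^+ 2.
Proof. by rewrite /cabs2/= expr0n addr0. Qed.

Lemma cabs2_conj {R : realType} (z : R[i]) : cabs2 (cconj z) = cabs2 z.
Proof. by rewrite /cabs2/= sqrrN. Qed.

Lemma cabs2_gt0 {R : realType} (z : R[i]) : z != 0 -> 0 < cabs2 z.
Proof.
move=> z0; rewrite lt_neqAle cabs2_ge0 andbT eq_sym; apply: contra z0.
by rewrite eq_complex /cabs2 paddr_eq0 ?sqr_ge0// !sqrf_eq0.
Qed.

Lemma ler_log2 {R : realType} (x y : R) : 0 < x -> x <= y -> log2 x <= log2 y.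
Proof.
move=> x0 xy; rewrite /log2 ler_pM2r ?invr_gt0 ?ln_gt0 ?ltr1n//.
by rewrite ler_ln// posrE//; exact: lt_le_trans xy.
Qed.

(** * Channel estimates and estimation errors of the pilot model *)

Section channel_estimate.
Context {R : realType} {d : measure_display} {Omega : measurableType d}.
Variables (P : probability Omega R) (M K : nat) (Phi : R[i]) (rho sigma2 : R).
Hypotheses (hPhi : Phi != 0) (hrho : 0 < rho) (hsigma2 : 0 < sigma2).
Variables (dD : 'I_M -> R[i]) (beta pp : 'I_K -> R).
Hypotheses (hdD : forall m, cabs2 (dD m) = 1)
  (hbeta : forall k, 0 < beta k) (hpp : forall k, 0 < pp k).
Variables (h z : 'I_K -> Omega -> 'cV[R[i]]_M).
Local Notation J := ('I_K * 'I_M * bool * bool)%type.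
Hypothesis hindep : mutually_independent P (fun i : J => let: (k, m, re, ch) := i in
  fun w => let c := (if ch then h k w else z k w) m 0 in
           if re then complex.Re c else complex.Im c).
Hypotheses
  (hh_re : forall k m, normal_rv P (fun w => complex.Re (h k w m 0)) (Num.sqrt (beta k / 2)))
  (hh_im : forall k m, normal_rv P (fun w => complex.Im (h k w m 0)) (Num.sqrt (beta k / 2)))
  (hz_re : forall k m, normal_rv P (fun w => complex.Re (z k w m 0)) (Num.sqrt (sigma2 / 2)))
  (hz_im : forall k m, normal_rv P (fun w => complex.Im (z k w m 0)) (Num.sqrt (sigma2 / 2))).
Local Notation hh := (hhat rho sigma2 Phi dD beta pp h z).
Local Notation e := (err_var rho sigma2 Phi beta pp).

Let A k : R := rho * beta k * K%:R * pp k * cabs2 Phi.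
Let A0 k : 0 < A k.
Proof.
have K0 : (0 < K)%N by case: k => i /=; exact: leq_ltn_trans.
by rewrite /A !mulr_gt0 ?ltr0n// cabs2_gt0.
Qed.
Let den0 k : 0 < A k + sigma2. Proof. exact: addr_gt0. Qed.

(** The shrinkage factor of linear MMSE estimation: this fraction of beta_k is the variance of the
    estimate, and the remaining fraction is the error variance. *)
Definition est_gain k : R := A k / (A k + sigma2).

Let gain0 k : 0 < est_gain k. Proof. by rewrite divr_gt0. Qed.
Let gainC k : 1 - est_gain k = sigma2 / (A k + sigma2).
Proof. by rewrite /est_gain; field; rewrite gt_eqF. Qed.

Lemma err_varE k : e k = (1 - est_gain k) * beta k.
Proof.
rewrite gainC /err_var (_ : rho * _ * pp k * beta k * cabs2 Phi = A k); last by rewrite /A; ring.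
by ring.
Qed.

Lemma est_varE k : beta k - e k = est_gain k * beta k.
Proof. by rewrite err_varE; ring. Qed.

Lemma est_var_gt0 k : 0 < beta k - e k. Proof. by rewrite est_varE mulr_gt0. Qed.

Lemma err_var_gt0 k : 0 < e k. Proof. by rewrite err_varE gainC mulr_gt0 ?divr_gt0. Qed.

Definition est_std (i : J) : R := let: (k, m, re, est) := i in
  Num.sqrt ((if est then beta k - e k else e k) / 2).

Lemma est_std_gt0 i : 0 < est_std i.
Proof.
case: i => [[[k m] re] est]; rewrite sqrtr_gt0 divr_gt0//.
by case: est; [exact: est_var_gt0|exact: err_var_gt0].
Qed.

Lemma est_std_sqr k m re est : est_std (k, m, re, est) ^+ 2 = (if est then beta k - e k else e k) / 2.
Proof.
rewrite sqr_sqrtr// divr_ge0//.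
by case: est; apply: ltW; [exact: est_var_gt0|exact: err_var_gt0].
Qed.

Lemma gaussian_family_est : gaussian_family P (chan_parts h hh) est_std.
Proof.
pose X (i : J) w := let: (k, m, re, ch) := i in
  let c := (if ch then h k w else z k w) m 0 in if re then complex.Re c else complex.Im c.
pose s (i : J) : R := let: (k, m, re, ch) := i in Num.sqrt ((if ch then beta k else sigma2) / 2).
(* The coefficient of the noise entry in the estimate; the unit-modulus diagonal of D disappears
   from its squared modulus. *)
pose c2 (u : 'I_K * 'I_M) : R[i] :=
  RC (Num.sqrt (rho * K%:R * pp u.1) * beta u.1 / (A u.1 + sigma2)) * cconj Phi * cconj (dD u.2).
have c2E u : cabs2 (c2 u) = A u.1 * beta u.1 / (A u.1 + sigma2) ^+ 2.
  have r0 : 0 <= rho * K%:R * pp u.1 by rewrite !mulr_ge0 ?ler0n// ltW.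
  rewrite /c2 !cabs2M !cabs2_conj cabs2_RC hdD mulr1 expr_div_n exprMn sqr_sqrtr//.
  by rewrite mulrAC; congr (_ / _); rewrite /A; ring.
have gX : gaussian_family P X s.
  split.
    move: hindep; congr (mutually_independent _ _).
    by apply/funext => -[[[k m] re] ch].
  by move=> [[[k m] re] ch]; rewrite /X /s; case: ch; case: re.
apply: (gaussian_family_mmse (a := fun u => est_gain u.1) (p := fun u => complex.Re (c2 u))
  (q := fun u => complex.Im (c2 u)) (vh := fun u => beta u.1 / 2) (vz := fun=> sigma2 / 2) gX) => //.
- by move=> [[[k m] re] ch]; rewrite sqrtr_gt0; case: ch; rewrite divr_gt0.
- exact: est_std_gt0.
- by move=> [k m] re ch; rewrite /s sqr_sqrtr; case: ch; rewrite // divr_ge0// ltW.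
- by move=> [k m] re ch; rewrite est_std_sqr est_varE err_varE; case: ch => /=; rewrite mulrA.
- by move=> u; rewrite -[_ + _]/(cabs2 (c2 u)) c2E divr_gt0 ?exprn_gt0// mulr_gt0.
(* Estimate and error are uncorrelated: with A = [A u.1], both sides equal A beta sigma2 / (2 (A +
   sigma2)^2). *)
- move=> u; rewrite -[_ ^+ 2 + _]/(cabs2 (c2 u)) c2E gainC /est_gain.
  by field; rewrite gt_eqF.
- move=> [k m] re w.
  have -> : chan_parts h hh (k, m, re, true) w =
      let c := RC (est_gain k) * h k w m 0 + c2 (k, m) * z k w m 0 in
      if re then complex.Re c else complex.Im c.
    by rewrite /= !mxE /c2 /est_gain/= !mulrA.
  by case: re => /=; rewrite ?creD ?cimD ?creM ?cimM /=; ring.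
- move=> [k m] re w; rewrite /= ![(h k w - _) m 0]mxE [(- _ : 'cV_M) m 0]mxE.
  by case: re; case: (h k w m 0) (hh k w m 0) => [? ?] [? ?].
Qed.

End channel_estimate.

(** * Lower bounds on harvested energy and downlink rate *)

Theorem theorem4
  (R : realType) (d : measure_display) (Omega : measurableType d)
  (P : probability Omega R)
  (M K T TD : nat) (hM : (0 < M)%N) (hK : (0 < K)%N) (hT : (0 < T)%N)
  (hMK : (K < M)%N)
  (Phi : R[i]) (hPhi : Phi != 0)
  (rho sigma2 : R) (hrho : 0 < rho) (hsigma2 : 0 < sigma2)
  (dD : 'I_M -> R[i]) (hdD : forall m, cabs2 (dD m) = 1)
  (beta pp : 'I_K -> R) (hbeta : forall k, 0 < beta k) (hpp : forall k, 0 < pp k)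
  (h z : 'I_K -> Omega -> 'cV[R[i]]_M)
  (* all real and imaginary parts of all entries of h_1..h_K, z_1..z_K are
     mutually independent; index (k, m, is_real_part, is_channel) *)
  (hindep : mutually_independent P
     (fun i : 'I_K * 'I_M * bool * bool =>
        let: (k, m, re, ch) := i in
        fun w => let c := (if ch then h k w else z k w) m 0 in
                 if re then complex.Re c else complex.Im c))
  (* h_k ~ CN(0, beta_k I_M): entries with iid N(0, beta_k/2) real/imag parts *)
  (hh_re : forall k m, normal_rv P (fun w => complex.Re (h k w m 0)) (Num.sqrt (beta k / 2)))
  (hh_im : forall k m, normal_rv P (fun w => complex.Im (h k w m 0)) (Num.sqrt (beta k / 2)))
  (* z_k ~ CN(0, sigma^2 I_M) *)
  (hz_re : forall k m, normal_rv P (fun w => complex.Re (z k w m 0)) (Num.sqrt (sigma2 / 2)))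
  (hz_im : forall k m, normal_rv P (fun w => complex.Im (z k w m 0)) (Num.sqrt (sigma2 / 2)))
  (rhoRF etaEH : R) (hrhoRF : 0 < rhoRF) (heta : 0 < etaEH <= 1)
  (ps sRF2 ss2 alpha : 'I_K -> R)
  (hps : forall k, 0 <= ps k) (hsRF2 : forall k, 0 < sRF2 k) (hss2 : forall k, 0 < ss2 k)
  (halpha : forall k, 0 <= alpha k <= 1) :
  let hh := hhat rho sigma2 Phi dD beta pp h z in
  let w := zf_precoder P hh in
  let e := err_var rho sigma2 Phi beta pp in
  forall k : 'I_K,
    (TD%:R / T%:R) * etaEH * (1 - alpha k) *
      (rhoRF * ps k * (M - K)%:R * (beta k - e k) +
       \sum_(k' < K) rhoRF * ps k' * e k)
    <= harvested P TD T etaEH rhoRF alpha ps h w k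
  /\
    (TD%:R / T%:R) *
      log2 (1 + rhoRF * ps k * alpha k * (M - K)%:R * (beta k - e k) /
                (alpha k * e k * (\sum_(k' < K) rhoRF * ps k')
                 + alpha k * sRF2 k + ss2 k))
    <= rateD P TD T rhoRF alpha ps sRF2 ss2 h w k.

Proof.
set gX := gaussian_family_est hPhi hrho hsigma2 hdD hbeta hpp hindep hh_re hh_im hz_re hz_im.
move=> hh w e k.
have s0 := est_std_gt0 hPhi hrho hsigma2 hbeta hpp (M := M).
have ssq := est_std_sqr hPhi hrho hsigma2 hbeta hpp (M := M).
have g0 := est_var_gt0 hPhi hrho hsigma2 hbeta hpp.
have e0 := err_var_gt0 hPhi hrho hsigma2 hbeta hpp.
have sE k' (m : 'I_M) re := ssq k' m re true.
have sErr k' (m : 'I_M) re := ssq k' m re false.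
have TT0 : 0 <= TD%:R / T%:R :> R by rewrite divr_ge0 ?ler0n.
have /andP[al0 al1] := halpha k; have /andP[eta0 _] := heta.
set n := zf_power P h hh k.
(* Energy and SINR are computed exactly below as nondecreasing functions of 1 / n; this bound is
   then substituted in both. *)
have n_ge : (M - K)%:R * (beta k - e k) <= n^-1 := zf_power_inv_ge gX s0 sE g0 hMK k.
have ps0 k' : 0 <= rhoRF * ps k' by rewrite mulr_ge0// ltW.
split.
  apply: ler_wpM2l.
    by apply: mulr_ge0; [apply: mulr_ge0 => //; exact: ltW|rewrite subr_ge0].
  rewrite (zf_received_power gX s0 sE sErr g0 hMK) sqr_sqrtr// -/n.
  apply: lerD; first by rewrite -mulrA ler_wpM2l.
  rewrite mulr_sumr le_eqVlt; apply/orP; left; apply/eqP.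
  by apply: eq_bigr => k' _; rewrite sqr_sqrtr// mulrC.
apply: ler_wpM2l => //; set Q := \sum_(k' < K) rhoRF * ps k'.
have Q0 : 0 <= Q by exact: sumr_ge0.
set D := alpha k * e k * Q + alpha k * sRF2 k + ss2 k.
have D0 : 0 < D.
  rewrite ltr_wpDl// addr_ge0//; last by rewrite mulr_ge0// ltW.
  by apply: mulr_ge0 => //; apply: mulr_ge0 => //; exact: ltW (e0 k).
(* The subtracted squared mean gain cancels the 1 / n term of the total received power, so the
   denominator is [D], which does not depend on n. *)
have -> : sinrD P rhoRF alpha ps sRF2 ss2 h w k = rhoRF * ps k * alpha k * n^-1 / D.
  rewrite /sinrD (zf_gain gX s0 sE g0 hMK) -/n.
  have -> : \sum_(k' < K) rhoRF * ps k' * rexp P (fun w' => cabs2 (cdot (h k w') (w k' w'))) =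
      rhoRF * ps k / n + e k * Q.
    under eq_bigr do rewrite (zf_cross_power gX s0 sE sErr g0 hMK) mulrDr.
    rewrite big_split/= -mulr_suml mulrC -/Q mulrC [Q * _]mulrC; congr (_ + _).
    rewrite (bigD1 k)//= eqxx mul1r big1 ?addr0// => k' kk'.
    by rewrite eq_sym (negbTE kk') mul0r mulr0.
  by congr (_ / _); rewrite ?/D; ring.
have c0 : 0 <= rhoRF * ps k * alpha k by rewrite mulr_ge0.
apply: ler_log2.
  rewrite ltr_pwDl// divr_ge0 ?(ltW D0)// -mulrA mulr_ge0// mulr_ge0 ?ler0n//.
  by apply: ltW; exact: g0.
by rewrite lerD2l ler_pM2r ?invr_gt0// -mulrA ler_wpM2l.
Qed.
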